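(* Let $n\ge 2$ and let $\mathrm{QP}_{n+1}$ be the bi-cyclopermutohedron. For integers $i$ put $\xi(n,i)=\sum_{k=0}^{i}\binom{n}{k}$, let $\mathbb{Z}_2=\mathbb{Z}/2\mathbb{Z}$, and let $\bigoplus_m G$ denote the direct sum of $m$ copies of $G$. The integral homology of $\mathrm{QP}_{n+1}$ is as follows. If $n$ is even, then $$H_i(\mathrm{QP}_{n+1},\mathbb{Z})\cong\begin{cases}\displaystyle\bigoplus_{\xi(n,i)}\mathbb{Z}_2, & i\text{ odd and }0\le i\le n-2,\\ \displaystyle\bigoplus_{\binom{n}{i}}\mathbb{Z}, & i\text{ even and }0\le i\le n-2,\\ 0,&\text{otherwise.}\end{cases}$$ If $n$ is odd, then $$H_i(\mathrm{QP}_{n+1},\mathbb{Z})\cong\begin{cases}\displaystyle\bigoplus_{\xi(n,i)}\mathbb{Z}, & i=n-2,\\ \displaystyle\bigoplus_{\xi(n,i)}\mathbb{Z}_2, & i\text{ odd and }0\le i< n-2,\\ \displaystyle\bigoplus_{\binom{n}{i}}\mathbb{Z}, & i\text{ even and }0\le i\le n-2,\\ 0,&\text{otherwise.}\end{cases}$$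
   Context: Write $[n+1]=\{1,\dots,n+1\}$. A linearly ordered partition of $[n+1]$ into $m$ blocks is a tuple $(I_1,\dots,I_m)$ of nonempty pairwise disjoint subsets with union $[n+1]$. A cyclically ordered partition is an equivalence class of linearly ordered partitions under cyclic permutation of the blocks; it is always represented by the linearly ordered partition in which the block containing $n+1$ comes last. The cyclopermutohedron $\mathrm{CP}_{n+1}$ is the regular CW complex of dimension $n-2$ whose $k$-cells, $0\le k\le n-2$, are labeled by all cyclically ordered partitions of $[n+1]$ into $n-k+1$ blocks (so there are always at least 3 blocks). A closed cell $F$ contains a cell $F'$ iff the label of $F'$ refines the label of $F$ in an orientation-preserving way, i.e. the label of $F$ is obtained from that of $F'$ by replacing runs of cyclically consecutive blocks by their unions, keeping the cyclic order. (A regular CW complex is determined up to homeomorphism by its face poset.) The map $r:(I_1,I_2,\dots,I_{k-1},I_k)\mapsto(I_{k-1},\dots,I_2,I_1,I_k)$ (with $n+1\in I_k$) is a fixed-point-free cellular involution of $\mathrm{CP}_{n+1}$. The bi-cyclopermutohedron is the quotient $\mathrm{QP}_{n+1}=\mathrm{CP}_{n+1}/\mathbb{Z}_2$ by this involution. It is a regular CW complex whose $k$-cells, $0\le k\le n-2$, are labeled by bi-cyclically ordered partitions of $[n+1]$ into $n-k+1$ blocks, i.e. classes $\{\lambda,r(\lambda)\}$ of cyclically ordered partitions; a closed cell contains a cell $F'$ iff the label of $F'$ refines its label (i.e. some representative of the label of $F'$ refines some representative of the other label). *)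

(* Defs.v *)
From HB Require Import structures.
From mathcomp Require Import all_boot all_order all_algebra.
From mathcomp Require Import boolp.

Set Implicit Arguments.
Unset Strict Implicit.
Unset Printing Implicit Defensive.

Import GRing.Theory.
Local Open Scope ring_scope.

(* The combinatorial data of a finite regular CW complex: [face y x] means    *)
(* that the closed cell x contains the cell y (so it is reflexive).           *)
Record cell_complex := CellComplex {
  cell : finType;
  face : cell -> cell -> Prop;
  dim : cell -> nat
}.
Arguments face {_} _ _.
Arguments dim {_} _.

Definition facet (X : cell_complex) (y x : cell X) : Prop :=
  face y x /\ dim x = (dim y).+1.

(* Systems of incidence numbers [x : y] on a regular CW complex, as in Massey *)
(* or Cooke-Finney. Orienting the cells of a regular CW complex yields such a *)
(* system, and every such system arises from a choice of orientations (the    *)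
(* vertices being positively oriented), so that each of them presents the     *)
(* cellular chain complex. [inc_edge] says that the two end points of an edge *)
(* have opposite signs. In [inc_square], if z is a face of x of codimension   *)
(* 2, then exactly two cells y, y' lie strictly between them and the equation *)
(* reads [x:y][y:z] + [x:y'][y':z] = 0; for all other x, z it is automatic.   *)
Record incidence (X : cell_complex) := Incidence {
  inc :> cell X -> cell X -> int;
  inc_facet : forall x y, facet y x -> inc x y = 1 \/ inc x y = -1;
  inc_nfacet : forall x y, ~ facet y x -> inc x y = 0;
  inc_edge : forall x, dim x = 1%N -> \sum_y inc x y = 0;
  inc_square : forall x z, \sum_y inc x y * inc y z = 0
}.

Section CellularHomology.
Variables (X : cell_complex) (e : incidence X).

(* C_i is the subgroup of the chains supported by the i-cells of X. *)
Definition chain : zmodType := {ffun cell X -> int}.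

Definition homogeneous (i : int) (c : chain) : bool :=
  [forall x, (c x != 0) ==> ((dim x)%:Z == i)].

Definition boundary (c : chain) : chain := [ffun y => \sum_x c x * e x y].

Lemma homogeneous0 i : homogeneous i 0.
Proof. by apply/forallP => x; rewrite ffunE eqxx. Qed.

Lemma homogeneousB i c d :
  homogeneous i c -> homogeneous i d -> homogeneous i (c - d).
Proof.
move=> /forallP hc /forallP hd; apply/forallP => x; apply/implyP.
rewrite !ffunE; have [-> | c0 _] := eqVneq (c x) 0.
  by rewrite add0r oppr_eq0; apply/implyP/hd.
exact: implyP (hc x) c0.
Qed.

Lemma boundary_is_zmod_morphism : zmod_morphism boundary.
Proof.
move=> c d; apply/ffunP => y; rewrite !ffunE -sumrB.
by apply: eq_bigr => x _; rewrite !ffunE mulrBl.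
Qed.

HB.instance Definition _ :=
  GRing.isZmodMorphism.Build chain chain boundary boundary_is_zmod_morphism.

Section Degree.
Variable i : int.

Definition is_cycle : {pred chain} :=
  fun c => homogeneous i c && (boundary c == 0).

Lemma is_cycle_zmod_closed : zmod_closed is_cycle.
Proof.
split; first by rewrite unfold_in homogeneous0 raddf0 eqxx.
move=> c d /andP[hc /eqP bc] /andP[hd /eqP bd].
by rewrite unfold_in homogeneousB // raddfB /= bc bd subrr eqxx.
Qed.

HB.instance Definition _ :=
  GRing.isZmodClosed.Build chain is_cycle is_cycle_zmod_closed.

Record cycle := Cycle { cycle_val :> chain; cycleP : cycle_val \in is_cycle }.

HB.instance Definition _ := [isSub for cycle_val].
HB.instance Definition _ := [Choice of cycle by <:].
HB.instance Definition _ := [SubChoice_isSubZmodule of cycle by <:].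

Definition is_boundary : {pred cycle} :=
  fun z => `[< exists2 b : chain, homogeneous (i + 1) b
                                & boundary b = cycle_val z >].

Lemma is_boundary_zmod_closed : zmod_closed is_boundary.
Proof.
split; first by apply/asboolP; exists 0; rewrite ?homogeneous0 ?raddf0.
move=> y z /asboolP[b hb eb] /asboolP[c hc ec]; apply/asboolP.
by exists (b - c); rewrite ?homogeneousB // raddfB /= eb ec.
Qed.

HB.instance Definition _ :=
  GRing.isZmodClosed.Build cycle is_boundary is_boundary_zmod_closed.

Definition homology : zmodType := Quotient.quot is_boundary.

End Degree.
End CellularHomology.

Definition isomorphic (A B : zmodType) : Prop :=
  exists f : {additive A -> B}, bijective f.

Definition direct_sum (m : nat) (G : zmodType) : zmodType := {ffun 'I_m -> G}.

(* The set [n+1] is 'I_n.+1, its element n+1 being ord_max. An ordered        *)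
(* partition is the sequence of its blocks, of which there are at most n+1.   *)
Section BiCyclopermutohedron.
Variable n : nat.

Local Notation block := {set 'I_n.+1}.
Local Notation blocks := (n.+1.-bseq block).

Definition linearly_ordered_partition (p : blocks) : bool :=
  [&& set0 \notin (p : seq block), pairwise (fun A B : block => [disjoint A & B]) p
    & \bigcup_(B <- p) B == setT].

(* Labels of cells of the cyclopermutohedron: cyclically ordered partitions   *)
(* with at least 3 blocks, represented with the block of n+1 in last place.   *)
Definition cyclic_label (p : blocks) : bool :=
  [&& linearly_ordered_partition p, (3 <= size p)%N
    & ord_max \in last set0 p].

(* Some rotation of p can be cut into runs of consecutive blocks whose unions *)
(* are, in order, the blocks of q.                                            *)
Definition cyclic_refines (p q : blocks) : Prop :=
  exists (j : nat) (runs : seq (seq block)),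
    flatten runs = rot j p /\
    [seq \bigcup_(B <- s) B | s <- runs] = q :> seq block.

(* rev gives (I_k, I_{k-1}, ..., I_1); rot 1 moves I_k back to the end. *)
Definition reflect_label (p : blocks) : blocks := [bseq of rot 1 (rev p)].

Definition is_bicyclic_label (x : {set blocks}) : bool :=
  [exists p, cyclic_label p && (x == [set p; reflect_label p])].

Definition bicyclic_label := {x : {set blocks} | is_bicyclic_label x}.

(* A k-cell has n - k + 1 blocks; both representatives have the same number   *)
(* of blocks.                                                                 *)
Definition bicyclic_dim (x : bicyclic_label) : nat :=
  (n.+1 - \max_(p in val x) size p)%N.

Definition bicyclic_face (y x : bicyclic_label) : Prop :=
  exists p q, [/\ p \in val y, q \in val x & cyclic_refines p q].

Definition QP : cell_complex := CellComplex bicyclic_face bicyclic_dim.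

End BiCyclopermutohedron.

Definition xi (n i : nat) : nat := (\sum_(k < i.+1) 'C(n, k))%N.

(* Main.v *)
From HB Require Import structures.
From mathcomp Require Import all_boot all_order all_algebra.
From mathcomp Require Import zify ring.
From mathcomp Require boolp.
Require Import Defs.

(** A cyclically ordered partition of {1, ..., n+1} into m+1 blocks is the same
    thing as a word of length n in the letters 0, ..., m in which each of 1, ..., m
    occurs: the letter of a is the number of the block of a, counted cyclically
    from the block of n+1, which has number 0.  Merging the blocks i and i+1
    (cyclically) acts on each letter as the i-th face map of the simplicial circle,
    the 1-simplex with its end points identified; there the letter 0 is the base
    point.  Hence these words are the nondegenerate m-simplices of the n-fold power
    of the circle.  Passing to a face of a cell splits a block, so a chain of
    dimension n-m is a normalised m-cochain of the torus, and the boundary of chains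
    is the coboundary of cochains, in degrees m >= 2.  The reflection of a partition
    is the reversal j |-> m+1-j of the nonzero letters, so the chains of the quotient
    are the cochains that are invariant under a signed reversal, [flip n m].

    The cohomology of the torus is computed by recursion on n, by an explicit chain
    homotopy for the product with a circle: a cocycle is a coboundary if and only if
    its periods over the subtori with m coordinates vanish ([exactness],
    [periods_surjective]).

    In degree at least 2 the reversal acts freely on nondegenerate simplices, so
    every invariant cochain z is a trace y + flip y.  If z is a cocycle, then delta y
    is a cocycle of degree m+1 that is invariant for the opposite sign.  Iterating
    this leads to degrees above n, where all cochains vanish, and on the way back one
    gets the classification of invariant cocycles ([invariant_cocycle_boundary],
    [invariant_cocycle_exists]).  The classes are read off by half periods, which
    relate to periods as hemispheres to spheres.  If n+m is even, each period is
    twice a half period, and the half periods over the m-element sets s are arbitrary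
    integers; this gives a free group of rank C(n, m).  If n+m is odd, periods vanish
    and only the half periods modulo 2 are invariants, one for each set s with at
    least m elements; there are xi(n, n-m) of them.  In degree 2, which is the top
    dimension n-2, there are no coboundaries to divide by; for n odd, cocycles
    correspond to arbitrary functions on the sets with at least two elements
    ([potential]).

    Geometrically, filter by the set s of the positions with a nonzero letter: the
    graded pieces are the shifted chain complexes of the boundaries of the
    permutohedra on s modulo the antipode, that is of real projective spaces, with
    constant or alternating coefficients, and the homology is the sum of theirs.

    It remains to treat all systems of incidence numbers.  One of them makes the
    dictionary above exact: the i-th face has incidence number (-1)^i, corrected by
    orientations of words ([incidence_number]).  Here a vertex is a permutation and is
    oriented by its sign, so that the end points of an edge cancel.  Any other system
    differs from it by a ratio with values in {1, -1}, which is constrained by the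
    diamonds of the face poset and by the edges.  Since the facets of a cell of
    dimension at least 2 are connected through common facets ([facets_connected]), the
    ratio is a coboundary of signs on cells ([incidence_unique]), and a change of
    these signs does not affect homology. *)

Set Implicit Arguments.
Unset Strict Implicit.
Unset Printing Implicit Defensive.

Import Order.TTheory GRing.Theory Num.Theory.
Local Open Scope ring_scope.

(** * Words and their face maps *)

(** Case analysis on innermost conditions first, leaving linear arithmetic: this
    settles identities between piecewise linear maps of letters. *)
Ltac split_ifs :=
  repeat match goal with |- context [if ?b then _ else _] =>
    lazymatch b with
    | context [if _ then _ else _] => fail
    | _ => let h := fresh "h" in case h: b => //=
    end
  end; try lia.

Definition word (n m : nat) (w : seq nat) : bool :=
  (size w == n) && all (fun j => j <= m)%N w.

(** The i-th face map on the (m+1)-simplices of the circle.  The letter j stands for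
    the simplex whose first j vertices lie at one end of the interval; if the face
    has no further vertices, it is the base point, which is why m+1 can become 0. *)
Definition merge_letter (m i j : nat) : nat :=
  (if j <= i then (if j == m.+1 then 0 else j) else j.-1)%N.

Definition cochain := seq nat -> int.

Definition delta (m : nat) (c : cochain) : cochain :=
  fun w => \sum_(0 <= i < m.+2) (-1) ^+ i * c (map (merge_letter m i) w).

(** A simplex is degenerate when some letter in 1, ..., m is missing. *)
Definition normal (n m : nat) (c : cochain) : Prop :=
  forall w j, word n m w -> (0 < j <= m)%N -> j \notin w -> c w = 0.

Lemma word_cons n m j w :
  word n.+1 m (j :: w) = (j <= m)%N && word n m w.
Proof. by rewrite /word /= eqSS; case: (j <= m)%N; rewrite ?andbF. Qed.

Lemma word_map n m m' f w :
  word n m w -> (forall j, (j <= m)%N -> (f j <= m')%N) -> word n m' (map f w).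
Proof.
move=> /andP[/eqP sz /allP h] hf; rewrite /word size_map sz eqxx all_map.
by apply/allP => j /h /= /hf.
Qed.

Lemma eq_map_word n m (f g : nat -> nat) w :
  word n m w -> (forall j, (j <= m)%N -> f j = g j) -> map f w = map g w.
Proof. by move=> /andP[_ /allP h] e; apply/eq_in_map => j /h /e. Qed.

Lemma word_widen n m m' w : (m <= m')%N -> word n m w -> word n m' w.
Proof.
move=> le_m h; rewrite -[w]map_id; apply: word_map h _ => j hj.
exact: leq_trans hj le_m.
Qed.

Lemma word_merge n m i w :
  (i <= m.+1)%N -> word n m.+1 w -> word n m (map (merge_letter m i) w).
Proof.
move=> hi /word_map; apply=> j hj; rewrite /merge_letter.
by case: ifP => ?; [case: ifP|]; lia.
Qed.

Lemma eq_delta n m c c' :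
  (forall w, word n m w -> c w = c' w) ->
  forall w, word n m.+1 w -> delta m c w = delta m c' w.
Proof.
move=> e w hw; rewrite /delta !big_mkord; apply: eq_bigr => i _.
by rewrite e // word_merge // -ltnS.
Qed.

Lemma merge_merge m i j x : (i < j <= m.+2)%N -> (x <= m.+2)%N ->
  merge_letter m i (merge_letter m.+1 j x) = merge_letter m j.-1 (merge_letter m.+1 i x).
Proof.
rewrite /merge_letter => hij hx.
split_ifs.
Qed.

Lemma delta0 m w : delta m (fun=> 0) w = 0.
Proof. by rewrite /delta big1 // => i _; rewrite mulr0. Qed.

Lemma deltaB m c d w : delta m (fun w => c w - d w) w = delta m c w - delta m d w.
Proof. by rewrite /delta -sumrB; apply: eq_bigr => i _; rewrite mulrBr. Qed.

Lemma deltaD m c d w : delta m (fun w => c w + d w) w = delta m c w + delta m d w.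
Proof. by rewrite /delta -big_split; apply: eq_bigr => i _; rewrite /= mulrDr. Qed.

Lemma deltaZ m a c w : delta m (fun w => a * c w) w = a * delta m c w.
Proof. by rewrite /delta mulr_sumr; apply: eq_bigr => i _; rewrite mulrCA. Qed.

(** Under the simplicial identities, the terms with i < j cancel those with j <= i. *)
Lemma alternating_square_sum (k : nat) (F : nat -> nat -> int) :
  (forall i j, (i < j <= k)%N -> F i j = F j.-1 i) ->
  \sum_(0 <= j < k.+1) \sum_(0 <= i < k) (-1) ^+ (i + j) * F i j = 0.
Proof.
move=> sF.
under eq_bigr => j _ do rewrite (bigID (fun i => (i < j)%N)) /=.
rewrite big_split /= big_nat_recl //= [X in X + _ + _]big1_seq ?add0r; last first.
  by move=> i /andP[].
rewrite [X in _ + X]big_nat_recr //= [X in _ + (_ + X)]big1_seq; last first.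
  by move=> i /andP[]; rewrite mem_index_iota; lia.
rewrite addr0 (exchange_big_dep_nat xpredT) //= -big_split /=.
apply: big1_seq => i /andP[_]; rewrite mem_index_iota => hi.
under [X in _ + X]eq_bigl => j do rewrite -leqNgt -ltnS.
rewrite -big_split /= big1_seq // => j /andP[hij]; rewrite mem_index_iota => hj.
by rewrite sF /=; [rewrite addnS exprS addnC; ring | lia].
Qed.

Lemma deltaK n m c w : word n m.+2 w -> delta m.+1 (delta m c) w = 0.
Proof.
move=> hw; rewrite /delta.
under eq_bigr => j _ do rewrite mulr_sumr.
under eq_bigr => j _ do under eq_bigr => i _ do
  rewrite mulrA -exprD addnC -map_comp.
apply: (alternating_square_sum
  (F := fun i j => c (map (merge_letter m i \o merge_letter m.+1 j) w))).
move=> i j hij; congr (c _); apply: (eq_map_word hw) => x hx /=.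
exact: merge_merge.
Qed.

(** * Homotopy for a product with a circle *)

(** The simplex of a product with a circle obtained by shuffling the edge of the circle
    into the degeneracy of w that repeats a vertex at the same place. *)
Definition insert_letter (l : nat) (w : seq nat) : seq nat :=
  l :: map (bump l) w.
Arguments insert_letter : simpl never.

(** The first j of the simplices that triangulate the product of the circle with w;
    all of them together integrate z along the fibre. *)
Definition partial_fiber_sum (j : nat) (z : cochain) : cochain :=
  fun w => \sum_(0 <= l < j) (-1) ^+ l * z (insert_letter l.+1 w).

Lemma word_insert n m l w : (0 < l <= m.+1)%N ->
  word n m w -> word n.+1 m.+1 (insert_letter l w).
Proof.
move=> hl hw; rewrite /insert_letter word_cons; apply/andP; split; first by lia.
by apply: (word_map hw) => j; rewrite /bump; lia.
Qed.

Lemma eq_partial n m j z z' w : (j <= m.+1)%N -> word n m w ->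
  (forall u, word n.+1 m.+1 u -> z u = z' u) ->
  partial_fiber_sum j z w = partial_fiber_sum j z' w.
Proof.
move=> hj hw e; apply: eq_big_nat => l hl.
by rewrite e // word_insert //; lia.
Qed.

Section MergeInsert.
Variables (n m l : nat) (w : seq nat).
Hypotheses (hw : word n m w) (hl : (l <= m)%N).

Lemma merge_insert_lt i : (i < l)%N ->
  map (merge_letter m i) (insert_letter l.+1 w)
  = insert_letter l (map (merge_letter m.-1 i) w).
Proof.
move=> hi; rewrite /insert_letter map_cons; congr (_ :: _).
  by rewrite /merge_letter; split_ifs.
rewrite -!map_comp; apply: (eq_map_word hw) => x hx /=.
by rewrite /merge_letter /bump; split_ifs.
Qed.

Lemma merge_insert_eq : map (merge_letter m l) (insert_letter l.+1 w) = l :: w.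
Proof.
rewrite /insert_letter map_cons; congr (_ :: _).
  by rewrite /merge_letter; split_ifs.
rewrite -[RHS]map_id -!map_comp; apply: (eq_map_word hw) => x hx /=.
by rewrite /merge_letter /bump; split_ifs.
Qed.

Lemma merge_insert_succ :
  map (merge_letter m l.+1) (insert_letter l.+1 w)
  = (if l == m then 0%N else l.+1) :: w.
Proof.
rewrite /insert_letter map_cons; congr (_ :: _).
  by rewrite /merge_letter; split_ifs.
rewrite -[RHS]map_id -!map_comp; apply: (eq_map_word hw) => x hx /=.
by rewrite /merge_letter /bump; split_ifs.
Qed.

Lemma merge_insert_gt i : (l < i <= m)%N ->
  map (merge_letter m i.+1) (insert_letter l.+1 w)
  = insert_letter l.+1 (map (merge_letter m.-1 i) w).
Proof.
move=> hi; rewrite /insert_letter map_cons; congr (_ :: _).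
  by rewrite /merge_letter; split_ifs.
rewrite -!map_comp; apply: (eq_map_word hw) => x hx /=.
by rewrite /merge_letter /bump; split_ifs.
Qed.

End MergeInsert.

Lemma partialS j z w : partial_fiber_sum j.+1 z w =
  partial_fiber_sum j z w + (-1) ^+ j * z (insert_letter j.+1 w).
Proof. by rewrite /partial_fiber_sum big_nat_recr. Qed.

(** The faces l and l+1 of the l-th shuffle are its common faces with its neighbours, and
    contribute the first two terms; the other faces are shuffles of faces of w. *)
Lemma delta_insert n m j z w : word n m w -> (j <= m)%N ->
  (-1) ^+ j * delta m z (insert_letter j.+1 w) =
  z (j :: w) - z ((if j == m then 0%N else j.+1) :: w)
  - \sum_(0 <= i < m.+1) (-1) ^+ i *
     (partial_fiber_sum (if j.+1 <= i then j.+1 else j)%N z (map (merge_letter m.-1 i) w)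
      - partial_fiber_sum (if j <= i then j else j.-1)%N z (map (merge_letter m.-1 i) w)).
Proof.
move=> hw hj; rewrite /delta.
(* the terms i = j, and i = j + 1 on the left, are singled out *)
have cut (F : nat -> int) : \sum_(0 <= i < m.+1) F i =
    \sum_(0 <= i < j) F i + (F j + \sum_(j.+1 <= i < m.+1) F i).
  rewrite (@big_cat_nat _ _ _ j) //=; last by lia.
  by rewrite (@big_ltn _ _ _ j).
have cut2 (F : nat -> int) : \sum_(0 <= i < m.+2) F i = \sum_(0 <= i < j) F i
    + (F j + (F j.+1 + \sum_(j.+1 <= i < m.+1) F i.+1)).
  rewrite (@big_cat_nat _ _ _ j) //=; last by lia.
  rewrite (@big_ltn _ _ _ j); last by lia.
  rewrite (@big_ltn _ _ _ j.+1); last by lia.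
  by rewrite [X in _ + (_ + (_ + X))]big_add1.
rewrite cut cut2 {cut cut2}.
rewrite (merge_insert_eq hw hj) (merge_insert_succ hw hj) leqnn ltnn subrr mulr0 add0r.
rewrite !mulrDr.
have sj : (-1) ^+ j * (-1) ^+ j = 1 :> int by rewrite -expr2 sqrr_sign.
rewrite exprS !mulrA mulrN mulr1 mulNr sj !mul1r mulN1r.
suff [e1 e2] : 
  (-1) ^+ j * (\sum_(0 <= i < j)
      (-1) ^+ i * z (map (merge_letter m i) (insert_letter j.+1 w))) = 
  - (\sum_(0 <= i < j) (-1) ^+ i *
       (partial_fiber_sum (if j < i then j.+1 else j)%N z (map (merge_letter m.-1 i) w)
        - partial_fiber_sum (if j <= i then j else j.-1)%N z (map (merge_letter m.-1 i) w)))
  /\ (-1) ^+ j * (\sum_(j.+1 <= i < m.+1)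
      (-1) ^+ i.+1 * z (map (merge_letter m i.+1) (insert_letter j.+1 w))) = 
  - (\sum_(j.+1 <= i < m.+1) (-1) ^+ i *
       (partial_fiber_sum (if j < i then j.+1 else j)%N z (map (merge_letter m.-1 i) w)
        - partial_fiber_sum (if j <= i then j else j.-1)%N z (map (merge_letter m.-1 i) w))).
  by rewrite e1 e2 opprD !addrA; ring.
split; rewrite mulr_sumr -sumrN; apply: eq_big_nat => i /andP[hi1 hi2].
  rewrite (merge_insert_lt hw) // ltnNge (ltnW hi2) /= leqNgt hi2 /=.
  case: j hi2 {hi1 hj sj} => // j hi2.
  by rewrite partialS exprS /=; ring.
rewrite (merge_insert_gt hw) ?hi1 // (ltnW hi1) partialS.
by rewrite (exprS _ i) /=; ring.
Qed.

(** Summing over shuffles, the common faces telescope, so that only the two ends of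
    the partial triangulation remain. *)
Lemma partial_delta n m j z w : word n m w -> (j <= m.+1)%N ->
  partial_fiber_sum j (delta m z) w =
  z (0%N :: w) - z ((if j == m.+1 then 0%N else j) :: w)
  - \sum_(0 <= i < m.+1) (-1) ^+ i *
      partial_fiber_sum (if j <= i then j else j.-1)%N z (map (merge_letter m.-1 i) w).
Proof.
move=> hw; elim: j => [_|j IH hj].
  rewrite {1}/partial_fiber_sum big_nil /= subrr big1 ?subr0 // => i _.
  by rewrite /partial_fiber_sum big_nil mulr0.
rewrite partialS IH ?(ltnW hj) // (delta_insert z hw) //.
rewrite (_ : (j == m.+1) = false); last by lia.
rewrite eqSS; under [X in _ + (_ - X)]eq_bigr => i _ do rewrite mulrBr.
rewrite sumrB /=; ring.
Qed.

Definition fiber_sum (m : nat) (z : cochain) : cochain := partial_fiber_sum m z.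

(** On the word j :: w, the sum over the part of the triangulation between the words
    0 :: w and j :: w. *)
Definition homotopy (z : cochain) : cochain :=
  fun w => if w is j :: w' then partial_fiber_sum j z w' else 0.

Definition restrict (z : cochain) : cochain := fun w => z (0%N :: w).

Definition pullback (y : cochain) : cochain := fun w => y (behead w).

(** The cross product of v with the generator of the cohomology of the circle, by the
    Alexander-Whitney formula: the generator is evaluated on the last edge of the
    first coordinate, and v on the face opposite to the last vertex. *)
Definition cross (m : nat) (v : cochain) : cochain :=
  fun w => if head 0%N w == m then v (map (merge_letter m.-1 m) (behead w)) else 0.

Lemma fiber_sum_delta n m z w : word n m w ->
  fiber_sum m.+1 (delta m z) w = - delta m.-1 (fiber_sum m z) w.
Proof.
case: m => [|m] hw; rewrite /fiber_sum (partial_delta _ hw) // eqxx subrr sub0r /=.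
  rewrite big_nat1 /delta /partial_fiber_sum big_nil mulr0 big1 // => i _.
  by rewrite big_nil mulr0.
rewrite /delta; congr (- _); apply: eq_big_nat => i /andP[_ hi].
by rewrite leqNgt hi.
Qed.

(** Up to homotopy a cochain of a product with a circle is the sum of its restriction to
    the base point and of the cross product of its integral along the circle: this is
    the Kuenneth formula, in a form that can be iterated over the coordinates. *)
Lemma homotopy_delta n m z w : word n.+1 m.+1 w ->
  homotopy (delta m.+1 z) w =
  pullback (restrict z) w - z w
  - delta m (homotopy z) w
  - (-1) ^+ m.+1 * cross m.+1 (fiber_sum m.+1 z) w.
Proof.
case: w => [//|j w]; rewrite word_cons => /andP[hj hw].
rewrite /homotopy (partial_delta _ hw) ?(leqW hj) //.
rewrite (_ : (j == m.+2) = false); last by lia.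
rewrite /pullback /restrict /= -!addrA; congr (_ + (_ + _)).
rewrite -opprD; congr (- _); rewrite /delta /cross /fiber_sum /= big_nat_recr //=.
rewrite [in RHS]big_nat_recr //= -!addrA; congr (_ + _).
  apply: eq_big_nat => i hi; congr (_ * _); congr partial_fiber_sum.
  by rewrite /merge_letter; split_ifs.
rewrite /merge_letter -/(merge_letter _ _) hj; case: ifP => [/eqP-> | _].
  by rewrite /partial_fiber_sum big_nil mulr0 add0r.
by rewrite mulr0 addr0.
Qed.

Lemma restrict_delta m z w : restrict (delta m z) w = delta m (restrict z) w.
Proof. by []. Qed.

Lemma pullback_delta n m y w : word n.+1 m.+1 w ->
  delta m (pullback y) w = pullback (delta m y) w.
Proof. by case: w. Qed.

Lemma cross_delta n m v w : word n.+1 m.+2 w ->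
  delta m.+1 (cross m.+1 v) w = cross m.+2 (delta m v) w.
Proof.
case: w => [//|j w]; rewrite word_cons => /andP[hj hw].
rewrite /delta /cross /=.
case: eqP => [->|/eqP ne].
  rewrite big_nat_recr //= [X in _ + X](_ : _ = 0) ?addr0; last first.
    by rewrite /merge_letter; split_ifs; rewrite mulr0.
  apply: eq_big_nat => i /andP[_ hi]; congr (_ * _).
  rewrite ifT; last by rewrite /merge_letter; split_ifs.
  rewrite -!map_comp; congr v; apply: (eq_map_word hw) => x hx /=.
  by rewrite [in RHS](@merge_merge m i m.+2) //=; lia.
rewrite big_nat_recr //= big_nat_recr //= big1_seq ?add0r; last first.
  move=> i /andP[_]; rewrite mem_index_iota => hi.
  by rewrite ifF ?mulr0 // /merge_letter; apply/negbTE; split_ifs.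
have [e1 e2] : (merge_letter m.+1 m.+1 j == m.+1) = (j == m.+1)
    /\ (merge_letter m.+1 m.+2 j == m.+1) = (j == m.+1).
  by split; rewrite /merge_letter; split_ifs.
rewrite e1 e2; case: ifP => _; last by rewrite !mulr0 addr0.
rewrite -!map_comp (eq_map_word (g := merge_letter m m.+1 \o merge_letter m.+1 m.+1) hw).
  by rewrite [_ ^+ m.+2]exprS; ring.
by move=> x hx /=; rewrite /merge_letter; split_ifs.
Qed.

(** * Normal cochains, periods and exactness *)

(** Used for degenerate words, whose only faces that matter are two adjacent equal
    ones with opposite signs. *)
Lemma sum_adjacent N j (F : nat -> int) : (j.+1 < N)%N ->
  (forall i, (i < N)%N -> i != j -> i != j.+1 -> F i = 0) ->
  \sum_(0 <= i < N) F i = F j + F j.+1.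
Proof.
move=> hj F0; rewrite (@big_cat_nat _ _ _ j) //=; last by lia.
rewrite (@big_ltn _ _ _ j) ?(@big_ltn _ _ _ j.+1) //; last by lia.
rewrite !big1_seq ?addr0 ?add0r // => i /andP[_]; rewrite mem_index_iota => hi.
  by apply: F0; lia.
by apply: F0; lia.
Qed.

Lemma notin_map n m w (f : nat -> nat) j : word n m w ->
  (forall x, (x <= m)%N -> x \in w -> f x != j) -> j \notin map f w.
Proof.
move=> /andP[_ /allP hw] hf; apply/mapP => -[x hx /eqP]; rewrite eq_sym.
by apply/negP; apply: hf => //; exact: hw.
Qed.

Lemma neq_mem (w : seq nat) x j : j \notin w -> x \in w -> x != j.
Proof. by move=> hj hx; apply: contraNneq hj => <-. Qed.

Lemma merge_missing n m j w : word n m.+1 w -> j.+1 \notin w -> (j <= m)%N ->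
  map (merge_letter m j.+1) w = map (merge_letter m j) w.
Proof.
move=> /andP[_ /allP hw] hj jm; apply/eq_in_map => x xw.
have := neq_mem hj xw; have := hw _ xw.
by rewrite /merge_letter => ? ?; split_ifs.
Qed.


Lemma normal_delta n m c : normal n m c -> normal n m.+1 (delta m c).
Proof.
move=> nc w [//|j] hw hj jw; rewrite /delta (@sum_adjacent _ j) //.
  by rewrite (merge_missing hw) // exprS; ring.
move=> i hi ne1 ne2; have hwi := word_merge (m := m) (i := i) hi hw.
have [lt_ij|le_ji] := ltnP i j.
  rewrite (nc _ j) ?mulr0 //; first by lia.
  apply: (notin_map hw) => x hx xw; have := neq_mem jw xw.
  by rewrite /merge_letter => ?; split_ifs.
rewrite (nc _ j.+1) ?mulr0 //; first by lia.
apply: (notin_map hw) => x hx xw; have := neq_mem jw xw.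
by rewrite /merge_letter => ?; split_ifs.
Qed.

Lemma normal_restrict n m z : normal n.+1 m z -> normal n m (restrict z).
Proof.
move=> nz w j hw hj jw; apply: (nz _ j) => //.
by rewrite inE negb_or jw andbT; lia.
Qed.

Lemma normal_partial n m z w j x : normal n.+1 m.+1 z -> word n m w ->
  (x <= m.+1)%N -> (0 < j <= m)%N -> j \notin w -> partial_fiber_sum x z w = 0.
Proof.
move=> nz hw hx hj jw; apply: big1_seq => l /andP[_]; rewrite mem_index_iota => hl.
rewrite (nz _ (bump l.+1 j)) ?mulr0 //; first by rewrite word_insert //; lia.
  by rewrite /bump; lia.
rewrite inE negb_or mem_map ?jw; last by exact: (can_inj (@bumpK _)).
by rewrite eq_sym neq_bump.
Qed.

Lemma normal_fiber_sum n m z : normal n.+1 m.+1 z -> normal n m (fiber_sum m.+1 z).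
Proof. by move=> nz w j hw hj; apply: normal_partial hw _ hj. Qed.

Lemma normal_homotopy n m z : normal n.+1 m.+1 z -> normal n.+1 m (homotopy z).
Proof.
move=> nz [//|x w] j; rewrite word_cons => /andP[hx hw] hj.
rewrite inE negb_or => /andP[_ jw].
by apply: (normal_partial nz hw _ hj); rewrite // leqW.
Qed.

Lemma normal_pullback n m y : normal n m y -> normal n.+1 m (pullback y).
Proof.
move=> ny [//|x w] j; rewrite word_cons => /andP[hx hw] hj.
by rewrite inE negb_or => /andP[_ jw]; apply: ny jw.
Qed.

Lemma normal_cross n m v : normal n m v -> normal n.+1 m.+1 (cross m.+1 v).
Proof.
move=> nv [//|x w] j; rewrite word_cons => /andP[hx hw] hj.
rewrite inE negb_or => /andP[jx jw]; rewrite /cross /=; case: eqP => // ex.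
apply: (nv _ j); [by rewrite word_merge | by lia |].
apply: (notin_map hw) => y hy yw; have := neq_mem jw yw.
by rewrite /merge_letter => ?; split_ifs.
Qed.

Lemma normalB n m c d : normal n m c -> normal n m d ->
  normal n m (fun w => c w - d w).
Proof. by move=> nc nd w j hw hj jw; rewrite (nc _ j) // (nd _ j) // subrr. Qed.

Lemma normalD n m c d : normal n m c -> normal n m d ->
  normal n m (fun w => c w + d w).
Proof. by move=> nc nd w j hw hj jw; rewrite (nc _ j) // (nd _ j) // addr0. Qed.

Lemma normalZ n m a c : normal n m c -> normal n m (fun w => a * c w).
Proof. by move=> nc w j hw hj jw; rewrite (nc _ j) // mulr0. Qed.

Lemma partialB j y z w :
  partial_fiber_sum j (fun w => y w - z w) w = partial_fiber_sum j y w - partial_fiber_sum j z w.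
Proof. by rewrite /partial_fiber_sum -sumrB; apply: eq_bigr => i _; rewrite mulrBr. Qed.

Lemma partialD j y z w :
  partial_fiber_sum j (fun w => y w + z w) w = partial_fiber_sum j y w + partial_fiber_sum j z w.
Proof. by rewrite /partial_fiber_sum -big_split; apply: eq_bigr => i _; rewrite /= mulrDr. Qed.

Lemma partialZ j a z w : partial_fiber_sum j (fun w => a * z w) w = a * partial_fiber_sum j z w.
Proof. by rewrite /partial_fiber_sum mulr_sumr; apply: eq_bigr => i _; rewrite mulrCA. Qed.

Definition is_cocycle n m (z : cochain) :=
  forall w, word n m.+1 w -> delta m z w = 0.

(** The integral over the subtorus with coordinates in s. *)
Fixpoint period (s : bitseq) (m : nat) (z : cochain) : int :=
  match s with
  | [::] => z [::]
  | false :: s' => period s' m (restrict z)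
  | true :: s' => period s' m.-1 (fiber_sum m z)
  end.

Lemma restrict_cocycle n m z : is_cocycle n.+1 m z -> is_cocycle n m (restrict z).
Proof. by move=> cz w hw; rewrite -restrict_delta; apply: cz; rewrite word_cons hw. Qed.

Lemma fiber_sum_cocycle n m z : is_cocycle n.+1 m.+1 z -> is_cocycle n m (fiber_sum m.+1 z).
Proof.
move=> cz w hw; apply/eqP; rewrite -oppr_eq0; apply/eqP.
rewrite -(fiber_sum_delta (m := m.+1) z hw).
apply: big1_seq => i /andP[_]; rewrite mem_index_iota => hi.
by rewrite cz ?mulr0 // word_insert //; lia.
Qed.

Lemma eq_period n s : forall m z z', size s = n -> (count id s <= m)%N ->
  (forall w, word n m w -> z w = z' w) -> period s m z = period s m z'.
Proof.
elim: s n => [|[] s IH] [|n] //= m z z' => [_ _ e | [sz] | [sz]].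
- by apply: e.
- case: m => [//|m] hc e; apply: (IH n) => //= w hw.
  by apply: (eq_partial _ hw).
- by move=> hc e; apply: (IH n) => // w hw; apply: e; rewrite word_cons hw.
Qed.

(** Induction on the number of circles: by [homotopy_delta] a cocycle is cohomologous to
    the sum of two cocycles that come from one coordinate less, and whose periods are
    those of z over the sets s without and with the first coordinate. *)
Lemma exactness n : forall m z, normal n m z -> is_cocycle n m z ->
  (forall s, size s = n -> count id s = m -> period s m z = 0) ->
  if m is m'.+1 then
    exists2 b, normal n m' b & forall w, word n m w -> z w = delta m' b w
  else forall w, word n 0 w -> z w = 0.
Proof.
elim: n => [|n IH] [|m] z nz cz pz.
- by move=> [|//] _; apply: (pz [::]).
- by exists (fun=> 0) => // -[|//] hw; rewrite (nz _ 1%N) // delta0.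
- move=> [//|j w]; rewrite word_cons leqn0 => /andP[/eqP-> hw].
  apply: (IH 0%N (restrict z)) => //.
  + exact: normal_restrict.
  + exact: restrict_cocycle.
  + by move=> s sz cs; apply: (pz (false :: s)) => //=; rewrite sz.
(* the part of z on the words that start with the base point *)
have [b0 nb0 zb0] : exists2 b, normal n m b &
    forall w, word n m.+1 w -> restrict z w = delta m b w.
  apply: (IH m.+1 (restrict z)) => //.
  + exact: normal_restrict.
  + exact: restrict_cocycle.
  + by move=> s sz cs; apply: (pz (false :: s)) => //=; rewrite sz.
have npz := normal_fiber_sum nz; have cpz := fiber_sum_cocycle cz.
have ppz s : size s = n -> count id s = m -> period s m (fiber_sum m.+1 z) = 0.
  by move=> sz cs; apply: (pz (true :: s)) => /=; rewrite ?sz ?cs.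
(* the part that involves the class of the first circle *)
have [b1 nb1 zb1] : exists2 b, normal n.+1 m b &
    forall w, word n.+1 m.+1 w -> cross m.+1 (fiber_sum m.+1 z) w = delta m b w.
  have := IH m (fiber_sum m.+1 z) npz cpz ppz; case: m {nz cz pz b0 nb0 zb0 ppz cpz npz} => [|m].
    move=> pz0; exists (fun=> 0) => // -[//|j w]; rewrite word_cons => /andP[hj hw].
    rewrite /cross /=; case: eqP => _; last by rewrite delta0.
    rewrite pz0; first by rewrite delta0.
    exact: word_merge.
  move=> [b nb zb]; exists (cross m.+1 b); first exact: normal_cross.
  move=> w hw; rewrite (cross_delta _ hw) /cross; case: eqP => // _.
  rewrite zb //; case: w hw => [//|j w]; rewrite word_cons => /andP[_ hw].
  exact: word_merge.
exists (fun w => pullback b0 w - (-1) ^+ m.+1 * b1 w - homotopy z w).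
  apply: normalB; last exact: normal_homotopy.
  apply: normalB; first exact: normal_pullback.
  exact: normalZ.
move=> w hw; rewrite !deltaB deltaZ -zb1 // (pullback_delta _ hw).
rewrite [pullback (delta m b0) w](_ : _ = pullback (restrict z) w); last first.
  case: w hw => [//|j w]; rewrite word_cons => /andP[_ hw].
  by rewrite /pullback /= zb0.
have := homotopy_delta z hw; rewrite [homotopy (delta _ _) w](_ : _ = 0); last first.
  case: w hw => [//|j w]; rewrite word_cons => /andP[hj hw] /=.
  rewrite (eq_partial (z' := fun=> 0) _ hw) //; first by apply: big1 => ?; rewrite mulr0.
  exact: leqW.
by move=> E; rewrite -[LHS]addr0 [X in _ + X]E; ring.
Qed.

(** * The reversal *)

Definition reverse_letter (m j : nat) : nat := (if j == 0 then 0 else m.+1 - j)%N.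

(** The sign of the reversal of m+1 vertices, twisted by the parity of k.  Raising k by one
    turns invariant cochains into anti-invariant ones, which is how the inductions
    below keep track of the alternation. *)
Definition rev_sign (k m : nat) : int := (-1) ^+ (k + 'C(m.+1, 2)).

Definition flip (k m : nat) (c : cochain) : cochain :=
  fun w => rev_sign k m * c (map (reverse_letter m) w).

Definition equivariant (n k m : nat) (c : cochain) : Prop :=
  forall w, word n m w -> flip k m c w = c w.

Lemma signr_sub k i : (i <= k)%N -> (-1) ^+ (k - i) = (-1) ^+ k * (-1) ^+ i :> int.
Proof.
move=> hi; rewrite -exprD -(@signr_odd _ (_ + _)) oddD -oddB //.
by rewrite signr_odd.
Qed.

Lemma reverse_le m j : (reverse_letter m j <= m)%N.
Proof. by rewrite /reverse_letter; split_ifs. Qed.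

Lemma word_reverse n m w : word n m w -> word n m (map (reverse_letter m) w).
Proof. by move=> hw; apply: (word_map hw) => j _; apply: reverse_le. Qed.

Lemma reverseK n m w : word n m w -> map (reverse_letter m) (map (reverse_letter m) w) = w.
Proof.
move=> hw; rewrite -[RHS]map_id -map_comp; apply: (eq_map_word hw) => j hj /=.
by rewrite /reverse_letter; split_ifs.
Qed.

Lemma rev_sign2 k m : rev_sign k m * rev_sign k m = 1.
Proof. by rewrite /rev_sign -expr2 sqrr_sign. Qed.

Lemma rev_signS k m : rev_sign k m.+1 = (-1) ^+ m.+1 * rev_sign k m.
Proof. by rewrite /rev_sign binS bin1 addnA exprD mulrC. Qed.

Lemma rev_signSl k m : rev_sign k.+1 m = - rev_sign k m.
Proof. by rewrite /rev_sign addSn exprS mulN1r. Qed.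

Lemma flipSl k m c w : flip k.+1 m c w = - flip k m c w.
Proof. by rewrite /flip rev_signSl mulNr. Qed.

Lemma flipK n k m c w : word n m w -> flip k m (flip k m c) w = c w.
Proof. by move=> hw; rewrite /flip (reverseK hw) mulrA rev_sign2 mul1r. Qed.

Lemma flipB k m c d w : flip k m (fun w => c w - d w) w = flip k m c w - flip k m d w.
Proof. by rewrite /flip mulrBr. Qed.

Lemma flipD k m c d w : flip k m (fun w => c w + d w) w = flip k m c w + flip k m d w.
Proof. by rewrite /flip mulrDr. Qed.

Lemma eq_flip n k m c c' :
  (forall w, word n m w -> c w = c' w) ->
  forall w, word n m w -> flip k m c w = flip k m c' w.
Proof. by move=> e w hw; rewrite /flip e // word_reverse. Qed.

Lemma normal_flip n k m c : normal n m c -> normal n m (flip k m c).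
Proof.
move=> nc w j hw hj jw; rewrite /flip (nc _ (reverse_letter m j)) ?mulr0 ?word_reverse //.
  by rewrite /reverse_letter; split_ifs.
apply: (notin_map hw) => x hx xw; have := neq_mem jw xw.
by rewrite /reverse_letter => ?; split_ifs.
Qed.

(** The reversal exchanges the faces i and m+1-i, and the sign in [rev_sign] makes up
    for the change of (-1)^i. *)
Lemma delta_flip n k m c w : word n m.+1 w ->
  delta m (flip k m c) w = flip k m.+1 (delta m c) w.
Proof.
move=> hw; rewrite /flip /delta rev_signS big_nat_rev mulr_sumr.
apply: eq_big_nat => i hi; rewrite add0n subSS.
rewrite signr_sub; last by lia.
rewrite -!map_comp (eq_map_word (g := merge_letter m i \o reverse_letter m.+1) hw); first by ring.
by move=> x hx /=; rewrite /merge_letter /reverse_letter; split_ifs.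
Qed.

(** The reversal changes the orientation of the circle; hence the shift of k. *)
Lemma fiber_sum_flip n k m z w : word n m w ->
  fiber_sum m.+1 (flip k m.+1 z) w = flip k.+1 m (fiber_sum m.+1 z) w.
Proof.
move=> hw; rewrite flipSl /flip /fiber_sum /partial_fiber_sum rev_signS big_nat_rev.
rewrite mulr_sumr -sumrN; apply: eq_big_nat => l hl; rewrite add0n subSS.
rewrite signr_sub; last by lia.
have sm : (-1) ^+ m * (-1) ^+ m = 1 :> int by rewrite -expr2 sqrr_sign.
rewrite (_ : map (reverse_letter m.+1) _ = insert_letter l.+1 (map (reverse_letter m) w)).
  rewrite exprS mulN1r !mulNr mulrN; congr (- _).
  rewrite [LHS](_ : _ = ((-1) ^+ m * (-1) ^+ m) * ((-1) ^+ l * rev_sign k m *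
     z (insert_letter l.+1 [seq reverse_letter m i | i <- w]))); first by rewrite sm; ring.
  by ring.
rewrite /insert_letter map_cons -!map_comp; congr (_ :: _).
  by rewrite /reverse_letter; split_ifs.
by apply: (eq_map_word hw) => x hx /=; rewrite /reverse_letter /bump; split_ifs.
Qed.

Lemma fiber_sumB m y z :
  fiber_sum m (fun w => y w - z w) = (fun w => fiber_sum m y w - fiber_sum m z w).
Proof. by apply: boolp.funext => w; apply: partialB. Qed.

Lemma fiber_sumD m y z :
  fiber_sum m (fun w => y w + z w) = (fun w => fiber_sum m y w + fiber_sum m z w).
Proof. by apply: boolp.funext => w; apply: partialD. Qed.

Lemma fiber_sumZ m a z : fiber_sum m (fun w => a * z w) = (fun w => a * fiber_sum m z w).
Proof. by apply: boolp.funext => w; apply: partialZ. Qed.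

Lemma periodB s : forall m y z,
  period s m (fun w => y w - z w) = period s m y - period s m z.
Proof. by elim: s => [|[] s IH] m y z //=; rewrite ?fiber_sumB IH. Qed.

Lemma periodD s : forall m y z,
  period s m (fun w => y w + z w) = period s m y + period s m z.
Proof. by elim: s => [|[] s IH] m y z //=; rewrite ?fiber_sumD IH. Qed.

Lemma periodZ s : forall m a z, period s m (fun w => a * z w) = a * period s m z.
Proof. by elim: s => [|[] s IH] m a z //=; rewrite ?fiber_sumZ IH. Qed.

Lemma period0 s m : period s m (fun=> 0) = 0.
Proof.
rewrite -[RHS](mul0r (period s m (fun=> 0))) -periodZ; congr period.
Qed.

Lemma period_delta n s : forall m c, size s = n -> count id s = m.+1 ->
  period s m.+1 (delta m c) = 0.
Proof.
elim: s n => [|[] s IH] [|n] m c //= [sz] cs; last exact: (IH n m (restrict c) sz cs).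
case: cs; rewrite add0n => cs.
rewrite (eq_period (n := n) (z' := fun w => -1 * delta m.-1 (fiber_sum m c) w)) ?cs //; last first.
  by move=> w hw; rewrite (fiber_sum_delta c hw) mulN1r.
rewrite periodZ; case: m cs => [|m] cs; last by rewrite (IH n) ?mulr0.
rewrite [delta _ _](_ : _ = fun=> 0) ?period0 ?mulr0 //.
apply: boolp.funext => w; rewrite /delta big1 // => i _.
by rewrite /fiber_sum /partial_fiber_sum big_nil mulr0.
Qed.

(** The reversal is the inversion of the torus, so it acts on H^m by (-1)^m. *)
Lemma period_flip n s : forall k m z, size s = n -> count id s = m ->
  period s m (flip k m z) = (-1) ^+ (k + m) * period s m z.
Proof.
elim: s n => [|[] s IH] [|n] //= k m z.
- by move=> _ <-; rewrite /flip /rev_sign /= addn0.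
- move=> [sz] <-; rewrite add1n.
  rewrite (eq_period (n := n) (z' := flip k.+1 (count id s) (fiber_sum (count id s).+1 z))) //.
    by rewrite (IH n) // addSnnS.
  by move=> w hw; apply: fiber_sum_flip hw.
by move=> [sz] cs; rewrite -(IH n).
Qed.

(** Pullbacks and cross products realise periods over the sets without and with the
    first coordinate independently of each other. *)
Lemma periods_surjective n : forall m (t : bitseq -> int),
  exists y, [/\ normal n m y, is_cocycle n m y &
    forall s, size s = n -> count id s = m -> period s m y = t s].
Proof.
elim: n => [|n IH] [|m] t.
- exists (fun=> t [::]); split=> [w j _|[|//] _|[|//]] //; first by lia.
  by rewrite /delta big_nat_recr // big_nat1 /=; ring.
- exists (fun=> 0); split=> // [w hw|[|//]] //.
  exact: delta0.
- have [y [ny cy py]] := IH 0%N (t \o cons false).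
  exists (pullback y); split.
  + exact: normal_pullback.
  + move=> [//|j w] hw; rewrite (pullback_delta _ hw) /pullback /=.
    by move: hw; rewrite word_cons => /andP[_ /cy].
  + by move=> [|[] s] //= [sz] cs; apply: py.
have [y0 [ny0 cy0 py0]] := IH m.+1 (t \o cons false).
have [y1 [ny1 cy1 py1]] := IH m (t \o cons true).
exists (fun w => pullback y0 w + (-1) ^+ m * cross m.+1 y1 w); split.
- by apply: normalD; [apply: normal_pullback | apply: normalZ; apply: normal_cross].
- move=> [//|j w] hw; rewrite deltaD deltaZ (pullback_delta _ hw) (cross_delta _ hw).
  move: hw; rewrite word_cons => /andP[hj hw].
  rewrite /pullback /cross /= cy0 //; case: eqP => _; last by rewrite mulr0 addr0.
  by rewrite cy1 ?mulr0 ?addr0 // word_merge.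
move=> [|[] s] //= [sz]; last first.
  rewrite add0n => cs; transitivity (period s m.+1 y0); last exact: py0.
  apply: (eq_period (n := n)); rewrite ?cs // => w hw.
  by rewrite /restrict /cross /= mulr0 addr0.
case; rewrite add0n => cs; transitivity (period s m y1); last exact: py1.
apply: (eq_period (n := n)); rewrite ?cs // => w hw.
rewrite fiber_sumD fiber_sumZ /fiber_sum [X in X + _]big1_seq; last first.
  move=> l /andP[_]; rewrite mem_index_iota => hl; rewrite /pullback /=.
  rewrite (ny0 _ l.+1) ?mulr0 //; first by apply: (word_map hw) => j; rewrite /bump; lia.
  by apply: (notin_map hw) => x _ _; rewrite eq_sym neq_bump.
rewrite add0r partialS /partial_fiber_sum big1_seq; last first.
  move=> l /andP[_]; rewrite mem_index_iota => hl.
  by rewrite /cross /insert_letter /= eqSS (_ : (l == m) = false) ?mulr0 //; lia.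
rewrite add0r mulrA -expr2 sqrr_sign mul1r /cross /insert_letter /= eqxx -map_comp.
congr y1; rewrite -[RHS]map_id; apply: (eq_map_word hw) => x hx /=.
by rewrite /merge_letter /bump; split_ifs.
Qed.

(** * Half periods *)

(** The sum of y over the vertices of the cube spanned by s. *)
Fixpoint subset_sum (s : bitseq) (y : cochain) : int :=
  if s is b :: s' then
    subset_sum s' (restrict y)
    + (if b then subset_sum s' (fun w => y (1%N :: w)) else 0)
  else y [::].

(** These functionals play the role of the hemispheres H_m in a sphere with antipodal
    cell structure, and those below that of the spheres F_m: modulo the
    indeterminacies stated in the lemmas, H_m applied to a trace is F_m
    ([half_period_trace]) and the boundary of H_(m+1) is F_m ([half_period_delta]).
    They make sense for any s with at least m elements; the recursion integrates along
    the coordinates in s until degree 2 is reached, and there keeps one of the two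
    shuffles of the next circle. *)
Fixpoint half_period (s : bitseq) (m : nat) (z : cochain) : int :=
  match s with
  | [::] => 0
  | false :: s' => half_period s' m (restrict z)
  | true :: s' => if (m <= 2)%N then - subset_sum s' (fun w => z (2%N :: w))
                  else half_period s' m.-1 (fiber_sum m z)
  end.

Fixpoint full_period (s : bitseq) (m : nat) (z : cochain) : int :=
  if (m <= 1)%N then subset_sum s z else
  match s with
  | [::] => 0
  | false :: s' => full_period s' m (restrict z)
  | true :: s' => full_period s' m.-1 (fiber_sum m z)
  end.

Lemma eq_subset_sum n s : forall y y', size s = n ->
  (forall w, word n 1 w -> y w = y' w) -> subset_sum s y = subset_sum s y'.
Proof.
elim: s n => [|b s IH] [|n] //= y y' => [_ e|[sz] e]; first exact: e.
congr (_ + _); first by apply: (IH n) => // w hw; apply: e; rewrite word_cons.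
by case: b => //; apply: (IH n) => // w hw; apply: e; rewrite word_cons.
Qed.

Lemma subset_sumD s : forall y z,
  subset_sum s (fun w => y w + z w) = subset_sum s y + subset_sum s z.
Proof.
by elim: s => [|b s IH] y z //=; rewrite !IH; case: b; rewrite ?IH //; ring.
Qed.

Lemma subset_sumZ s : forall a z,
  subset_sum s (fun w => a * z w) = a * subset_sum s z.
Proof.
by elim: s => [|b s IH] a z //=; rewrite !IH; case: b; rewrite ?IH //; ring.
Qed.

Lemma subset_sum_const s (c : int) : subset_sum s (fun=> c) = c * 2 ^+ count id s.
Proof.
elim: s => [|[] s IH] /=; first by rewrite mulr1.
  by rewrite /restrict IH exprS; ring.
by rewrite /restrict IH addr0 add0n.
Qed.

Lemma eq_half_period n s : forall m z z', size s = n -> (1 < m)%N ->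
  (forall w, word n m w -> z w = z' w) -> half_period s m z = half_period s m z'.
Proof.
elim: s n => [|[] s IH] [|n] //= m z z' [sz] hm e; last first.
  by apply: (IH n) => // w hw; apply: e; rewrite word_cons.
case: ifP => hm2.
  congr (- _); apply: (@eq_subset_sum n) => // w hw; apply: e.
  by rewrite word_cons hm (word_widen (m := 1)) // ltnW.
case: m hm hm2 e => [//|m] hm hm2 e.
by apply: (IH n) => //=; [lia | move=> w hw; apply: (eq_partial _ hw)].
Qed.

Lemma half_periodD s : forall m y z,
  half_period s m (fun w => y w + z w) = half_period s m y + half_period s m z.
Proof.
elim: s => [|[] s IH] m y z //=; last exact: IH.
by case: ifP => _; rewrite ?subset_sumD ?opprD // fiber_sumD IH.
Qed.

Lemma half_periodZ s : forall m a z,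
  half_period s m (fun w => a * z w) = a * half_period s m z.
Proof.
elim: s => [|[] s IH] m a z /=; [by rewrite mulr0 | | exact: IH].
by case: ifP => _; rewrite ?subset_sumZ ?mulrN // fiber_sumZ IH.
Qed.

Lemma half_periodB t m y z :
  half_period t m (fun w => y w - z w) = half_period t m y - half_period t m z.
Proof.
rewrite -[- half_period t m z]mulN1r -half_periodZ -half_periodD; congr half_period.
by apply: boolp.funext => w; rewrite mulN1r.
Qed.

(** The induction follows the definition down to degree 2, where the reversal exchanges the
    two shuffles of the first coordinate: these are the two summands of the
    fibre sum that appears in the full period. *)
Lemma half_period_trace n s : forall k m z, size s = n -> (1 < m)%N ->
  exists a, half_period s m (fun w => z w + flip k m z w)
    = full_period s m z + (1 - (-1) ^+ (k + m)) * a.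
Proof.
elim: s n => [|[] s IH] [|n] k m z //= => [_|[sz]|[sz]] hm; rewrite (leqNgt m 1) hm /=.
- by exists 0; rewrite mulr0.
- case: ifP => hm2; last first.
    case: m hm hm2 => [//|m] hm hm2; rewrite fiber_sumD /=.
    have [|a ha] := IH n k.+1 m (fiber_sum m.+1 z) sz; first by lia.
    exists a; rewrite -addSnnS -ha; apply: (@eq_half_period n) => //; first by lia.
    by move=> w hw; rewrite (fiber_sum_flip _ _ hw).
  have {hm hm2} -> : m = 2 by lia.
  exists (- subset_sum s (fun w => z (insert_letter 1 w))).
  rewrite /= (_ : full_period s 1 (fiber_sum 2 z) = subset_sum s (fiber_sum 2 z)); last by case: (s).
  rewrite subset_sumD (@eq_subset_sum n _ (fun w => flip k 2 z (2 :: w))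
    (fun w => - (-1) ^+ k * z (insert_letter 1 w))) //; last first.
    have e : rev_sign k 2 = - (-1) ^+ k.
      by rewrite /rev_sign (_ : 'C(3, 2) = 3) // exprD !exprS; ring.
    move=> w hw; rewrite /flip e /insert_letter map_cons; congr (_ * z (_ :: _)).
    by apply: (eq_map_word hw) => x hx; rewrite /reverse_letter /bump; split_ifs.
  rewrite subset_sumZ (@eq_subset_sum n s (fiber_sum 2 z)
    (fun w => z (insert_letter 1 w) + -1 * z (2 :: w))) //; last first.
    move=> w hw; rewrite /fiber_sum /partial_fiber_sum !big_nat_recr //= big_nil add0r mul1r.
    congr (_ + _ * z (_ :: _)).
    by rewrite -[RHS]map_id; apply: (eq_map_word hw) => x hx; rewrite /bump; split_ifs.
  rewrite subset_sumD subset_sumZ addn2 !exprS; ring.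
- have [a ha] := IH n k m (restrict z) sz hm.
  by exists a; rewrite -ha.
Qed.

(** In degree 1 the coboundary on 2 :: w has three terms: a constant, which is counted
    2^r times for the r > 0 remaining elements of s, hence evenly, and the two halves
    of the full period, one of them with the opposite sign, which is the same
    modulo 2. *)
Lemma half_period_delta n s : forall m y, size s = n -> (0 < m < count id s)%N ->
  exists a, half_period s m.+1 (delta m y) = full_period s m y + 2 * a.
Proof.
elim: s n => [|b s IH] [|n] m y //; first by rewrite ltn0 andbF.
case: (ltnP 1 m) => [hm | hm1] [sz] hmc.
  rewrite /= (leqNgt m 1) hm /=; case: b hmc => /= hmc; last exact: (IH n).
  case: m hm hmc => [//|[//|m]] hm hmc.
  have [|a ha] := IH n m.+1 (fiber_sum m.+2 y) sz; first by lia.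
  exists (- a - full_period s m.+1 (fiber_sum m.+2 y)).
  rewrite (@eq_half_period n _ _ _ (fun w => -1 * delta m.+1 (fiber_sum m.+2 y) w)) //; last first.
    by move=> w hw; rewrite (fiber_sum_delta _ hw) mulN1r.
  by rewrite half_periodZ ha; ring.
have {hm1} em : m = 1 by lia.
subst m; case: b hmc => /= hmc; last first.
  have [a ha] := IH n 1 (restrict y) sz hmc; exists a.
  by rewrite addr0 -(_ : full_period s 1 (restrict y) = subset_sum s (restrict y)) //; case: (s).
have hc : (0 < count id s)%N by lia.
pose y0 := y (1%N :: nseq n 0%N).
exists (- subset_sum s (restrict y) - y0 * 2 ^+ (count id s).-1).
rewrite (@eq_subset_sum n s (fun w => delta 1 y (2 :: w))
  (fun w => y0 + (-1 * y (1 :: w) + restrict y w))) //; last first.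
  move=> w hw; rewrite /delta !big_nat_recr //= big_nil add0r mul1r expr1 sqrrN expr1n mul1r addrA.
  congr (y (_ :: _) + _ * y (_ :: _) + y (_ :: _)).
  - rewrite -(map_id (nseq _ _)) -(_ : map (fun=> 0%N) w = nseq n 0%N).
      by rewrite map_id; apply: (eq_map_word hw) => x hx; rewrite /merge_letter; split_ifs.
    by case/andP: hw => /eqP <- _; elim: (w) => //= x w' ->.
  - by rewrite -[RHS]map_id; apply: (eq_map_word hw) => x hx; rewrite /merge_letter; split_ifs.
  - by rewrite -[RHS]map_id; apply: (eq_map_word hw) => x hx; rewrite /merge_letter; split_ifs.
rewrite subset_sumD subset_sum_const subset_sumD subset_sumZ.
by rewrite -{1}(prednK hc) exprS; ring.
Qed.

(** With exactly m elements in s, all but one of the summands of [subset_sum] are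
    evaluated at degenerate words. *)
Lemma full_period_period n s : forall m y, size s = n -> count id s = m ->
  (0 < m)%N -> normal n m y -> full_period s m y = period s m y.
Proof.
have zero t : forall l (c : cochain), count id t = 0%N ->
    subset_sum t c = c (nseq (size t) 0%N) /\ period t l c = c (nseq (size t) 0%N).
  by elim: t => [|[] t IH] l c //= ht; rewrite addr0; apply: IH.
have one : forall t n (c : cochain), size t = n -> count id t = 1 -> normal n 1 c ->
    subset_sum t c = period t 1 c.
  elim=> [|[] t IH] [|k] c //= [sz].
    rewrite add1n => -[ct] nc.
    have [-> _] := zero t 0%N (restrict c) ct; have [-> _] := zero t 0%N (fun w => c (1%N :: w)) ct.
    have [_ ->] := zero t 0%N (fiber_sum 1 c) ct.
    rewrite /restrict (nc _ 1%N) ?add0r //.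
    - rewrite /fiber_sum /partial_fiber_sum big_nat1 /insert_letter mul1r; congr (c (_ :: _)).
      by rewrite map_nseq.
    - by rewrite /word /= size_nseq sz eqxx all_nseq orbT.
    - by rewrite inE mem_nseq andbF.
  rewrite add0n addr0 => ct nc; apply: (IH k) => //; exact: normal_restrict.
elim: s n => [|[] s IH] [|n] m y //.
  by move=> _ <-.
- move=> [sz] hc hm ny; rewrite /full_period -/full_period /=.
  case: ifP => hm1.
    have em : m = 1 by [lia]; rewrite em in hc ny *.
    by apply: (one (true :: s) n.+1 y); rewrite //= sz.
  case: m hc hm hm1 ny => [//|m] [hc] hm hm1 ny.
  by apply: (IH n) => //; [lia | exact: normal_fiber_sum].
move=> [sz] hc hm ny; rewrite /full_period -/full_period /=.
case: ifP => hm1.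
  have em : m = 1 by [lia]; rewrite em in hc ny *.
  by apply: (one (false :: s) n.+1 y); rewrite //= sz.
apply: (IH n) => //; exact: normal_restrict.
Qed.

(** * Invariant cocycles *)

Definition invariant (n k m : nat) (c : cochain) : Prop :=
  normal n m c /\ equivariant n k m c.

(** The sets s whose half periods are invariants of cohomology classes. *)
Definition detects (k m : nat) (s : bitseq) : bool :=
  if odd (k + m) then (m <= count id s)%N else count id s == m.

(** The modulus of the half periods; modulus 0 means integral values, since 0 only
    divides 0. *)
Definition exponent (k m : nat) : int := if odd (k + m) then 2 else 0.

Lemma exponentE k m : 1 - (-1) ^+ (k + m) = exponent k m.
Proof. by rewrite /exponent -signr_odd; case: odd. Qed.

Lemma exponentSS k m : exponent k.+1 m.+1 = exponent k m.
Proof. by rewrite /exponent addSn addnS /= negbK. Qed.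

Lemma normal_high n m c w : normal n m c -> (n < m)%N -> word n m w -> c w = 0.
Proof.
move=> nc hm hw; have [j hj jw] : exists2 j, (0 < j <= m)%N & j \notin w.
  have [/allP sub|/allPn[j hj jw]] := boolP (all (mem w) (iota 1 m)).
    have /andP[/eqP sz _] := hw.
    by have := uniq_leq_size (iota_uniq 1 m) sub; rewrite size_iota sz; lia.
  by exists j => //; move: hj; rewrite mem_iota; lia.
exact: nc hj jw.
Qed.

Definition trace (k m : nat) (y : cochain) : cochain :=
  fun w => y w + flip k m y w.

Lemma invariant_trace n k m y : normal n m y -> invariant n k m (trace k m y).
Proof.
move=> ny; split; first by apply: normalD => //; apply: normal_flip.
by move=> w hw; rewrite /trace flipD (flipK _ _ hw) addrC.
Qed.

Lemma delta_trace n k m y w : word n m.+1 w ->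
  delta m (trace k m y) w = trace k m.+1 (delta m y) w.
Proof. by move=> hw; rewrite deltaD (delta_flip _ _ hw). Qed.

Lemma index_reverse n m w x : word n m w -> (x <= m)%N ->
  index x (map (reverse_letter m) w) = index (reverse_letter m x) w.
Proof.
move=> /andP[_ /allP hw] hx; rewrite /index find_map; apply: eq_in_find => y yw /=.
have := hw _ yw; rewrite /reverse_letter => hy.
by apply/eqP/eqP; split_ifs.
Qed.

(** The reversal exchanges the letters 1 and m.  Hence exactly one of each pair of
    nondegenerate words has its first 1 before its first m, and restricting z to these
    words gives y. *)
Lemma trace_surjective n k m z : (1 < m)%N -> invariant n k m z ->
  exists2 y, normal n m y & forall w, word n m w -> z w = trace k m y w.
Proof.
move=> hm [nz ez].
exists (fun w => if (index 1%N w < index m w)%N then z w else 0).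
  by move=> w j hw hj jw; case: ifP => // _; apply: nz hj jw.
move=> w hw; rewrite /trace /flip !(index_reverse hw) //; last exact: ltnW.
rewrite /reverse_letter /= subSS subn0 (_ : (m == 0%N) = false); last by lia.
rewrite subSn // subnn.
have ezw := ez w hw; rewrite /flip in ezw.
case: ltngtP => h; first by rewrite mulr0 addr0.
  by rewrite add0r.
suff -> : z w = 0 by rewrite mulr0 addr0.
have [w1|] := boolP (1%N \in w); last by apply: nz => //; lia.
have : nth 0%N w (index 1%N w) = 1%N by rewrite nth_index.
rewrite h => e; have [wm|] := boolP (m \in w); last by apply: nz => //; lia.
by move: e; rewrite nth_index // => e; lia.
Qed.

Lemma exactness_pos n m z : normal n m.+1 z -> is_cocycle n m.+1 z ->
  (forall s, size s = n -> count id s = m.+1 -> period s m.+1 z = 0) ->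
  exists2 b, normal n m b & forall w, word n m.+1 w -> z w = delta m b w.
Proof. exact: exactness. Qed.

(** Adding v - flip v to y does not change its trace.  For a cocycle v this changes
    the periods of y by multiples of 1 - (-1)^(k+m+1), so they can be made zero; then
    y is a coboundary. *)
Lemma integrate_trace n k m y : normal n m.+1 y -> is_cocycle n m.+1 y ->
  (forall s, size s = n -> count id s = m.+1 ->
     (exponent k m.+1 %| period s m.+1 y)%Z) ->
  exists2 b, invariant n k m b &
    forall w, word n m.+1 w -> trace k m.+1 y w = delta m b w.
Proof.
move=> ny cy py.
have [v [nv cv pv]] :=
  periods_surjective n m.+1 (fun s => (period s m.+1 y %/ exponent k m.+1)%Z).
pose y' w := y w - (v w - flip k m.+1 v w).
have [|||b nb eb] := @exactness_pos n m y'.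
- by apply: normalB => //; apply: normalB => //; apply: normal_flip.
- move=> w hw; rewrite !deltaB (delta_flip _ _ hw) cy // cv // /flip cv ?word_reverse //.
  by rewrite mulr0 !subrr.
- move=> s sz cs; rewrite /y' !periodB (period_flip (n := n)) // pv //.
  have := divzK (py s sz cs); set q := (_ %/ _)%Z => <-.
  by rewrite -exponentE; ring.
exists (trace k m b); first exact: invariant_trace.
move=> w hw; rewrite (delta_trace _ _ hw) /trace /flip -!eb ?word_reverse //.
rewrite -/(flip k m.+1 y' w) /y' flipB flipB (flipK _ _ hw) /flip; ring.
Qed.

Lemma equivariant_opp n k m u : normal n m u ->
  (forall w, word n m w -> flip k m u w = - u w) -> invariant n k.+1 m u.
Proof. by move=> nu eu; split=> // w hw; rewrite flipSl eu // opprK. Qed.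

Lemma trace_opp n k m u : invariant n k.+1 m u ->
  forall w, word n m w -> trace k m u w = 0.
Proof.
by move=> [_ eu] w hw; have := eu w hw; rewrite flipSl /trace => <-; rewrite addNr.
Qed.

(** For k+m even, an invariant z satisfies trace z = 2 z, and for #|s| = m the full
    period is the period. *)
Lemma half_period_double n k m s z : size s = n -> count id s = m -> (1 < m)%N ->
  ~~ odd (k + m) -> invariant n k m z -> period s m z = 2 * half_period s m z.
Proof.
move=> sz cs hm ev [nz ez].
have [a] := half_period_trace k z sz hm.
rewrite exponentE /exponent (negbTE ev) mul0r addr0 => e.
rewrite -(full_period_period sz cs) //; last exact: ltnW.
rewrite -e (eq_half_period (n := n) (z' := fun w => 2 * z w)) ?half_periodZ //.
by move=> w hw; rewrite ez //; ring.
Qed.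

Lemma half_period_exact n k m s y : size s = n -> (1 < m)%N -> detects k m s ->
  normal n m y ->
  (exponent k m %| half_period s m (trace k m y) - full_period s m y)%Z.
Proof.
move=> sz hm ds ny; have [a ->] := half_period_trace k y sz hm.
by rewrite exponentE addrC addKr dvdz_mulr.
Qed.

Lemma half_period_delta_exponent n k m s y : size s = n -> (0 < m)%N ->
  odd (k + m) -> (m < count id s)%N ->
  (exponent k m %| half_period s m.+1 (delta m y) - full_period s m y)%Z.
Proof.
move=> sz hm od hs; have [|a ->] := @half_period_delta n s m y sz; first by rewrite hm.
by rewrite /exponent od addrC addKr dvdz_mulr.
Qed.

Lemma invariant_delta n k m b : invariant n k m b -> invariant n k m.+1 (delta m b).
Proof.
move=> [nb eb]; split; first exact: normal_delta.
by move=> w hw; rewrite -(delta_flip _ _ hw) (eq_delta eb hw).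
Qed.

(** Half periods are well defined on classes.  For k+m+1 odd, the full period of an
    invariant cochain is twice its half period, so [half_period_delta] gives an even
    number; for k+m+1 even, twice the half period is the period of a coboundary. *)
Lemma half_period_boundary n k m s b : size s = n -> (1 < m)%N ->
  invariant n k m b -> detects k m.+1 s ->
  (exponent k m.+1 %| half_period s m.+1 (delta m b))%Z.
Proof.
move=> sz hm ib; rewrite /detects /exponent addnS /=; case: ifP => [ev|/negbT od] ds.
  have [|a ->] := @half_period_delta n s m b sz; first by rewrite ds ltnW.
  have [a'] := half_period_trace k b sz hm.
  rewrite exponentE /exponent (negbTE ev) mul0r addr0 => <-.
  rewrite (eq_half_period (n := n) (z' := fun w => 2 * b w)) //.
    by rewrite half_periodZ -mulrDr dvdz_mulr.
  by move=> w hw; rewrite ib.2 //; ring.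
have := @half_period_double n k m.+1 s (delta m b) sz (eqP ds) (ltnW hm).
rewrite addnS /= od => /(_ isT (invariant_delta ib)).
rewrite (period_delta (n := n)) ?(eqP ds) //; lia.
Qed.

(** Write z as the trace of y.  Then u = delta y is invariant for k+1, and its half
    periods vanish because those of z do; by descending induction on the degree, u is
    the coboundary of some b that is invariant for k+1.  Such a b has trace zero, so
    y - b is a cocycle with trace z, and [integrate_trace] applies. *)
Lemma invariant_cocycle_boundary n d : forall k m z, (n <= m + d)%N -> (0 < m)%N ->
  invariant n k m.+1 z -> is_cocycle n m.+1 z ->
  (forall s, size s = n -> detects k m.+1 s ->
     (exponent k m.+1 %| half_period s m.+1 z)%Z) ->
  exists2 b, invariant n k m b & forall w, word n m.+1 w -> z w = delta m b w.
Proof.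
elim: d => [|d IH] k m z hd hm iz cz gz.
  exists (fun=> 0); first by split=> // w _; rewrite /flip mulr0.
  move=> w hw; rewrite (normal_high iz.1) //; last by rewrite addn0 in hd.
  by rewrite delta0.
have [y ny zy] := trace_surjective (hm : 1 < m.+1)%N iz.
pose u := delta m.+1 y.
have nu : normal n m.+2 u by apply: normal_delta.
have cu : is_cocycle n m.+2 u by move=> w hw; apply: deltaK hw.
have iu : invariant n k.+1 m.+2 u.
  apply: equivariant_opp => // w hw; apply/eqP; rewrite -addr_eq0 addrC; apply/eqP.
  by rewrite -/(trace k m.+2 u w) -(delta_trace _ _ hw) -(eq_delta zy hw) cz.
(* half periods of z bound full periods of y, and these the half periods of u *)
have gy s : size s = n -> detects k m.+1 s ->
    (exponent k m.+1 %| full_period s m.+1 y)%Z.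
  move=> sz ds; rewrite -(rpredBl _ (gz s sz ds)).
  by rewrite (eq_half_period sz _ zy) // (half_period_exact (n := n)).
have gu s : size s = n -> detects k.+1 m.+2 s ->
    (exponent k.+1 m.+2 %| half_period s m.+2 u)%Z.
  move=> sz; rewrite exponentSS /detects addSn addnS /= negbK => ds.
  have [od|ev] := boolP (odd (k + m.+1)).
    rewrite od in ds; rewrite -[half_period _ _ _](subrK (full_period s m.+1 y)).
    rewrite rpredD ?(half_period_delta_exponent (n := n)) // gy // /detects od; exact: ltnW.
  rewrite (negbTE ev) in ds; have := half_period_double sz (eqP ds) isT _ iu.
  rewrite (@period_delta n s m.+1 y sz (eqP ds)) /exponent (negbTE ev) addSn addnS /= negbK ev.
  by move=> /(_ isT) e; rewrite dvd0z; lia.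
have [||b ib ub] := IH k.+1 m.+1 u _ _ iu cu gu; rewrite ?addSnnS //.
(* the trace of b vanishes, so y can be corrected without changing its trace *)
pose y' w := y w - b w.
have zy' w : word n m.+1 w -> z w = trace k m.+1 y' w.
  move=> hw; rewrite zy // /trace /y' flipB -[in LHS](subr0 (_ + _)) -(trace_opp ib hw) /trace.
  by ring.
have [|||b' ib' eb'] := @integrate_trace n k m y'.
- by apply: normalB => //; case: ib.
- by move=> w hw; rewrite deltaB -ub // subrr.
- move=> s sz cs.
  have ds : detects k m.+1 s by rewrite /detects cs leqnn eqxx if_same.
  have ny' : normal n m.+1 y' by apply: normalB => //; case: ib.
  rewrite -(full_period_period sz cs) //.
  rewrite -(rpredBl _ (gz s sz ds)).
  by rewrite (eq_half_period sz _ zy') // (half_period_exact (n := n)).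
by exists b' => // w hw; rewrite zy' // eb'.
Qed.

(** For k+m even, take the trace of a cocycle with prescribed periods.  For k+m odd,
    start from a cocycle u of degree m+1 with the prescribed half periods; it is delta y
    since its periods vanish, and the trace of y has the prescribed half periods over
    the sets with more than m elements.  Those over the sets with m elements
    are adjusted by adding a cocycle to y. *)
Lemma invariant_cocycle_exists n d : forall k m (t : bitseq -> int),
  (n < m + d)%N -> (1 < m)%N ->
  exists z, [/\ invariant n k m z, is_cocycle n m z &
    forall s, size s = n -> detects k m s ->
      (exponent k m %| half_period s m z - t s)%Z].
Proof.
elim: d => [|d IH] k m t hd hm.
  exists (fun=> 0); split; first by split=> // w _; rewrite /flip mulr0.
    by move=> w _; apply: delta0.
  move=> s sz; have := count_size id s; rewrite /detects sz => ?.
  by case: ifP => _ ?; lia.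
have [od|ev] := boolP (odd (k + m)); last first.
  have [y [ny cy py]] := periods_surjective n m t.
  exists (trace k m y); split; first exact: invariant_trace.
    by move=> w hw; rewrite (delta_trace _ _ hw) /trace /flip !cy ?word_reverse // mulr0.
  move=> s sz ds; have cs : count id s = m.
    by move: ds; rewrite /detects (negbTE ev) => /eqP.
  have := half_period_exact sz hm ds ny.
  by rewrite (full_period_period sz cs) ?py // ltnW.
have [u [iu cu gu]] := IH k.+1 m.+1 t (leq_trans hd (eq_leq (esym (addSnnS _ _)))) (ltnW hm).
have pu s : size s = n -> count id s = m.+1 -> period s m.+1 u = 0.
  move=> sz cs; have := @period_flip n s k.+1 m.+1 u sz cs.
  rewrite (eq_period sz _ iu.2) ?cs // addSn addnS !exprS -signr_odd od expr1 mulrA mulrNN !mul1r mulN1r.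
  by lia.
have [y ny uy] := exactness_pos iu.1 cu pu.
have [v [nv cv pv]] := periods_surjective n m (fun s => t s - full_period s m y).
pose y' w := y w + v w.
have ny' : normal n m y' by apply: normalD.
have uy' w : word n m.+1 w -> delta m y' w = u w.
  by move=> hw; rewrite deltaD cv // addr0 uy.
exists (trace k m y'); split; first exact: invariant_trace.
  move=> w hw; rewrite (delta_trace _ _ hw) /trace (eq_flip k uy') // uy' //.
  exact: trace_opp iu w hw.
move=> s sz ds; have hc : (m <= count id s)%N by move: ds; rewrite /detects od.
rewrite -[half_period _ _ _](subrK (full_period s m y')) -addrA.
rewrite rpredD ?(half_period_exact (n := n)) //.
have [lt_m|le_m] := ltnP m (count id s).
  have hm' := ltnW hm.
  have du := half_period_delta_exponent (n := n) y' sz hm' od lt_m.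
  have dt := gu s sz; rewrite exponentSS /detects addSn addnS /= negbK od in dt.
  rewrite (eq_half_period sz _ uy') // in du.
  by rewrite -[_ - _](subrKA (half_period s m.+1 u)) rpredD ?dt // -opprB rpredN.
have cs : count id s = m by apply/eqP; rewrite eqn_leq hc le_m.
have hm' := ltnW hm.
rewrite (full_period_period sz cs) // periodD pv // (full_period_period sz cs) //.
by set p := period _ _ _; rewrite (_ : _ - t s = 0) ?dvdz0 //; ring.
Qed.

(** * Invariant cocycles of degree 2 *)

Definition indicator (s : bitseq) : seq nat := map nat_of_bool s.

(** In degree 1, cochains are functions c on subsets (indicator words), and a cocycle of
    degree 2 records the failure of c to be additive on disjoint unions.  The potential
    recovers c from it by adding the elements of s one at a time, up to the additive
    function [linear_part], which has the same values on singletons. *)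
Fixpoint potential (s : bitseq) (z : cochain) : int :=
  if s is b :: s' then
    potential s' (restrict z) - (if b then z (2 :: indicator s') else 0)
  else 0.

Fixpoint linear_part (s : bitseq) (c : cochain) : int :=
  if s is b :: s' then
    linear_part s' (restrict c) + (if b then c (1%N :: nseq (size s') 0%N) else 0)
  else 0.

Lemma word_indicator n s : size s = n -> word n 1 (indicator s).
Proof.
move=> sz; rewrite /word size_map sz eqxx all_map; apply/allP => b _ /=.
exact: leq_b1.
Qed.

Lemma potentialB s y z :
  potential s (fun w => y w - z w) = potential s y - potential s z.
Proof.
by elim: s y z => [|b s IH] y z //=; rewrite IH; case: b; ring.
Qed.

Lemma eq_potential n s : forall y z, size s = n ->
  (forall w, word n 2 w -> y w = z w) -> potential s y = potential s z.
Proof.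
elim: s n => [|b s IH] [|n] // y z [sz] e /=; congr (_ - _).
  by apply: (IH n) => // w hw; apply: e; rewrite word_cons.
by case: b; rewrite ?e // word_cons (word_widen (m := 1)) ?word_indicator.
Qed.

Lemma delta1 n c w : word n 2 w -> delta 1 c w =
  c (indicator (map (eq_op 2) w)) - c (indicator (map (ltn 0) w))
  + c (indicator (map (eq_op 1%N) w)).
Proof.
move=> hw; rewrite /delta !big_nat_recr //= big_nil add0r mul1r expr1 sqrrN expr1n mul1r.
rewrite mulN1r /indicator -!map_comp.
by congr (c _ - c _ + c _); apply: (eq_map_word hw) => -[|[|[|]]].
Qed.

Lemma delta1_top n c s : size s = n -> delta 1 c (2 :: indicator s) =
  c (1%N :: nseq n 0%N) - c (1%N :: indicator s) + c (0%N :: indicator s).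
Proof.
move=> sz; rewrite (delta1 (n := n.+1)); last first.
  by rewrite word_cons (word_widen (m := 1)) ?word_indicator.
rewrite /indicator /= -!map_comp -sz.
congr (c (_ :: _) - c (_ :: _) + c (_ :: _)).
- by elim: (s) => //= -[] s' ->.
- by apply: eq_map => -[].
- by apply: eq_map => -[].
Qed.

Lemma potential_delta n s : forall c, size s = n -> normal n 1 c ->
  potential s (delta 1 c) = c (indicator s) - linear_part s c.
Proof.
elim: s n => [|b s IH] [|n] c // => [_|[sz]] nc.
  by rewrite /= subr0 (nc _ 1%N).
have := IH n (restrict c) sz (normal_restrict nc); rewrite /= => ->.
case: b => /=; last by rewrite subr0 addr0.
by rewrite (delta1_top _ sz) /restrict sz; ring.
Qed.

Lemma potential_small n s z : size s = n -> normal n 2 z ->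
  (count id s <= 1)%N -> potential s z = 0.
Proof.
elim: s n z => [|b s IH] [|n] // z [sz] nz /= hc.
rewrite (IH n (restrict z)) // ?sub0r; last by lia.
  case: b hc => //= hc; rewrite (nz _ 1%N) ?oppr0 //.
    by rewrite word_cons (word_widen (m := 1)) ?word_indicator.
  rewrite inE /=; apply/mapP => -[[] // bs _].
  by have := has_count id s; rewrite (_ : has id s) //; [lia | apply/hasP; exists true].
exact: normal_restrict.
Qed.

(** The sets of positions of 2 and of 1 in w are disjoint with union the set of positions
    of nonzero letters. *)
Lemma linear_part_additive w : forall c,
  linear_part (map (eq_op 2) w) c - linear_part (map (ltn 0) w) c
  + linear_part (map (eq_op 1%N) w) c = 0 \/ has (ltn 2) w.
Proof.
elim: w => [|j w IH] c; first by left.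
have [|h] := IH (restrict c); last by right; rewrite /= h orbT.
rewrite /= !size_map => e.
case: j => [|[|[|j]]] /=; [left|left|left|right] => //.
- by rewrite !addr0.
- by apply: etrans e; ring.
- by apply: etrans e; ring.
Qed.

(** For k odd the periods of an invariant cocycle vanish, so it is delta c; if its potential
    is zero, c is additive and its coboundary vanishes. *)
Lemma top_cocycle_eq0 n k z : odd k -> invariant n k 2 z -> is_cocycle n 2 z ->
  (forall s, size s = n -> (2 <= count id s)%N -> potential s z = 0) ->
  forall w, word n 2 w -> z w = 0.
Proof.
move=> od iz cz pz.
have ez s : size s = n -> count id s = 2 -> period s 2 z = 0.
  move=> sz cs; have := @period_flip n s k 2 z sz cs.
  rewrite (eq_period sz _ iz.2) ?cs // addn2 !exprS -signr_odd od expr1 mulrA mulrNN !mul1r mulN1r.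
  by lia.
have [c nc zc] := exactness_pos iz.1 cz ez.
have lc s : size s = n -> c (indicator s) = linear_part s c.
  move=> sz; apply/eqP; rewrite -subr_eq0 -(potential_delta sz nc); apply/eqP.
  rewrite -(eq_potential sz zc); case: (ltnP (count id s) 2) => hs; last exact: pz.
  exact: (potential_small sz iz.1).
move=> w hw; have /andP[/eqP sz /allP hw2] := hw.
rewrite zc // (delta1 _ hw) !lc ?size_map //.
have [->//|/hasP[x xw]] := linear_part_additive w c.
by have := hw2 x xw => /= ? ?; lia.
Qed.

(** For k odd every cochain of degree 1 is invariant, because the reversal of letters
    0 and 1 is trivial; so any function on the sets with at least two elements gives a
    cocycle. *)
Lemma top_cocycle_exists n k (t : bitseq -> int) : odd k ->
  exists z, [/\ invariant n k 2 z, is_cocycle n 2 z &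
    forall s, size s = n -> (2 <= count id s)%N -> potential s z = t s].
Proof.
(* functions on the sets with at least two elements, extended by zero *)
move=> od; pose c w := if (2 <= count_mem 1%N w)%N then t (map (eq_op 1%N) w) else 0.
have nc : normal n 1 c.
  move=> w j hw hj jw; have -> : c w = 0; last by [].
  rewrite /c; have ej : j = 1%N by lia.
  by move: jw; rewrite ej -has_pred1 has_count; case: ifP => //; lia.
have ic : invariant n k 1 c.
  split=> // w hw; rewrite /flip /rev_sign binn addn1 -signr_odd /= od expr0 mul1r.
  by congr c; rewrite -[RHS]map_id; apply: (eq_map_word hw) => -[|[|]].
exists (delta 1 c); split.
- exact: invariant_delta.
- by move=> w hw; apply: deltaK hw.
move=> s sz hs; rewrite (potential_delta sz nc).
have -> : linear_part s c = 0.
  have c0 u : (count_mem 1%N u <= 1)%N -> c u = 0.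
    by rewrite /c; case: ifP => //; lia.
  elim: s c c0 {sz hs nc ic} => //= b s IH c c0.
  rewrite IH => [|u hu]; last by rewrite /restrict c0.
  case: b; rewrite // c0 // /= count_nseq /=; lia.
rewrite subr0 /c /indicator -map_comp count_map.
rewrite (eq_count (a2 := id)); last by case.
by rewrite hs; congr t; rewrite -[RHS]map_id; apply: eq_map => -[].
Qed.

(** * Words as labels of cells *)

(** The nondegenerate words; they correspond to the partitions into nonempty blocks. *)
Definition packed (n m : nat) (w : seq nat) : bool :=
  word n m w && all (mem w) (iota 1 m).

Lemma packedP n m w :
  reflect (word n m w /\ forall j, (0 < j <= m)%N -> j \in w) (packed n m w).
Proof.
apply: (iffP andP) => -[hw h]; split=> //.
  by move=> j hj; apply: (allP h); rewrite mem_iota; lia.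
by apply/allP => j; rewrite mem_iota => hj; apply: h; lia.
Qed.

Lemma packed_word n m w : packed n m w -> word n m w.
Proof. by case/andP. Qed.

Lemma packed_le n m w : packed n m w -> (m <= n)%N.
Proof.
case/andP=> /andP[/eqP sz _] /allP sub.
by have := uniq_leq_size (iota_uniq 1 m) sub; rewrite size_iota sz.
Qed.

Lemma packed_reverse n m w : packed n m w -> packed n m (map (reverse_letter m) w).
Proof.
move=> /packedP[hw h]; apply/packedP; split; first exact: word_reverse.
move=> j hj; apply/mapP; exists (reverse_letter m j).
  by apply: h; rewrite /reverse_letter; split_ifs.
by rewrite /reverse_letter; split_ifs.
Qed.

Lemma packed_merge n m i w : (i <= m.+1)%N ->
  packed n m.+1 w -> packed n m (map (merge_letter m i) w).
Proof.
move=> hi /packedP[hw h]; apply/packedP; split; first exact: word_merge.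
move=> j hj; apply/mapP; exists (if (j <= i)%N then j else j.+1).
  by apply: h; split_ifs.
by rewrite /merge_letter; split_ifs.
Qed.

Lemma merge_reverse n m i w : (i <= m.+1)%N -> word n m.+1 w ->
  map (merge_letter m i) (map (reverse_letter m.+1) w)
  = map (reverse_letter m) (map (merge_letter m (m.+1 - i)) w).
Proof.
move=> hi hw; rewrite -!map_comp; apply: (eq_map_word hw) => x hx /=.
by rewrite /merge_letter /reverse_letter; split_ifs.
Qed.

Lemma normal_unpacked n m c w : normal n m c -> word n m w -> ~~ packed n m w ->
  c w = 0.
Proof.
move=> nc hw npw; have /allPn[j] : ~~ all (mem w) (iota 1 m).
  by apply: contra npw => h; rewrite /packed hw.
by rewrite mem_iota => hj jw; apply: (nc w j hw _ jw); lia.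
Qed.

Lemma nth_map0 (f : nat -> nat) w a : f 0%N = 0%N ->
  nth 0%N (map f w) a = f (nth 0%N w a).
Proof.
move=> f0; have [lt_a|le_a] := ltnP a (size w); first by rewrite (nth_map 0%N).
by rewrite !nth_default ?size_map.
Qed.

Lemma in_bigcup_seq (T : finType) (s : seq {set T}) (a : T) :
  (a \in \bigcup_(B <- s) B) = has (fun B : {set T} => a \in B) s.
Proof. by elim: s => [|B s IH]; rewrite ?big_nil ?inE // big_cons inE IH. Qed.

Section Labels.
Variable n : nat.
Local Notation T := 'I_n.+1.
Local Notation block := {set T}.
Local Notation blocks := (n.+1.-bseq block).

(** Position n is beyond the end of w, so the default value of nth gives the element n+1
    the letter 0. *)
Definition letter_block (w : seq nat) (t : nat) : block :=
  [set a : T | nth 0%N w a == t].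

Definition word_blocks (m : nat) (w : seq nat) : seq block :=
  map (letter_block w) (rcons (iota 1 m) 0%N).

Definition block_index (m j : nat) : nat := if j == 0%N then m else j.-1.

Lemma size_word_blocks m w : size (word_blocks m w) = m.+1.
Proof. by rewrite size_map size_rcons size_iota. Qed.

Lemma nth_letter m w (a : T) : word n m w -> (nth 0%N w a <= m)%N.
Proof.
move=> /andP[/eqP sz /all_nthP h]; have [lt_a|le_a] := ltnP a (size w).
  exact: h.
by rewrite nth_default.
Qed.

Lemma nth_block_letter m t : (t <= m)%N ->
  nth 0%N (rcons (iota 1 m) 0%N) t = if t == m then 0%N else t.+1.
Proof.
move=> ht; rewrite nth_rcons size_iota.
by case: ltngtP ht => // h _; rewrite nth_iota.
Qed.

Lemma nth_word_blocks m w t : (t <= m)%N ->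
  nth set0 (word_blocks m w) t = letter_block w (if t == m then 0%N else t.+1).
Proof.
by move=> ht; rewrite (nth_map 0%N) ?nth_block_letter // size_rcons size_iota.
Qed.

Lemma in_word_blocks m w t (a : T) : word n m w -> (t <= m)%N ->
  (a \in nth set0 (word_blocks m w) t) = (t == block_index m (nth 0%N w a)).
Proof.
move=> hw ht; rewrite nth_word_blocks // inE; have := nth_letter a hw.
by rewrite /block_index => ?; apply/eqP/eqP; split_ifs.
Qed.

Lemma nth_ord_max m w : word n m w -> nth 0%N w (ord_max : T) = 0%N.
Proof. by move=> /andP[/eqP sz _]; rewrite nth_default // sz. Qed.

Lemma word_blocks_inj m w w' : word n m w -> word n m w' ->
  word_blocks m w = word_blocks m w' -> w = w'.
Proof.
move=> hw hw' e; have /andP[/eqP sz _] := hw; have /andP[/eqP sz' _] := hw'.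
apply: (@eq_from_nth _ 0%N) => [|i hi]; first by rewrite sz.
have hin : (i < n.+1)%N by rewrite ltnW // ltnS -sz.
have [a <-] : exists a : T, a = i :> nat by exists (Ordinal hin).
have la := nth_letter a hw; have la' := nth_letter a hw'.
have hb : (block_index m (nth 0%N w a) <= m)%N by rewrite /block_index; split_ifs.
have := in_word_blocks a hw hb; rewrite eqxx e (in_word_blocks a hw' hb) => /eqP.
by rewrite /block_index; split_ifs.
Qed.

Lemma letter_surj m w t : packed n m w -> (t <= m)%N ->
  exists a : T, nth 0%N w a = t.
Proof.
move=> /packedP[hw h] ht; have [->|t0] := posnP t.
  by exists ord_max; apply: nth_ord_max hw.
have tw : t \in w by apply: h; rewrite t0.
have /andP[/eqP sz _] := hw.
have ha : (index t w < n.+1)%N by rewrite ltnW // ltnS -sz index_mem.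
by exists (Ordinal ha); apply: nth_index.
Qed.

Lemma word_blocks_label m w (p : blocks) : packed n m w -> (1 < m)%N ->
  p = word_blocks m w :> seq block -> cyclic_label p.
Proof.
move=> pw hm ep; have hw := packed_word pw.
rewrite /cyclic_label /linearly_ordered_partition ep size_word_blocks ltnS hm.
apply/and3P; split=> //.
  apply/and3P; split.
  - apply/mapP => -[t]; rewrite mem_rcons inE mem_iota => ht e.
    have [|a ha] := @letter_surj m w t pw; first by move: ht; lia.
    by have := in_set0 a; rewrite e inE ha eqxx.
  - rewrite pairwise_map; apply/(pairwiseP 0%N) => i j; rewrite !inE size_rcons size_iota.
    move=> hi hj ij /=; rewrite disjoints_subset; apply/subsetP => a.
    rewrite !inE => /eqP->; rewrite !nth_block_letter; try lia.
    by apply/eqP; split_ifs.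
  - apply/eqP/setP => a; rewrite in_setT in_bigcup_seq; apply/hasP.
    exists (letter_block w (nth 0%N w a)); last by rewrite inE eqxx.
    apply: map_f; rewrite mem_rcons inE mem_iota.
    by have := nth_letter a hw; lia.
rewrite -nth_last size_word_blocks /= in_word_blocks //.
by rewrite (nth_ord_max hw) /block_index.
Qed.

Definition label_letter (p : seq block) (a : T) : nat :=
  let i := (find (fun B : block => a \in B) p).+1 in if i == size p then 0%N else i.

Definition label_word (p : seq block) : seq nat :=
  [seq label_letter p (inord a) | a <- iota 0 n].

Lemma label_mem (p : blocks) (a : T) t : linearly_ordered_partition p ->
  (t < size p)%N ->
  (a \in nth set0 p t) = (t == find (fun B : block => a \in B) p).
Proof.
move=> /and3P[_ /(pairwiseP set0) dis /eqP cov] ht.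
have hp : has (fun B : block => a \in B) p by rewrite -in_bigcup_seq cov in_setT.
set f := find _ _; have hf : (f < size p)%N by rewrite -has_find.
have af : a \in nth set0 p f by apply: (nth_find set0 hp).
apply/idP/eqP => [at_|-> //]; case: (ltngtP t f) => // h.
  have := dis t f ht hf h; rewrite disjoints_subset => /subsetP/(_ a at_).
  by rewrite inE af.
have := dis f t hf ht h; rewrite disjoints_subset => /subsetP/(_ a af).
by rewrite inE at_.
Qed.

Lemma label_find_lt (p : blocks) (a : T) : linearly_ordered_partition p ->
  (find (fun B : block => a \in B) p < size p)%N.
Proof. by move=> /and3P[_ _ /eqP cov]; rewrite -has_find -in_bigcup_seq cov in_setT. Qed.

Lemma nth_label_word (p : blocks) (a : T) : cyclic_label p ->
  nth 0%N (label_word p) a = label_letter p a.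
Proof.
move=> /and3P[lp hp mp]; rewrite /label_word.
have [lt_a|le_a] := ltnP a n.
  by rewrite (nth_map 0%N) ?size_iota // nth_iota // add0n inord_val.
rewrite nth_default ?size_map ?size_iota // /label_letter.
have -> : a = ord_max by apply: val_inj => /=; have := ltn_ord a; lia.
rewrite -nth_last (label_mem _ lp) in mp; last by lia.
by rewrite -(eqP mp) prednK ?eqxx //; lia.
Qed.

Lemma label_word_packed (p : blocks) : cyclic_label p ->
  packed n (size p).-1 (label_word p).
Proof.
move=> cp; have /and3P[lp hp mp] := cp; apply/packedP; split.
  rewrite /word size_map size_iota eqxx all_map; apply/allP => i _ /=.
  by have := label_find_lt (inord i) lp; rewrite /label_letter; split_ifs.
move=> j hj; have [a ha] : exists a : T, a \in nth set0 p j.-1.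
  apply/set0Pn; apply: contraTneq lp => e; apply/negP => /and3P[/negP[]].
  have hlt : (j.-1 < size p)%N by move: hj hp; clear; lia.
  by rewrite -[X in X \in _]e mem_nth.
rewrite (label_mem _ lp) in ha; last by lia.
have e : label_letter p a = j.
  by rewrite /label_letter -(eqP ha) prednK; [split_ifs | lia].
rewrite -e -(nth_label_word _ cp); apply: mem_nth.
rewrite size_map size_iota ltnNge; apply/negP => h.
move: e; rewrite -(nth_label_word _ cp) nth_default ?size_map ?size_iota //.
by move=> e; move: hj; rewrite -e.
Qed.

Lemma label_wordK (p : blocks) : cyclic_label p ->
  word_blocks (size p).-1 (label_word p) = p.
Proof.
move=> cp; have /and3P[lp hp mp] := cp.
have pw := packed_word (label_word_packed cp).
apply: (@eq_from_nth _ set0); first by rewrite size_word_blocks prednK //; lia.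
move=> t; rewrite size_word_blocks ltnS => ht; apply/setP => a.
rewrite (in_word_blocks a pw ht) (label_mem a lp); last by lia.
rewrite (nth_label_word _ cp) /label_letter /block_index.
by have := label_find_lt a lp; split_ifs.
Qed.

Lemma rev_iota_reverse m :
  map (reverse_letter m) (rcons (iota 1 m) 0%N) = rot 1 (rev (rcons (iota 1 m) 0%N)).
Proof.
rewrite rev_rcons rot1_cons map_rcons; congr rcons.
apply: (@eq_from_nth _ 0%N) => [|i]; first by rewrite size_rev size_map.
rewrite size_map size_iota => hi; rewrite (nth_map 0%N) ?size_iota //.
rewrite nth_rev ?size_iota // !nth_iota; try lia.
by rewrite /reverse_letter; split_ifs.
Qed.

Lemma letter_block_reverse m w t : word n m w -> (t <= m)%N ->
  letter_block (map (reverse_letter m) w) t = letter_block w (reverse_letter m t).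
Proof.
move=> hw ht; apply/setP => a; rewrite !inE.
rewrite nth_map0 //; have := nth_letter a hw; rewrite /reverse_letter => ?.
by apply/eqP/eqP; split_ifs.
Qed.

Lemma word_blocks_reverse m w : word n m w ->
  word_blocks m (map (reverse_letter m) w) = rot 1 (rev (word_blocks m w)).
Proof.
move=> hw; rewrite /word_blocks -map_rev -map_rot -rev_iota_reverse -map_comp.
apply/eq_in_map => t; rewrite mem_rcons inE mem_iota => ht.
by rewrite /= letter_block_reverse //; lia.
Qed.

Definition word_label (m : nat) (w : seq nat) : blocks :=
  insub_bseq n.+1 (word_blocks m w).

Lemma val_word_label m w : packed n m w ->
  word_label m w = word_blocks m w :> seq block.
Proof.
move=> /packed_le hm; rewrite /word_label /insub_bseq insubdK //.
by rewrite unfold_in size_word_blocks.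
Qed.

Lemma reflect_word_label m w : packed n m w ->
  reflect_label (word_label m w) = word_label m (map (reverse_letter m) w).
Proof.
move=> pw; apply: val_inj => /=; rewrite !val_word_label ?packed_reverse //.
by rewrite (word_blocks_reverse (packed_word pw)).
Qed.

Lemma word_label_inj m m' w w' : packed n m w -> packed n m' w' ->
  word_label m w = word_label m' w' -> m = m' /\ w = w'.
Proof.
move=> pw pw' /(congr1 val); rewrite /= !val_word_label // => e.
have em : m = m' by have := congr1 size e; rewrite !size_word_blocks => -[].
by subst m'; split=> //; apply: (word_blocks_inj (packed_word pw) (packed_word pw') e).
Qed.

Lemma cyclic_label_word (p : blocks) : cyclic_label p ->
  exists m w, [/\ (1 < m)%N, packed n m w & p = word_label m w].
Proof.
move=> cp; exists (size p).-1, (label_word p); split.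
- by case/and3P: cp => _ ? _; lia.
- exact: label_word_packed.
- by apply: val_inj; rewrite /= val_word_label ?label_word_packed // label_wordK.
Qed.

Local Notation cellT := (bicyclic_label n).

(** A cell is named by a word and by its reversal, and by no other words. *)
Definition names (m : nat) (w : seq nat) (x : cellT) : bool :=
  [&& (1 < m)%N, packed n m w
    & val x == [set word_label m w; word_label m (map (reverse_letter m) w)]].

Lemma names_reverse m w x : names m w x -> names m (map (reverse_letter m) w) x.
Proof.
case/and3P=> hm pw /eqP ex; apply/and3P; split; rewrite ?packed_reverse //.
by rewrite ex (reverseK (packed_word pw)) setUC.
Qed.

Lemma names_eq m w x y : names m w x -> names m w y -> x = y.
Proof.
by case/and3P=> _ _ /eqP ex /and3P[_ _ /eqP ey]; apply: val_inj; rewrite /= ex ey.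
Qed.

Lemma names_word m w m' w' x : names m w x -> names m' w' x ->
  m' = m /\ (w' = w \/ w' = map (reverse_letter m) w).
Proof.
case/and3P=> _ pw /eqP ex /and3P[_ pw' /eqP ey].
have : word_label m' w' \in val x by rewrite ey !inE eqxx.
rewrite ex !inE => /orP[] /eqP /word_label_inj-/(_ pw'); first by case/(_ pw); auto.
by case/(_ (packed_reverse pw)); auto.
Qed.

Lemma names_cell m w : (1 < m)%N -> packed n m w -> exists x, names m w x.
Proof.
move=> hm pw; set X := [set word_label m w; word_label m (map (reverse_letter m) w)].
have hX : is_bicyclic_label X.
  apply/existsP; exists (word_label m w); rewrite reflect_word_label // eqxx andbT.
  exact: (word_blocks_label pw hm (val_word_label pw)).
by exists (exist _ X hX); rewrite /names hm pw eqxx.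
Qed.

Lemma cell_names (x : cellT) : exists m w, names m w x.
Proof.
have /existsP[p /andP[cp /eqP ex]] := valP x.
have [m [w [hm pw ep]]] := cyclic_label_word cp.
by exists m, w; rewrite /names hm pw /= ex ep reflect_word_label // eqxx.
Qed.

Lemma names_le m w x : names m w x -> (1 < m <= n)%N.
Proof. by case/and3P=> hm /packed_le -> _; rewrite hm. Qed.

Lemma names_label m w x p : names m w x -> p \in val x ->
  exists2 w', names m w' x & p = word_blocks m w' :> seq block.
Proof.
move=> nx; have /and3P[hm pw /eqP ex] := nx; rewrite ex !inE => /orP[] /eqP ->.
  by exists w => //; apply: val_word_label.
exists (map (reverse_letter m) w); first exact: names_reverse.
by apply: val_word_label; apply: packed_reverse.
Qed.

Lemma names_mem m w x : names m w x -> word_label m w \in val x.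
Proof. by case/and3P=> _ _ /eqP->; rewrite !inE eqxx. Qed.

Lemma names_packed m w x : names m w x -> packed n m w.
Proof. by case/and3P. Qed.

Lemma names_dim m w x : names m w x -> bicyclic_dim x = (n - m)%N.
Proof.
move=> nx; rewrite /bicyclic_dim -[RHS]subSS; congr (_ - _)%N; apply/eqP.
rewrite eqn_leq; apply/andP; split.
  by apply/bigmax_leqP => p /(names_label nx)[w' _ ->]; rewrite size_word_blocks.
rewrite -(size_word_blocks m w) -(val_word_label (names_packed nx)).
exact: (leq_bigmax_cond (F := fun p : blocks => size p) _ (names_mem nx)).
Qed.

End Labels.

(** * Faces as merged words *)

(** Cutting into one run less than there are blocks joins exactly two adjacent blocks. *)
Lemma runs_one_merge (T : finType) (runs : seq (seq {set T})) :
  all (fun r => r != [::]) runs -> size (flatten runs) = (size runs).+1 ->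
  exists A x y C, flatten runs = A ++ x :: y :: C /\
    [seq \bigcup_(B <- r) B | r <- runs] = A ++ (x :|: y) :: C.
Proof.
have ge rs : all (fun r : seq {set T} => r != [::]) rs -> (size rs <= size (flatten rs))%N.
  by elim: rs => //= -[|B r] rs IH //= /IH h; rewrite size_cat; lia.
have single rs : all (fun r : seq {set T} => r != [::]) rs ->
    size (flatten rs) = size rs -> [seq \bigcup_(B <- r) B | r <- rs] = flatten rs.
  elim: rs => //= -[|B [|B' r]] rs IH //= hrs; rewrite ?size_cat.
    by move=> [] /(IH hrs) ->; rewrite big_seq1.
  by have := ge _ hrs; lia.
elim: runs => //= -[|B [|B' [|B'' r]]] runs IH //= hrs; rewrite ?size_cat.
- move=> [] /(IH hrs)[A [x [y [C [-> ->]]]]]; exists (B :: A), x, y, C.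
  by rewrite big_seq1.
- move=> [] /(single _ hrs) ->; exists [::], B, B', (flatten runs).
  by rewrite big_cons big_seq1.
- by have := ge _ hrs; move=> /= ?; lia.
Qed.

Section Faces.
Variable n : nat.
Local Notation T := 'I_n.+1.
Local Notation block := {set T}.
Local Notation blocks := (n.+1.-bseq block).

Lemma nth_map_merge m i w a : nth 0%N (map (merge_letter m i) w) a = merge_letter m i (nth 0%N w a).
Proof. exact: nth_map0. Qed.

(** The two joined blocks are consecutive in a rotation of p.  As the element n+1 is in the
    last block both of p and of q, the rotation is trivial, unless the block of n+1 is
    joined with the first one. *)
Lemma refines_merge m w v (p q : blocks) : packed n m.+1 w -> packed n m v ->
  p = word_blocks n m.+1 w :> seq block -> q = word_blocks n m v :> seq block ->
  cyclic_refines p q -> exists2 i, (i <= m.+1)%N & map (merge_letter m i) w = v.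
Proof.
move=> pw pv ep eq [j [runs [fl un]]]; have hw := packed_word pw; have hv := packed_word pv.
have sz : size runs = m.+1 by rewrite -(size_map (fun r => \bigcup_(B <- r) B)) un eq size_word_blocks.
have rne : all (fun r => r != [::]) runs.
  apply/allP => r rr; apply/eqP => er.
  have : set0 \in (q : seq block) by rewrite -un; apply/mapP; exists r; rewrite // er big_nil.
  rewrite eq => /mapP[t]; rewrite mem_rcons inE mem_iota => ht e.
  have [|a ha] := @letter_surj n m v t pv; first by lia.
  by have := in_set0 a; rewrite e inE ha eqxx.
have [|A [x [y [C [e1 e2]]]]] := runs_one_merge rne.
  by rewrite fl size_rot ep size_word_blocks sz.
have {j fl} [j hj fl] : exists2 j, (j <= m.+1)%N & flatten runs = rot j p.
  have [hj|hj] := leqP j m.+1; first by exists j.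
  by exists 0%N => //; rewrite fl rot0 rot_oversize // ep size_word_blocks.
pose k := size A.
have szA : (k <= m)%N.
  have := congr1 size e2; rewrite un eq size_word_blocks size_cat /= /k; lia.
(* the place of the block of the letter c in the rotated sequence *)
pose rpos c := if (j <= block_index m.+1 c)%N then (block_index m.+1 c - j)%N
               else (block_index m.+1 c + m.+2 - j)%N.
have key (a : T) : block_index m (nth 0%N v a) =
    let t := rpos (nth 0%N w a) in if (t <= k)%N then t else t.-1.
  set c := nth 0%N w a; have hc : (c <= m.+1)%N := nth_letter a hw.
  have hb : (block_index m.+1 c <= m.+1)%N by rewrite /block_index; split_ifs.
  have ht : (rpos c <= m.+1)%N by rewrite /rpos; split_ifs.
  have ain : a \in nth set0 (A ++ x :: y :: C) (rpos c).
    rewrite -e1 fl /rot nth_cat size_drop ep size_word_blocks nth_drop.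
    have fin i : i = block_index m.+1 c -> a \in nth set0 (word_blocks n m.+1 w) i.
      by move=> ->; rewrite in_word_blocks.
    case: ifP => h; last rewrite nth_take.
    - by apply: fin; move: h; rewrite /rpos; split_ifs.
    - by apply: fin; move: h; rewrite /rpos; split_ifs.
    - by move: h; rewrite /rpos; split_ifs.
  have inq t : (t <= m)%N -> a \in nth set0 (A ++ (x :|: y) :: C) t ->
      block_index m (nth 0%N v a) = t.
    by move=> htm; rewrite -e2 un eq in_word_blocks // => /eqP.
  move: ain; rewrite nth_cat /=; case: ltnP => h1.
    by rewrite ifT ?(ltnW h1) // => ain; apply: inq; rewrite ?nth_cat ?h1 //; lia.
  case E: (rpos c - k)%N => [|[|d]] /= ain.
  - rewrite ifT; last by lia.
    apply: inq; first by lia.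
    rewrite nth_cat ifF; last by rewrite -/k; lia.
    by rewrite -/k E /= !inE ain.
  - rewrite ifF; last by lia.
    apply: inq; first by lia.
    rewrite nth_cat ifF; last by rewrite -/k; lia.
    by rewrite (_ : (_ - _ = 0)%N) /=; [rewrite !inE ain orbT | rewrite -/k; lia].
  - rewrite ifF; last by lia.
    apply: inq; first by lia.
    rewrite nth_cat ifF; last by rewrite -/k; lia.
    by rewrite (_ : (_ - _ = d.+1)%N) //= -/k; lia.
have kmax := key ord_max; rewrite !(nth_ord_max hw, nth_ord_max hv) /= in kmax.
(* the element n+1 is in the last block before and after the union *)
have {kmax} hjk : j = 0%N \/ j = 1%N /\ k = m.
  move: kmax; rewrite /rpos /block_index /=; split_ifs.
exists (if j == 0%N then k.+1 else 0%N); first by split_ifs.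
have /andP[/eqP szw _] := hw; have /andP[/eqP szv _] := hv.
apply: (@eq_from_nth _ 0%N) => [|i hi]; first by rewrite size_map szw szv.
have hin : (i < n.+1)%N by move: hi; rewrite size_map szw; lia.
have [a <-] : exists a : T, a = i :> nat by exists (Ordinal hin).
rewrite nth_map_merge; have := key a; have := nth_letter a hw; have := nth_letter a hv.
move: (nth _ w a) (nth _ v a) => c c' h1 h2.
by rewrite /rpos /block_index /merge_letter; case: hjk => [->|[-> ->]] /=; split_ifs.
Qed.

(** The cyclic sequence of blocks, cut such that the two blocks to be joined are adjacent.
    For i = 0 these are the last and the first block, whence the rotation. *)
Lemma letters_merge m i : (i <= m.+1)%N -> exists A C,
  let y := (if i == m.+1 then 0 else i.+1)%N in
  [/\ rot (i == 0%N) (rcons (iota 1 m.+1) 0%N) = A ++ i :: y :: C,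
      map (merge_letter m i) (A ++ i :: C) = rcons (iota 1 m) 0%N
    & {in A ++ C, forall l, [/\ l <= m.+1, l != i & l != y]%N}].
Proof.
case: i => [|i] hi.
  exists (iota 2 m), [::] => /=; rewrite rot1_cons; split.
  - by rewrite -cats1 -cats1 -catA.
  - rewrite map_cat cats1; congr rcons.
    rewrite -[RHS]map_id (iotaDl 1 1 m) -map_comp; apply/eq_in_map => l.
    by rewrite mem_iota /= /merge_letter => ?; split_ifs.
  - by move=> l; rewrite cats0 mem_iota => ?; split; lia.
rewrite rot0; case: eqVneq => [[->]|ne].
  exists (iota 1 m), [::]; split.
  - by rewrite -[in LHS](addn1 m) iotaD -cats1 -catA add1n.
  - rewrite map_cat /= cats1; congr rcons; last by rewrite /merge_letter leqnn eqxx.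
    rewrite -[RHS]map_id; apply/eq_in_map => l; rewrite mem_iota /merge_letter => ?; split_ifs.
  - by move=> l; rewrite cats0 mem_iota => ?; split; lia.
have {}hi : (i < m)%N by lia.
exists (iota 1 i), (rcons (iota i.+3 (m - i.+1)) 0%N); split.
- have -> : m.+1 = (i + (m - i.+1).+2)%N by lia.
  by rewrite iotaD rcons_cat.
- rewrite map_cat /= map_rcons.
  rewrite [in RHS](_ : m = (i + (m - i.+1).+1)%N); last by lia.
  rewrite iotaD rcons_cat; congr (_ ++ _ :: rcons _ _).
  + rewrite -[RHS]map_id; apply/eq_in_map => l; rewrite mem_iota /merge_letter => ?; split_ifs.
  + by rewrite /merge_letter; split_ifs.
  + rewrite /= add1n -[RHS]map_id (iotaDl 1 i.+2) -map_comp; apply/eq_in_map => l.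
    by rewrite mem_iota /merge_letter /= => ?; split_ifs.
- move=> l; rewrite mem_cat mem_rcons inE !mem_iota => ?; split; lia.
Qed.

Lemma merge_refines m i w (p q : blocks) : (i <= m.+1)%N -> packed n m.+1 w ->
  p = word_blocks n m.+1 w :> seq block ->
  q = word_blocks n m (map (merge_letter m i) w) :> seq block -> cyclic_refines p q.
Proof.
move=> hi pw ep eq; have hw := packed_word pw.
have [A [C [e1 e2 h]]] := letters_merge hi; set y := (if _ then _ else _) in e1 h.
pose single := map (fun l : nat => [:: l]).
exists (i == 0%N : nat),
  (map (map (letter_block n w)) (single A ++ [:: i; y] :: single C)).
have fs B : flatten (single B) = B by elim: B => //= l B ->.
rewrite -map_flatten flatten_cat /= !fs -e1 ep /word_blocks map_rot; split=> //.
rewrite eq /word_blocks -e2 -!map_comp !map_cat /=.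
have one l : l \in A ++ C -> \bigcup_(B <- [seq letter_block n w i0 | i0 <- [:: l]]) B
    = letter_block n (map (merge_letter m i) w) (merge_letter m i l).
  move=> /h [h1 h2 h3]; rewrite /= big_seq1; apply/setP => a; rewrite !inE nth_map_merge.
  have := nth_letter a hw; move: h3; rewrite /merge_letter /y => h3 h4.
  by apply/eqP/eqP => [->//|]; move: h3; split_ifs.
congr (_ ++ _ :: _).
- rewrite /single -!map_comp; apply/eq_in_map => l lA; apply: one.
  by rewrite mem_cat lA.
- rewrite big_cons big_seq1; apply/setP => a; rewrite !inE nth_map_merge.
  have := nth_letter a hw; rewrite /merge_letter /y => h4.
  by apply/orP/eqP => [[/eqP->|/eqP->]|]; [split_ifs|split_ifs|];
    split_ifs; move=> ?; rewrite -!(rwP eqP); lia.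
- rewrite /single -!map_comp; apply/eq_in_map => l lC; apply: one.
  by rewrite mem_cat lC orbT.
Qed.

(** This is the dictionary between the face poset and the simplicial structure. *)
Lemma facetP m w (x y : bicyclic_label n) : names m w y ->
  @facet (QP n) y x <-> exists m' i,
    [/\ m = m'.+1, (i <= m)%N & names m' (map (merge_letter m' i) w) x].
Proof.
move=> ny; have /andP[hm hmn] := names_le ny; split.
  case=> -[p [q [py qx pq]]] /= hd.
  have [m' [v nx]] := cell_names x; have /andP[hm' hmn'] := names_le nx.
  move: hd; rewrite (names_dim ny) (names_dim nx) => hd.
  have em : m = m'.+1 by lia.
  subst m; have [w1 nw1 ep] := names_label ny py; have [v1 nv1 eq] := names_label nx qx.
  have [i hi e] := refines_merge (names_packed nw1) (names_packed nv1) ep eq pq.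
  have [_ [ew|ew]] := names_word ny nw1.
    by exists m', i; split=> //; rewrite -ew e.
  exists m', (m'.+1 - i)%N; split=> //; first exact: leq_subr.
  have hw := packed_word (names_packed ny).
  have := nv1; rewrite -e ew (merge_reverse hi hw) => /names_reverse.
  by rewrite (reverseK (word_merge _ hw)) // leq_subr.
move=> [m' [i [em hi nx]]]; subst m; split; last first.
  have /andP[hm' hmn'] := names_le nx.
  by rewrite /= (names_dim ny) (names_dim nx); lia.
exists (word_label n m'.+1 w), (word_label n m' (map (merge_letter m' i) w)); split.
- exact: names_mem ny.
- exact: names_mem nx.
- apply: (merge_refines hi (names_packed ny)); first exact: val_word_label (names_packed ny).
  exact: val_word_label (names_packed nx).
Qed.

End Faces.

(** * Signs of permutation words *)

Fixpoint inversions (w : seq nat) : nat :=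
  if w is x :: w' then (count (fun y => y < x) w' + inversions w')%N else 0%N.

Lemma inversions_mono (f : nat -> nat) w :
  {in w &, forall x y, (f y < f x)%N = (y < x)%N} ->
  inversions (map f w) = inversions w.
Proof.
elim: w => //= x w IH mf; rewrite IH; last first.
  by move=> y z yw zw; rewrite mf // inE ?yw ?zw orbT.
congr (_ + _)%N; rewrite count_map; apply: eq_in_count => y yw /=.
by rewrite mf // inE ?eqxx ?yw ?orbT.
Qed.

Lemma count_ltS_uniq w x : uniq w -> count (fun y => y < x.+1)%N w
  = (count (fun y => y < x)%N w + (x \in w))%N.
Proof.
move=> uw; rewrite -count_uniq_mem // -[RHS]count_predUI -[LHS]addn0; congr addn.
  by apply: eq_count => y /=; rewrite ltnS leq_eqVlt orbC.
by apply/esym/eqP; rewrite -leqn0 leqNgt -has_count; apply/hasPn => y _ /=; lia.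
Qed.

(** The reversal of letters exchanges inversions and non-inversions. *)
Lemma inversions_reverse m w : uniq w -> all (fun j => 0 < j <= m)%N w ->
  (inversions (map (reverse_letter m) w) + inversions w)%N = 'C(size w, 2).
Proof.
elim: w => //= x w IH /andP[xw uw] /andP[hx hw].
rewrite binS bin1 -IH // addnACA addnC; congr addn.
rewrite count_map -(count_predC (fun y => y < x)%N) addnC; congr addn.
apply: eq_in_count => y yw /=; have := allP hw y yw; have := neq_mem xw yw.
by rewrite /reverse_letter /= => ? ?; split_ifs.
Qed.

Definition swap_letter (i j : nat) : nat :=
  if j == i then i.+1 else if j == i.+1 then i else j.

(** Only the pair of positions of i and i+1 changes its order. *)
Lemma inversions_swap i w : uniq w -> i \in w -> i.+1 \in w ->
  odd (inversions (map (swap_letter i) w)) = ~~ odd (inversions w).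
Proof.
elim: w => //= x w IH /andP[xw uw].
have mono z : z \notin w -> (z == i) || (z == i.+1) ->
    inversions (map (swap_letter i) w) = inversions w.
  move=> zw /orP[] /eqP ez; subst z; apply: inversions_mono => a b aw bw.
    have e y : y \in w -> swap_letter i y = if y == i.+1 then i else y.
      by move/(neq_mem zw)/negbTE; rewrite /swap_letter => ->.
    rewrite !e //; move: (neq_mem zw aw) (neq_mem zw bw); clear; move=> ha hb.
    by case: eqP => [->|?]; case: eqP => [->|?]; lia.
  have e y : y \in w -> swap_letter i y = if y == i then i.+1 else y.
    by move/(neq_mem zw)/negbTE; rewrite /swap_letter => ->.
  rewrite !e //; move: (neq_mem zw aw) (neq_mem zw bw); clear; move=> ha hb.
  by case: eqP => [->|?]; case: eqP => [->|?]; lia.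
have swi : swap_letter i i = i.+1 by rewrite /swap_letter eqxx.
have swi1 : swap_letter i i.+1 = i by rewrite /swap_letter; split_ifs.
rewrite !inE; have [ex _|nei /= iw] := eqVneq i x.
  subst x; rewrite (_ : (i.+1 == i) = false) /=; last by lia.
  move=> xw1; rewrite swi (mono i) ?eqxx // count_map.
  rewrite (eq_in_count (a2 := fun y => y < i.+2)%N) => [|y yw /=]; last first.
    by have := neq_mem xw yw; rewrite /swap_letter; split_ifs.
  rewrite !count_ltS_uniq // xw1 (negbTE xw) addn0 !oddD /=.
  by rewrite addbT addNb.
have [ex _|nex /= iw1] := eqVneq i.+1 x.
  subst x; rewrite swi1 (mono i.+1) ?eqxx ?orbT // count_map.
  rewrite (eq_in_count (a2 := fun y => y < i)%N) => [|y yw /=]; last first.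
    by have := neq_mem xw yw; rewrite /swap_letter; split_ifs.
  by rewrite count_ltS_uniq // iw !oddD /= addbT addNb negbK.
have -> : swap_letter i x = x by rewrite /swap_letter; split_ifs.
rewrite count_map (eq_in_count (a2 := fun y => y < x)%N) => [|y yw /=]; last first.
  by have := neq_mem xw yw; rewrite /swap_letter; split_ifs.
by rewrite !oddD IH // addbN.
Qed.

Definition rotate_letter (n j : nat) : nat := if j == 1%N then n else j.-1.

(** The letter 1 becomes the largest; the pairs that contain it are the only ones whose
    order changes. *)
Lemma inversions_rotate n w : uniq w -> all (fun j => 0 < j <= n)%N w ->
  1%N \in w -> odd (inversions (map (rotate_letter n) w) + inversions w)
    = odd (size w).-1.
Proof.
elim: w => //= x w IH /andP[xw uw] /andP[hx hw].
rewrite inE; have [ex _|ne /= w1] := eqVneq 1%N x.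
  subst x.
  rewrite inversions_mono => [|a b aw bw]; last first.
    have := allP hw a aw; have := allP hw b bw.
    by have := neq_mem xw aw; have := neq_mem xw bw; rewrite /rotate_letter /=; split_ifs.
  rewrite (_ : count (fun y => y < 1)%N w = 0%N); last first.
    by apply/eqP; rewrite -leqn0 leqNgt -has_count; apply/hasPn => y /(allP hw) /=; lia.
  rewrite count_map add0n -addnA addnn oddD odd_double addbF; congr odd.
  apply/eqP; rewrite -all_count; apply/allP => y yw /=.
  by have := allP hw y yw; have := neq_mem xw yw; rewrite /rotate_letter /=; split_ifs.
have [k ek] : exists k, (count (fun y => y < x) w = k.+1
    /\ count (fun y => y < rotate_letter n x) (map (rotate_letter n) w) = k)%N.
  exists (count (fun y => (y < x) && (y != 1)) w)%N; split.
    have c1 : count_mem 1%N w = 1%N by rewrite count_uniq_mem // w1.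
    rewrite -addn1 -[X in (_ + X)%N]c1.
    rewrite -count_predUI -[LHS]addn0; congr addn.
      by apply: eq_count => y /=; lia.
    by apply/esym/eqP; rewrite -leqn0 leqNgt -has_count; apply/hasPn => y _ /=; lia.
  rewrite count_map; apply: eq_in_count => y yw /=.
  by have := allP hw y yw; rewrite /rotate_letter /=; split_ifs.
have {IH} := IH uw hw w1.
have : (0 < size w)%N by case: (w) w1.
case: ek => -> ->; lia.
Qed.

Definition perm_sign (w : seq nat) : int := (-1) ^+ inversions w.

Lemma packed_perm n w : packed n n w -> uniq w /\ all (fun j => 0 < j <= n)%N w.
Proof.
move=> /packedP[/andP[/eqP sz /allP hw] h].
have sub : {subset iota 1 n <= w} by move=> j; rewrite mem_iota => ?; apply: h; lia.
have uw := leq_size_uniq (iota_uniq 1 n) sub.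
have szw : (size w <= size (iota 1 n))%N by rewrite size_iota sz.
split; first exact: uw.
have [_ e] := uniq_min_size (iota_uniq 1 n) sub szw.
by apply/allP => j jw; move: (e j); rewrite jw mem_iota; lia.
Qed.

(** * Explicit incidence numbers *)

Lemma merge_succ m i : (i <= m.+1)%N ->
  merge_letter m i (if i == m.+1 then 0 else i.+1)%N = merge_letter m i i.
Proof. by move=> hi; rewrite /merge_letter leqnn; case: eqP => [->|] //= ?; split_ifs. Qed.

(** For m > 0 a face map identifies only one pair of cyclically consecutive letters; for
    m = 0 it would identify all of them. *)
Lemma merge_consecutive m i j : (0 < m)%N -> (i <= m.+1)%N -> (j <= m.+1)%N ->
  merge_letter m j i = merge_letter m j (if i == m.+1 then 0 else i.+1)%N -> i = j.
Proof.
move=> hm hi hj; rewrite /merge_letter; case: eqP => [->|/eqP ne] /=.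
  by split_ifs.
case: (leqP i j) => h1; case: (leqP i.+1 j) => h2; try lia.
by rewrite eqSS; case: eqP => h3; lia.
Qed.

Section Incidence.
Variable n : nat.
Local Notation T := 'I_n.+1.
Local Notation cellT := (bicyclic_label n).

(** The sign by which the word w represents its cell.  Any choice that obeys
    [orient_reverse] would do for the square of the boundary to vanish; for m = n the sign of the
    permutation makes the end points of edges cancel. *)
Definition orient (m : nat) (w : seq nat) : int :=
  if m == n then perm_sign w
  else if (index 1%N w < index m w)%N then 1 else rev_sign n m.

Lemma orient2 m w : orient m w * orient m w = 1.
Proof.
rewrite /orient; case: ifP => _; first by rewrite /perm_sign -expr2 sqrr_sign.
by case: ifP => _; rewrite ?mulr1 ?rev_sign2.
Qed.

Lemma orient_reverse m w : (1 < m)%N -> packed n m w ->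
  orient m (map (reverse_letter m) w) = rev_sign n m * orient m w.
Proof.
move=> hm pw; have hw := packed_word pw; rewrite /orient; case: eqP => [em|_].
  subst m; have [uw pos] := packed_perm pw.
  have := inversions_reverse uw pos; have /andP[/eqP -> _] := hw => e.
  rewrite /perm_sign /rev_sign binS bin1 -e -exprD.
  set r := inversions _; set q := inversions w.
  have -> : (n + (r + q + n) + q = r + (n + q) * 2)%N by lia.
  by rewrite exprD exprM sqrr_sign mulr1.
rewrite !(index_reverse hw) //; last exact: ltnW.
rewrite /reverse_letter /= subSS subn0 (_ : (m == 0%N) = false); last by lia.
rewrite subSn // subnn; case: ltngtP => // [||e].
- by rewrite rev_sign2.
- by rewrite mulr1.
have /packedP[_ h] := pw.
have w1 : 1%N \in w by apply: h; lia.
have wm : m \in w by apply: h; lia.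
by have := nth_index 0%N w1; have := nth_index 0%N wm; rewrite e => -> ?; lia.
Qed.

Lemma names_reverseE m w (x : cellT) : word n m w ->
  names m (map (reverse_letter m) w) x = names m w x.
Proof.
by move=> hw; apply/idP/idP => /names_reverse; rewrite ?(reverseK hw).
Qed.

(** A proper face of a cell is obtained in one way from a given word, because a letter
    and its successor are identified by one face map only, also after a reversal. *)
Lemma names_merge_inj m i j w (x : cellT) : packed n m.+1 w ->
  (i <= m.+1)%N -> (j <= m.+1)%N ->
  names m (map (merge_letter m i) w) x -> names m (map (merge_letter m j) w) x -> i = j.
Proof.
move=> pw hi hj ni nj; have /andP[hm _] := names_le ni.
have [ti eti] : exists a : T, nth 0%N w a = i := letter_surj pw hi.
pose i' := (if i == m.+1 then 0 else i.+1)%N.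
have hi' : (i' <= m.+1)%N by rewrite /i'; split_ifs.
have [ti' eti'] : exists a : T, nth 0%N w a = i' := letter_surj pw hi'.
have e : nth 0%N (map (merge_letter m i) w) ti = nth 0%N (map (merge_letter m i) w) ti'.
  by rewrite !nth_map_merge eti eti' merge_succ.
have : nth 0%N (map (merge_letter m j) w) ti = nth 0%N (map (merge_letter m j) w) ti'.
  have [_ [->//|->]] := names_word ni nj.
  by rewrite !(nth_map0 (f := reverse_letter m)) // e.
rewrite !nth_map_merge eti eti'; apply: merge_consecutive => //; exact: ltnW.
Qed.

Lemma cell_word_exists (x : cellT) :
  exists mw : nat * seq nat, names mw.1 mw.2 x.
Proof. by have [m [w nx]] := cell_names x; exists (m, w). Qed.

Definition cell_word (x : cellT) : nat * seq nat := xchoose (cell_word_exists x).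

Lemma cell_wordP x : names (cell_word x).1 (cell_word x).2 x.
Proof. exact: (xchooseP (cell_word_exists x)). Qed.

(** At most one summand is nonzero, by [names_merge_inj]. *)
Definition incidence_at (m : nat) (w : seq nat) (x : cellT) : int :=
  \sum_(0 <= i < m.+1) (-1) ^+ i *
    (if names m.-1 (map (merge_letter m.-1 i) w) x
     then orient m w * orient m.-1 (map (merge_letter m.-1 i) w) else 0).

Definition incidence_number (x y : cellT) : int :=
  incidence_at (cell_word y).1 (cell_word y).2 x.

Lemma incidence_at_reverse m w x : (1 < m)%N -> packed n m w ->
  incidence_at m (map (reverse_letter m) w) x = incidence_at m w x.
Proof.
case: m => [//|m] hm pw; have hw := packed_word pw.
rewrite /incidence_at big_nat_rev; apply: eq_big_nat => i hi /=.
rewrite add0n subSS (merge_reverse (leq_subr i m.+1) hw) subKn //.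
have hwi : word n m (map (merge_letter m i) w) by apply: word_merge.
rewrite names_reverseE //; case: ifP => nx; last by rewrite !mulr0.
rewrite !orient_reverse ?packed_merge //; last by case/andP: (names_le nx).
rewrite signr_sub; last by lia.
rewrite rev_signS.
have sm : (-1) ^+ m.+1 * (-1) ^+ m.+1 = 1 :> int by rewrite -expr2 sqrr_sign.
transitivity (((-1) ^+ m.+1 * (-1) ^+ m.+1) * (rev_sign n m * rev_sign n m) * ((-1) ^+ i
  * (orient m.+1 w * orient m [seq merge_letter m i i0 | i0 <- w]))); first by ring.
by rewrite sm rev_sign2 !mul1r.
Qed.

Lemma incidence_numberE m w x y : names m w y ->
  incidence_number x y = incidence_at m w x.
Proof.
move=> ny; have ny' := cell_wordP y; rewrite /incidence_number.
have /andP[hm _] := names_le ny.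
have [-> [->//|->]] := names_word ny ny'.
by rewrite incidence_at_reverse ?(names_packed ny).
Qed.

(** The cochain whose value on a word is the coefficient of the cell that it names,
    with the sign of the word. *)
Definition lift_chain (m : nat) (c : cellT -> int) : cochain :=
  fun w => orient m w * \sum_(x | names m w x) c x.

Lemma lift_chainE m w x c : names m w x -> lift_chain m c w = orient m w * c x.
Proof.
move=> nx; rewrite /lift_chain (big_pred1 x) // => y.
by apply/idP/eqP => [/names_eq|->//]; apply.
Qed.

Lemma boundary_lift m w y (c : cellT -> int) : names m.+1 w y ->
  \sum_x c x * incidence_number x y = orient m.+1 w * delta m (lift_chain m c) w.
Proof.
move=> ny; under eq_bigr => x _ do rewrite (incidence_numberE x ny) mulr_sumr.
rewrite exchange_big /= /delta mulr_sumr; apply: eq_bigr => i _.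
rewrite /lift_chain !mulr_sumr [RHS]big_mkcond /=; apply: eq_bigr => x _.
by case: ifP => _; [ring | rewrite !mulr0].
Qed.

Lemma incidence_merge m i w x y : names m.+1 w y -> (i <= m.+1)%N ->
  names m (map (merge_letter m i) w) x ->
  incidence_number x y = (-1) ^+ i * (orient m.+1 w * orient m (map (merge_letter m i) w)).
Proof.
move=> ny hi nx; rewrite (incidence_numberE x ny) /incidence_at big_mkord.
rewrite (bigD1 (inord i)) //= inordK // nx big1 ?addr0 // => j nej.
case: ifP => nj; last by rewrite mulr0.
have e := names_merge_inj (names_packed ny) hi (ltn_ord j) nx nj.
by case/eqP: nej; apply: val_inj; rewrite /= inordK -?e.
Qed.

Lemma incidence_facet (x y : cell (QP n)) : facet y x ->
  incidence_number x y = 1 \/ incidence_number x y = -1.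
Proof.
have ny := cell_wordP y; move=> /(facetP x ny)[m [i [em hi nx]]].
move: (cell_word y).1 (cell_word y).2 em hi nx ny => m' w -> hi nx ny.
rewrite (incidence_merge ny hi nx).
have sgn (a : int) : a * a = 1 -> a = 1 \/ a = -1.
  by move=> h; have := sqrf_eq1 a; rewrite expr2 h eqxx => /esym/orP[]/eqP; auto.
apply: sgn; rewrite mulrACA -expr2 sqrr_sign mul1r mulrACA !orient2 mul1r //.
Qed.

Lemma incidence_nfacet (x y : cell (QP n)) : ~ facet y x -> incidence_number x y = 0.
Proof.
have ny := cell_wordP y; move=> nf.
rewrite (incidence_numberE x ny) /incidence_at big1_seq // => i /andP[_].
rewrite mem_index_iota => hi; case: ifP => nx; last by rewrite mulr0.
case: nf; apply/(facetP x ny); exists (cell_word y).1.-1, i; split=> //.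
by have /andP[] := names_le ny; lia.
Qed.

(** By [boundary_lift] the boundary is [delta] on lifted chains, so this is [deltaK]. *)
Lemma incidence_square (x z : cellT) :
  \sum_y incidence_number x y * incidence_number y z = 0.
Proof.
have [m [w nz]] := cell_names z; have /andP[hm _] := names_le nz.
case: m hm nz => [//|m] hm nz.
rewrite (boundary_lift (fun y => incidence_number x y) nz).
have hw := packed_word (names_packed nz).
case: m hm nz hw => [|m] // hm nz hw.
rewrite (_ : delta _ _ _ = delta m.+1 (delta m (lift_chain m (fun x' => (x' == x)%:R))) w).
  by rewrite (deltaK _ hw) mulr0.
rewrite /delta big_mkord [RHS]big_mkord; apply: eq_bigr => i _; congr (_ * _).
case: m hm nz hw i => [|m] hm nz hw i.
  have low l c u : (l <= 1)%N -> lift_chain l c u = 0.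
    move=> hl; rewrite /lift_chain big_pred0 ?mulr0 // => y.
    by rewrite /names ltnNge hl.
  by rewrite low // /delta big1 // => j _; rewrite low ?mulr0.
have pi_ : packed n m.+2 (map (merge_letter m.+2 i) w).
  by apply: packed_merge (names_packed nz); rewrite -ltnS.
have [y ny] := names_cell (isT : 1 < m.+2)%N pi_.
rewrite (lift_chainE _ ny).
have := boundary_lift (fun x' => (x' == x)%:R) ny.
rewrite (bigD1 x) //= eqxx mul1r big1 => [|x' /negbTE ->]; last by rewrite mul0r.
by rewrite addr0 => ->; rewrite mulrA orient2 mul1r.
Qed.

End Incidence.

(** * The two end points of an edge *)

Section Edges.
Variable m : nat.
Local Notation n := m.+1.
Hypothesis m_gt0 : (0 < m)%N.

Lemma packed_perm_size w : packed n n w -> size w = n.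
Proof. by case/andP=> /andP[/eqP]. Qed.

Lemma packed_perm_nth w a : packed n n w -> (a < n)%N -> (0 < nth 0%N w a <= n)%N.
Proof.
move=> pw ha; have [_ /all_nthP pos] := packed_perm pw.
by apply: pos; rewrite packed_perm_size.
Qed.

Lemma lt_of_nth w a : packed n n w -> (0 < nth 0%N w a)%N -> (a < n)%N.
Proof.
move=> /packed_perm_size sz; apply: contraLR; rewrite -!leqNgt -sz => h.
by rewrite nth_default.
Qed.

Lemma packed_perm_eq w u : packed n n w -> packed n n u ->
  (forall a, (a < n)%N -> nth 0%N u a = nth 0%N w a) -> u = w.
Proof.
move=> pw pu e; apply: (@eq_from_nth _ 0%N); rewrite ?packed_perm_size //.
Qed.

Lemma merge_nth_eq i j w u a : map (merge_letter m j) u = map (merge_letter m i) w ->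
  merge_letter m j (nth 0%N u a) = merge_letter m i (nth 0%N w a).
Proof. by move=> e; rewrite -!nth_map_merge e. Qed.

Lemma packed_map f g w : packed n n w ->
  (forall j, (0 < j <= n)%N -> (0 < f j <= n)%N) ->
  (forall j, (0 < j <= n)%N -> (0 < g j <= n)%N /\ f (g j) = j) ->
  packed n n (map f w).
Proof.
move=> pw hf hg; have [_ /allP pos] := packed_perm pw; have /packedP[_ h] := pw.
apply/packedP; split.
  rewrite /word size_map packed_perm_size // eqxx; apply/allP => _ /mapP[j jw ->].
  by have := hf j (pos j jw); case/andP.
move=> j hj; have [hgj e] := hg j hj.
by apply/mapP; exists (g j); rewrite ?e // h.
Qed.

(** For 0 < i < n, the edge joins two permutations that differ by the transposition of the
    letters i and i+1. *)
Lemma swap_partner w i : packed n n w -> (0 < i <= m)%N ->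
  [/\ packed n n (map (swap_letter i) w),
      map (merge_letter m i) (map (swap_letter i) w) = map (merge_letter m i) w,
      perm_sign (map (swap_letter i) w) = - perm_sign w
    & forall u j, packed n n u -> (j <= n)%N ->
      map (merge_letter m j) u = map (merge_letter m i) w ->
      j = i /\ (u = w \/ u = map (swap_letter i) w)].
Proof.
move=> pw hi; have hw := packed_word pw.
have psw : packed n n (map (swap_letter i) w).
  apply: (packed_map (g := swap_letter i)) => // j hj; rewrite /swap_letter.
    by split_ifs.
  by split; split_ifs.
split => //.
- rewrite -map_comp; apply: (eq_map_word hw) => j hj /=.
  by rewrite /merge_letter /swap_letter; split_ifs.
- have [uw _] := packed_perm pw; have /packedP[_ h] := pw.
  rewrite /perm_sign -signr_odd inversions_swap ?h //; try lia.
  by rewrite -[in RHS]signr_odd; case: odd.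
move=> u j pu hj e.
have [a ha] : exists a : 'I_n.+1, nth 0%N w a = i by apply: (letter_surj pw); lia.
have [b hb] : exists b : 'I_n.+1, nth 0%N w b = i.+1 by apply: (letter_surj pw); lia.
have posa : (a < n)%N by apply: (lt_of_nth pw); lia.
have posb : (b < n)%N by apply: (lt_of_nth pw); lia.
have neab : nth 0%N u a != nth 0%N u b.
  have [uu _] := packed_perm pu.
  rewrite nth_uniq ?packed_perm_size //; apply/eqP => eab.
  by move: ha hb; rewrite eab => ->; lia.
have ea := merge_nth_eq a e; have eb := merge_nth_eq b e; rewrite ha in ea; rewrite hb in eb.
have ua := packed_perm_nth pu posa; have ub := packed_perm_nth pu posb.
have [ej cases] : j = i /\ (nth 0%N u a = i /\ nth 0%N u b = i.+1 \/
    nth 0%N u a = i.+1 /\ nth 0%N u b = i).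
  move: neab ea eb ua ub hi hj; move: (nth _ u a) (nth _ u b); clear => A B.
  move=> ne e1 e2 hA hB hi hj; move: e1 e2; rewrite /merge_letter.
  by split_ifs.
subst j; split=> //.
have other c : (c < n)%N -> nth 0%N w c != i -> nth 0%N w c != i.+1 ->
    nth 0%N u c = nth 0%N w c.
  move=> hc; have := merge_nth_eq c e.
  have := packed_perm_nth pu hc; have := packed_perm_nth pw hc.
  move: (nth _ u c) (nth _ w c) hi; clear => A B hi.
  by rewrite /merge_letter; split_ifs.
have [uw _] := packed_perm pw.
have atw c t (d : 'I_n.+1) : (c < n)%N -> (d < n)%N -> nth 0%N w c = t -> nth 0%N w d = t -> c = d.
  move=> hc hd <- /eqP; rewrite nth_uniq ?packed_perm_size // => /eqP //.
case: cases => -[ca cb]; [left|right]; apply: packed_perm_eq => // c hc.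
  have [eci|nei] := eqVneq (nth 0%N w c) i.
    by rewrite (atw c i a hc posa eci ha) ca ha.
  have [eci|nei1] := eqVneq (nth 0%N w c) i.+1.
    by rewrite (atw c _ b hc posb eci hb) cb hb.
  exact: other.
rewrite (nth_map 0%N) ?packed_perm_size //.
have [eci|nei] := eqVneq (nth 0%N w c) i.
  by rewrite (atw c i a hc posa eci ha) ca ha /swap_letter eqxx.
have [eci|nei1] := eqVneq (nth 0%N w c) i.+1.
  by rewrite (atw c _ b hc posb eci hb) cb hb /swap_letter; split_ifs.
by rewrite other // /swap_letter (negbTE nei) (negbTE nei1).
Qed.

(** The blocks 0 and 1 are joined in an edge; on its other end point the element with the
    letter 1 comes on the other side of n+1, hence has the letter n. *)
Lemma rotate_partner w : packed n n w ->
  [/\ packed n n (map (rotate_letter n) w),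
      map (merge_letter m n) (map (rotate_letter n) w) = map (merge_letter m 0) w,
      (-1) ^+ n * perm_sign (map (rotate_letter n) w) = - perm_sign w
    & forall u j, packed n n u -> (j <= n)%N ->
      map (merge_letter m j) u = map (merge_letter m 0) w ->
      j = 0%N /\ u = w \/ j = n /\ u = map (rotate_letter n) w].
Proof.
move=> pw; have hw := packed_word pw; have [uw pos] := packed_perm pw.
have prw : packed n n (map (rotate_letter n) w).
  apply: (packed_map (g := fun j => if j == n then 1%N else j.+1)) => // j hj.
    by rewrite /rotate_letter; split_ifs.
  by rewrite /rotate_letter; split; split_ifs.
split=> //.
- rewrite -map_comp; apply/eq_in_map => j jw; have := allP pos j jw => /= hj.
  by rewrite /merge_letter /rotate_letter; split_ifs.
- have /packedP[_ h] := pw; have w1 : 1%N \in w by apply: h; lia.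
  have := inversions_rotate uw pos w1; rewrite packed_perm_size // /perm_sign.
  move: (inversions _) (inversions w) => r q /= e.
  rewrite -exprD -[RHS]mulN1r -exprS -signr_odd -[RHS]signr_odd; congr (_ ^+ nat_of_bool _).
  by move: e; rewrite /= !oddD => <-; case: (odd r); case: (odd q).
move=> u j pu hj e.
have [b hb] : exists b : 'I_n.+1, nth 0%N w b = 1%N by apply: (letter_surj pw); lia.
have posb : (b < n)%N by apply: (lt_of_nth pw); lia.
have eb := merge_nth_eq b e; rewrite hb in eb; have ub := packed_perm_nth pu posb.
have [ej|ej] : j = 0%N \/ j = n.
  by move: eb ub hj; move: (nth _ u b); clear => B; rewrite /merge_letter; split_ifs.
  left; split=> //; apply: packed_perm_eq => // c hc; have := merge_nth_eq c e.
  have := packed_perm_nth pu hc; have := packed_perm_nth pw hc.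
  by move: (nth _ u c) (nth _ w c); clear -ej => A B; rewrite ej /merge_letter; split_ifs.
right; split=> //; apply: packed_perm_eq => // c hc; have := merge_nth_eq c e.
have := packed_perm_nth pu hc; have := packed_perm_nth pw hc.
rewrite (nth_map 0%N) ?packed_perm_size //.
by move: (nth _ u c) (nth _ w c); clear -ej => A B; rewrite ej /merge_letter /rotate_letter; split_ifs.
Qed.

Lemma edge_partner w i : packed n n w -> (i <= n)%N -> exists w' i',
  [/\ packed n n w', (i' <= n)%N,
      map (merge_letter m i') w' = map (merge_letter m i) w,
      (-1) ^+ i' * perm_sign w' = - ((-1) ^+ i * perm_sign w)
    & forall u j, packed n n u -> (j <= n)%N ->
      map (merge_letter m j) u = map (merge_letter m i) w ->
      u = w /\ j = i \/ u = w' /\ j = i'].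
Proof.
move=> pw hi; have [-> {i hi}|i0] := posnP i.
  have [pr er sr cr] := rotate_partner pw.
  exists (map (rotate_letter n) w), n; split=> //; first by rewrite sr mul1r.
  by move=> u j pu hj /(cr u j pu hj)[[-> ->]|[-> ->]]; auto.
have [him|him] := leqP i m.
  have [|pr er sr cr] := swap_partner (i := i) pw; first by rewrite i0.
  exists (map (swap_letter i) w), i; split=> //; first by rewrite sr mulrN.
  by move=> u j pu hj /(cr u j pu hj)[-> [->|->]]; auto.
have ei : i = n by lia.
subst i; pose g j := if j == n then 1%N else j.+1.
have pg : packed n n (map g w).
  apply: (packed_map (g := rotate_letter n)) => // j hj; rewrite /g /rotate_letter.
    by split_ifs.
  by split; split_ifs.
have eg : map (rotate_letter n) (map g w) = w.
  rewrite -[RHS]map_id -map_comp; apply/eq_in_map => j jw /=.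
  have [_ pos] := packed_perm pw; have := allP pos j jw => /=.
  by rewrite /rotate_letter /g; split_ifs.
have [pr er sr cr] := rotate_partner pg; rewrite eg in er sr cr.
exists (map g w), 0%N; split=> //; first by rewrite sr opprK mul1r.
by move=> u j pu hj; rewrite er => /(cr u j pu hj)[[-> ->]|[-> ->]]; auto.
Qed.

End Edges.

(** * Diamonds *)

Section ExplicitIncidence.
Variable n : nat.
Local Notation cellT := (cell (QP n)).

Lemma names_merge_choice m w v (x y : cellT) : names m.+1 w y -> names m v x ->
  facet y x -> exists w' i, [/\ names m.+1 w' y, (i <= m.+1)%N & map (merge_letter m i) w' = v].
Proof.
move=> ny nx /(facetP x ny)[m' [i [[em] hi nx']]]; subst m'.
have [_ [e|e]] := names_word nx nx'; first by exists w, i.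
have hw := packed_word (names_packed ny).
exists (map (reverse_letter m.+1) w), (m.+1 - i)%N; split; first exact: names_reverse.
  exact: leq_subr.
rewrite (merge_reverse (leq_subr i m.+1) hw) subKn // e.
exact: reverseK (packed_word (names_packed nx)).
Qed.

(** The reversal carries a word of y to the other one, so any word of x is reached. *)
Lemma facet_word m v (x y : cellT) : names m v x -> facet y x ->
  exists w i, [/\ names m.+1 w y, (i <= m.+1)%N & map (merge_letter m i) w = v].
Proof.
move=> nx f; have [m' [w ny]] := cell_names y.
have [m1 [i [em hi nx']]] := (facetP x ny).1 f; subst m'.
have [em _] := names_word nx nx'; subst m1.
exact: names_merge_choice ny nx f.
Qed.

End ExplicitIncidence.

Lemma edge_facets n (x : cell (QP n)) : dim x = 1%N -> (exists y, facet y x) ->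
  exists y1 y2, [/\ y1 != y2, facet y1 x /\ facet y2 x,
    incidence_number x y1 + incidence_number x y2 = 0
    & forall y, facet y x -> y = y1 \/ y = y2].
Proof.
have [m [v nx]] := cell_names x; rewrite /= (names_dim nx) => hd [y1 f1].
have /andP[hm hmn] := names_le nx.
have en : n = m.+1 by lia.
subst n; have [w [i [n1 hi ew]]] := facet_word nx f1.
have [w' [i' [pw' hi' ew' sw all_]]] := edge_partner (ltnW hm) (names_packed n1) hi.
have [y2 n2] := names_cell (ltnW hm : 1 < m.+1)%N pw'.
have nx1 : names m (map (merge_letter m i) w) x by rewrite ew.
have nx2 : names m (map (merge_letter m i') w') x by rewrite ew' ew.
have e1 := incidence_merge n1 hi nx1; have e2 := incidence_merge n2 hi' nx2.
rewrite /(orient _ m.+1) eqxx in e1 e2.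
have sum0 : incidence_number x y1 + incidence_number x y2 = 0.
  by rewrite e1 e2 ew' !mulrA sw mulNr addrN.
exists y1, y2; split=> //.
- apply/eqP => e; move: sum0; rewrite -e -mulr2n => /eqP; rewrite mulrn_eq0 /=.
  by case: (incidence_facet f1) => ->.
- by split=> //; apply/(facetP x n2); exists m, i'.
move=> y f; have [u [j [ny hj eu]]] := facet_word nx f.
have [[eu' _]|[eu' _]] := all_ u j (names_packed ny) hj (etrans eu (esym ew)).
  by left; apply: names_eq ny _; rewrite eu'.
by right; apply: names_eq ny _; rewrite eu'.
Qed.

Section Edge.
Variable n : nat.
Local Notation cellT := (cell (QP n)).

Lemma sum_edge (f : cellT -> int) x y1 y2 : y1 != y2 ->
  (forall y, facet y x -> y = y1 \/ y = y2) ->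
  (forall y, ~ facet y x -> f y = 0) -> \sum_y f y = f y1 + f y2.
Proof.
move=> ne only f0; rewrite (bigD1 y1) //= (bigD1 y2) /=; last by rewrite eq_sym.
rewrite big1 ?addr0 // => y /andP[n1 n2]; apply: f0 => /only[] e.
  by rewrite e eqxx in n1.
by rewrite e eqxx in n2.
Qed.

Lemma incidence_edge (x : cellT) : dim x = 1%N -> \sum_y incidence_number x y = 0.
Proof.
move=> hd; have [ex|nex] := boolp.pselect (exists y, facet y x).
  have [y1 [y2 [ne _ e0 only]]] := edge_facets hd ex.
  rewrite (sum_edge ne only) // => y; exact: incidence_nfacet.
rewrite big1 // => y _; apply: incidence_nfacet => f.
by apply: nex; exists y.
Qed.

Definition explicit_incidence : incidence (QP n) :=
  @Incidence (QP n) (@incidence_number n) (@incidence_facet n)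
    (@incidence_nfacet n) incidence_edge (@incidence_square n).

End Edge.

Definition next_letter (M i : nat) : nat := if i == M then 0%N else i.+1.

Lemma merge_next m i c : (i <= m.+2)%N -> (c <= m.+2)%N -> c != i ->
  merge_letter m.+1 i (next_letter m.+2 c) = next_letter m.+1 (merge_letter m.+1 i c).
Proof. by move=> hi hc ne; rewrite /merge_letter /next_letter; split_ifs. Qed.

Lemma merge_inj m i c c' : (i <= m.+1)%N -> (c <= m.+1)%N -> (c' <= m.+1)%N ->
  c != i -> c' != i -> merge_letter m i c = merge_letter m i c' -> c = c'.
Proof. by move=> hi hc hc' ne ne'; rewrite /merge_letter; split_ifs. Qed.

(** If c and its successor are identified after two face maps, but not by the first
    one, then the second face map is determined by c. *)
Lemma double_merge m a i c : (0 < m)%N -> (a <= m.+1)%N -> (i <= m.+2)%N ->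
  (c <= m.+2)%N -> c != i ->
  merge_letter m a (merge_letter m.+1 i c)
    = merge_letter m a (merge_letter m.+1 i (next_letter m.+2 c)) ->
  merge_letter m.+1 i c = a.
Proof.
move=> hm ha hi hc ne; rewrite merge_next //; apply: merge_consecutive => //.
by rewrite /merge_letter; split_ifs.
Qed.

(** Going from z to x joins two pairs of cyclically consecutive blocks, and a cell strictly
    in between joins one of them. *)
Lemma diamond n (x y y' y'' z : cell (QP n)) : facet y x -> facet y' x -> facet y'' x ->
  facet z y -> facet z y' -> facet z y'' -> y != y' -> y'' = y \/ y'' = y'.
Proof.
move=> yx y'x y''x zy zy' zy'' ne.
have [m [v nx]] := cell_names x; have /andP[hm _] := names_le nx.
have [w [a [ny ha ev]]] := facet_word nx yx.
have [u [i [nz hi ew]]] := facet_word ny zy.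
have pu := names_packed nz.
(* the cells between z and x join letters that are joined in x *)
have merged t : facet t x -> facet z t -> exists c, [/\ (c <= m.+2)%N,
    names m.+1 (map (merge_letter m.+1 c) u) t
    & c != i -> merge_letter m.+1 i c = a].
  move=> tx /(facetP t nz)[m' [c [[em] hc nt]]]; subst m'; exists c; split=> // nc.
  apply: (double_merge (ltnW hm) ha hi hc nc).
  have hc' : (next_letter m.+2 c <= m.+2)%N by rewrite /next_letter; split_ifs.
  have [p ep] := letter_surj pu hc; have [p' ep'] := letter_surj pu hc'.
  rewrite -ep' -{1}ep -!nth_map_merge ew ev.
  move/(facetP x nt): tx => [m' [b [[em] hb nx']]]; subst m'.
  have [_ ee] := names_word nx' nx.
  have e0 : nth 0%N (map (merge_letter m b) (map (merge_letter m.+1 c) u)) p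
      = nth 0%N (map (merge_letter m b) (map (merge_letter m.+1 c) u)) p'.
    by rewrite !nth_map_merge ep ep' /next_letter merge_succ.
  case: ee => -> //.
  by rewrite !(nth_map0 (f := reverse_letter m)) // e0.
have [c [hc nc Hc]] := merged _ y'x zy'.
have [d [hd nd Hd]] := merged _ y''x zy''.
have ny' : names m.+1 (map (merge_letter m.+1 i) u) y by rewrite ew.
have [ei|nci] := eqVneq c i.
  by case/eqP: ne; apply: (names_eq ny' (_ : names _ _ _)); rewrite -ei.
have [ei|ndi] := eqVneq d i.
  by left; apply: (names_eq (_ : names _ _ _) ny'); rewrite -ei; exact: nd.
right; apply: (names_eq nd (_ : names _ _ _)).
by rewrite (merge_inj hi hd hc ndi nci) // Hc // Hd.
Qed.

(** * Connectedness of the facets of a cell *)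

Lemma size_sum_count m v : all (fun j => j <= m)%N v ->
  size v = (\sum_(l < m.+1) count_mem (l : nat) v)%N.
Proof.
elim: v => [_|x v IH /= /andP[hx /IH ->]]; first by rewrite big1.
rewrite big_split /= -[LHS]add1n; congr addn.
rewrite (bigD1 (inord x)) //= inordK // eqxx big1 // => l ne.
by apply/eqP; rewrite eqb0 eq_sym; apply: contraNneq ne => <-; rewrite inord_val.
Qed.

Lemma fresh_position n v l (ps : seq nat) : size v = n -> (size ps < count_mem l v)%N ->
  exists a, [/\ (a < n)%N, nth 0%N v a = l & a \notin ps].
Proof.
move=> sz; pose P := [seq a <- iota 0 n | nth 0%N v a == l].
have <- : size P = count_mem l v.
  rewrite size_filter -[v in RHS](mkseq_nth 0%N) sz /mkseq count_map.
  by apply: eq_count => a.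
move=> lt; have [/allP sub|/allPn[a]] := boolP (all (mem ps) P).
  have uP : uniq P by rewrite filter_uniq // iota_uniq.
  by have := uniq_leq_size uP sub; rewrite leqNgt lt.
by rewrite mem_filter mem_iota => /andP[/eqP ea ha] nps; exists a; split=> //; lia.
Qed.

Lemma packed_mkseq n M f : (forall a, (a < n)%N -> (f a <= M)%N) ->
  (forall j, (0 < j <= M)%N -> exists2 a, (a < n)%N & f a = j) ->
  packed n M (mkseq f n).
Proof.
move=> hf sf; apply/packedP; split.
  rewrite /word size_mkseq eqxx; apply/allP => j /mapP[a].
  by rewrite mem_iota => ha ->; apply: hf.
move=> j /sf[a ha <-]; apply/mapP; exists a => //.
by rewrite mem_iota.
Qed.

Lemma packed_surj n M w j : packed n M w -> (0 < j <= M)%N ->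
  exists2 a, (a < n)%N & nth 0%N w a = j.
Proof.
move=> /packedP[/andP[/eqP sz _] h] hj; have jw := h j hj.
by exists (index j w); rewrite ?nth_index // -sz index_mem.
Qed.

Section Connectivity.
Variables (n m : nat) (v : seq nat) (x : cell (QP n)).
Hypotheses (nx : names m v x) (hmn : (m.+2 <= n)%N).
Variable val : cell (QP n) -> int.
Hypothesis val_adjacent : forall y y' z, facet y x -> facet y' x ->
  facet z y -> facet z y' -> val y = val y'.

Let m_gt1 : (1 < m)%N. Proof. by case/andP: (names_le nx). Qed.
Let pv : packed n m v := names_packed nx.

(** The words of cells that have x as a facet: w splits the block i of v, where both
    i = 0 and i = m+1 split the block of n+1, at its two ends. *)
Definition splits (w : seq nat) (i : nat) : Prop :=
  [/\ packed n m.+1 w, (i <= m.+1)%N & map (merge_letter m i) w = v].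

(** Adjacency and connectedness are expressed by means of an arbitrary function val
    that takes equal values on facets with a common facet. *)
Definition same (w w' : seq nat) : Prop :=
  forall y y' : cell (QP n),
    names m.+1 w y -> names m.+1 w' y' -> val y = val y'.

Lemma splits_facet w i (y : cell (QP n)) : splits w i -> names m.+1 w y -> facet y x.
Proof. by move=> [_ hi ew] ny; apply/(facetP x ny); exists m, i; rewrite ew. Qed.

Lemma splits_cell w i : splits w i -> exists y : cell (QP n), names m.+1 w y.
Proof. by move=> [pw _ _]; apply: names_cell pw; apply: ltnW. Qed.

Lemma same_refl w : same w w.
Proof. by move=> y y' ny /(names_eq ny) ->. Qed.

Lemma same_sym w w' : same w w' -> same w' w.
Proof. by move=> h y y' ny ny'; rewrite (h y' y). Qed.

Lemma same_trans w i w' w'' : splits w i -> same w' w -> same w w'' -> same w' w''.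
Proof.
move=> /splits_cell[y ny] h h' y' y'' ny' ny''.
by rewrite (h y' y) // (h' y y'').
Qed.

Lemma splits_nth w i a : splits w i -> (a < n)%N ->
  [/\ merge_letter m i (nth 0%N w a) = nth 0%N v a, (nth 0%N w a <= m.+1)%N
    & (nth 0%N v a <= m)%N].
Proof.
move=> [pw hi <-] ha; rewrite nth_map_merge; split=> //.
  by have /packed_word/andP[/eqP sz /all_nthP] := pw; apply; rewrite sz.
rewrite -nth_map_merge.
by have /packed_word/andP[/eqP sz /all_nthP] := packed_merge hi pw; apply; rewrite sz.
Qed.

Lemma splits_surj w i j : splits w i -> (0 < j <= m.+1)%N ->
  exists2 a, (a < n)%N & nth 0%N w a = j.
Proof. by case=> pw _ _; apply: packed_surj. Qed.

(** Two splittings of v with a common refinement, given letterwise by f, share a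
    facet. *)
Lemma common_refinement w i w' i' f p q : splits w i -> splits w' i' ->
  (p <= m.+2)%N -> (q <= m.+2)%N ->
  (forall a, (a < n)%N -> (f a <= m.+2)%N) ->
  (forall j, (0 < j <= m.+2)%N -> exists2 a, (a < n)%N & f a = j) ->
  (forall a, (a < n)%N -> merge_letter m.+1 p (f a) = nth 0%N w a) ->
  (forall a, (a < n)%N -> merge_letter m.+1 q (f a) = nth 0%N w' a) ->
  same w w'.
Proof.
move=> sw sw' hp hq hf sf ep eq y y' ny ny'.
have pu := packed_mkseq hf sf.
have [z nz] := names_cell (isT : 1 < m.+2)%N pu.
have word_of r s : packed n m.+1 s ->
    (forall a, (a < n)%N -> merge_letter m.+1 r (f a) = nth 0%N s a) ->
    map (merge_letter m.+1 r) (mkseq f n) = s.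
  move=> /packed_word/andP[/eqP sz _] e.
  rewrite /mkseq -map_comp -[RHS](mkseq_nth 0%N) sz; apply/eq_in_map => a.
  by rewrite mem_iota => ha; apply: e.
apply: (val_adjacent (splits_facet sw ny) (splits_facet sw' ny') (z := z)).
  by apply/(facetP y nz); exists m.+1, p; rewrite (word_of p w) //; case: sw.
by apply/(facetP y' nz); exists m.+1, q; rewrite (word_of q w') //; case: sw'.
Qed.

(** Splitting two blocks at once: a splitting shifts the letters after the cut by one,
    so w + w' - v has both shifts. *)
Lemma same_lt w i w' i' : splits w i -> splits w' i' -> (i < i' <= m)%N -> same w w'.
Proof.
move=> sw sw' hi.
pose f a := (nth 0%N w a + nth 0%N w' a - nth 0%N v a)%N.
apply: (@common_refinement w i w' i' f i'.+1 i) => //; try lia.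
- move=> a ha; have [e1 b1 b] := splits_nth sw ha; have [e2 b2 _] := splits_nth sw' ha.
  by move: e1 e2; rewrite /f /merge_letter; split_ifs.
- move=> j hj; case: (leqP j i.+1) => hji.
    have [|a ha ea] := splits_surj sw (j := j); first by lia.
    exists a => //; have [e1 b1 b] := splits_nth sw ha; have [e2 b2 _] := splits_nth sw' ha.
    by move: e1 e2 b1 b2 b; rewrite /f ea; clear -hi hji hj; rewrite /merge_letter; split_ifs.
  have [|a ha ea] := splits_surj sw' (j := j.-1); first by lia.
  exists a => //; have [e1 b1 b] := splits_nth sw ha; have [e2 b2 _] := splits_nth sw' ha.
  by move: e1 e2 b1 b2 b; rewrite /f ea; clear -hi hji hj; rewrite /merge_letter; split_ifs.
- move=> a ha; have [e1 b1 b] := splits_nth sw ha; have [e2 b2 _] := splits_nth sw' ha.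
  by move: e1 e2 b1 b2 b; rewrite /f; clear -hi; rewrite /merge_letter; split_ifs.
- move=> a ha; have [e1 b1 b] := splits_nth sw ha; have [e2 b2 _] := splits_nth sw' ha.
  by move: e1 e2 b1 b2 b; rewrite /f; clear -hi; rewrite /merge_letter; split_ifs.
Qed.

(** As before, with the block of n+1 split at its end; the new block must come
    after all others, so it gets the letter m+2. *)
Lemma same_last w i w' : splits w i -> splits w' m.+1 -> (i <= m)%N ->
  (forall a, (a < n)%N -> nth 0%N w' a = m.+1 -> nth 0%N w a = 0%N) -> same w w'.
Proof.
move=> sw sw' hi H.
pose f a := if nth 0%N w' a == m.+1 then m.+2 else nth 0%N w a.
apply: (@common_refinement w i w' m.+1 f m.+2 i) => //; try lia.
- move=> a ha; have [e1 b1 b] := splits_nth sw ha.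
  by rewrite /f; split_ifs.
- move=> j hj; case: (leqP j m.+1) => hji.
    have [|a ha ea] := splits_surj sw (j := j); first by lia.
    by exists a => //; have := H a ha; rewrite /f ea; split_ifs.
  have [|a ha ea] := splits_surj sw' (j := m.+1); first by lia.
  by exists a => //; rewrite /f ea eqxx; lia.
- move=> a ha; have := H a ha; have [e1 b1 b] := splits_nth sw ha.
  by rewrite /f /merge_letter; clear -b1; split_ifs.
- move=> a ha; have := H a ha; have [e1 b1 b] := splits_nth sw ha.
  have [e2 b2 _] := splits_nth sw' ha.
  move: e1 e2 b1 b2 b; rewrite /f; move: (nth _ w a) (nth _ w' a) (nth _ v a) => A B C.
  by clear -hi m_gt1; rewrite /merge_letter; split_ifs.
Qed.

Lemma words_differ w w' i i' : splits w i -> splits w' i' ->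
  w = w' \/ exists2 a, (a < n)%N & nth 0%N w a <> nth 0%N w' a.
Proof.
move=> [/packed_word/andP[/eqP sz _] _ _] [/packed_word/andP[/eqP sz' _] _ _].
have [/allP e|/allPn[a]] := boolP (all (fun a => nth 0%N w a == nth 0%N w' a) (iota 0 n)).
  left; apply: (@eq_from_nth _ 0%N); rewrite ?sz // => a ha; apply/eqP/e.
  by rewrite mem_iota.
by rewrite mem_iota => ha /eqP ne; right; exists a.
Qed.

(** Two cuts of the same block that are nested give a splitting into three parts. *)
Lemma same_nested w w' i : splits w i -> splits w' i -> (i <= m)%N ->
  (forall a, (a < n)%N -> (nth 0%N w' a <= nth 0%N w a)%N) -> same w w'.
Proof.
move=> sw sw' hi H.
have [->|[a0 ha0 ne0]] := words_differ sw sw'; first exact: same_refl.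
pose f a := (nth 0%N w a + nth 0%N w' a - nth 0%N v a)%N.
have strict : [/\ nth 0%N w a0 = i.+1, nth 0%N w' a0 = i & nth 0%N v a0 = i].
  have := H a0 ha0; have [e1 b1 b] := splits_nth sw ha0; have [e2 b2 _] := splits_nth sw' ha0.
  move: e1 e2 b1 b2 b ne0; move: (nth _ w a0) (nth _ w' a0) (nth _ v a0) => A B C.
  clear -hi; rewrite /merge_letter => e1 e2 b1 b2 b ne0 le.
  by split; move: e1 e2; split_ifs.
apply: (@common_refinement w i w' i f i.+1 i) => //; try lia.
- move=> a ha; have [e1 b1 b] := splits_nth sw ha; have [e2 b2 _] := splits_nth sw' ha.
  move: e1 e2 b1 b2 b; rewrite /f; move: (nth _ w a) (nth _ w' a) (nth _ v a) => A B C.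
  by clear -hi; rewrite /merge_letter; split_ifs.
- move=> j hj; case: (ltngtP j i.+1) => hji.
  + have [|a ha ea] := splits_surj sw (j := j); first by lia.
    exists a => //; have [e1 b1 b] := splits_nth sw ha; have [e2 b2 _] := splits_nth sw' ha.
    move: e1 e2 b1 b2 b (H a ha); rewrite /f ea; move: (nth _ w' a) (nth _ v a) => B C.
    by clear -hi hji hj; rewrite /merge_letter; split_ifs.
  + have [|a ha ea] := splits_surj sw' (j := j.-1); first by lia.
    exists a => //; have [e1 b1 b] := splits_nth sw ha; have [e2 b2 _] := splits_nth sw' ha.
    move: e1 e2 b1 b2 b (H a ha); rewrite /f ea; move: (nth _ w a) (nth _ v a) => B C.
    by clear -hi hji hj; rewrite /merge_letter; split_ifs.
  + by exists a0 => //; case: strict; rewrite /f => -> -> ->; lia.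
- move=> a ha; have [e1 b1 b] := splits_nth sw ha; have [e2 b2 _] := splits_nth sw' ha.
  move: e1 e2 b1 b2 b (H a ha); rewrite /f; move: (nth _ w a) (nth _ w' a) (nth _ v a) => A B C.
  by clear -hi; rewrite /merge_letter; split_ifs.
- move=> a ha; have [e1 b1 b] := splits_nth sw ha; have [e2 b2 _] := splits_nth sw' ha.
  move: e1 e2 b1 b2 b (H a ha); rewrite /f; move: (nth _ w a) (nth _ w' a) (nth _ v a) => A B C.
  by clear -hi; rewrite /merge_letter; split_ifs.
Qed.

Lemma same_nested_last w w' : splits w m.+1 -> splits w' m.+1 ->
  (forall a, (a < n)%N -> nth 0%N w a = m.+1 -> nth 0%N w' a = m.+1) -> same w w'.
Proof.
move=> sw sw' H.
have [->|[a0 ha0 ne0]] := words_differ sw sw'; first exact: same_refl.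
pose f a := if nth 0%N w a == m.+1 then m.+1 else
  if nth 0%N w' a == m.+1 then m.+2 else nth 0%N v a.
apply: (@common_refinement w m.+1 w' m.+1 f m.+2 m.+1) => //; try lia.
- move=> a ha; have [e1 b1 b] := splits_nth sw ha.
  by rewrite /f; split_ifs.
- move=> j hj; case: (leqP j m.+1) => hji.
    have [|a ha ea] := splits_surj sw (j := j); first by lia.
    exists a => //; have [e1 b1 b] := splits_nth sw ha; have [e2 b2 _] := splits_nth sw' ha.
    move: e1 e2 b1 b2 b; rewrite /f ea; move: (nth _ w' a) (nth _ v a) => B C.
    by clear -hji hj; rewrite /merge_letter; split_ifs.
  exists a0 => //.
  have := H a0 ha0; have [e1 b1 b] := splits_nth sw ha0; have [e2 b2 _] := splits_nth sw' ha0.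
  move: e1 e2 b1 b2 b ne0; rewrite /f; move: (nth _ w a0) (nth _ w' a0) (nth _ v a0) => A B C.
  by clear -hj hji; rewrite /merge_letter; split_ifs.
- move=> a ha; have := H a ha; have [e1 b1 b] := splits_nth sw ha.
  have [e2 b2 _] := splits_nth sw' ha.
  move: e1 e2 b1 b2 b; rewrite /f; move: (nth _ w a) (nth _ w' a) (nth _ v a) => A B C.
  by clear; rewrite /merge_letter; split_ifs.
- move=> a ha; have := H a ha; have [e1 b1 b] := splits_nth sw ha.
  have [e2 b2 _] := splits_nth sw' ha.
  move: e1 e2 b1 b2 b; rewrite /f; move: (nth _ w a) (nth _ w' a) (nth _ v a) => A B C.
  by clear; rewrite /merge_letter; split_ifs.
Qed.

Definition split_at (i : nat) (B : pred nat) : seq nat :=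
  mkseq (fun a => let l := nth 0%N v a in
    if (l < i)%N then l else if l == i then (if B a then i.+1 else i) else l.+1) n.

Definition split_last (B : pred nat) : seq nat :=
  mkseq (fun a => let l := nth 0%N v a in
    if (l == 0%N) && B a then m.+1 else l) n.

Lemma nth_v_le a : (nth 0%N v a <= m)%N.
Proof.
have /packed_word/andP[_ /all_nthP h] := pv.
by have [/h|le] := ltnP a (size v); [apply | rewrite nth_default].
Qed.

Lemma v_surj j : (0 < j <= m)%N -> exists2 a, (a < n)%N & nth 0%N v a = j.
Proof. exact: packed_surj pv. Qed.

Lemma merge_mkseq i f : (forall a, (a < n)%N -> merge_letter m i (f a) = nth 0%N v a) ->
  map (merge_letter m i) (mkseq f n) = v.
Proof.
have /packed_word/andP[/eqP sz _] := pv => e.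
rewrite /mkseq -map_comp -[RHS](mkseq_nth 0%N) sz; apply/eq_in_map => a.
by rewrite mem_iota => ha; apply: e.
Qed.

Lemma splits_at i (B : pred nat) : (i <= m)%N ->
  (exists a, [/\ (a < n)%N, nth 0%N v a = i & B a]) ->
  ((0 < i)%N -> exists a, [/\ (a < n)%N, nth 0%N v a = i & ~~ B a]) ->
  splits (split_at i B) i.
Proof.
move=> hi [a [ha va Ba]] hB; split; last 1 first.
- apply: merge_mkseq => c hc; have := nth_v_le c; move: (nth 0%N v c) => l hl /=.
  by rewrite /merge_letter; split_ifs.
- apply: packed_mkseq => [c hc|j hj]; first by have := nth_v_le c; split_ifs.
  case: (ltngtP j i.+1) => hji.
  + have [eji|neji] := eqVneq j i.
      have [|b [hb vb Bb]] := hB; first by lia.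
      by exists b => //; rewrite vb /= ltnn eqxx (negbTE Bb).
    have [|b hb vb] := @v_surj j; first by lia.
    by exists b => //; rewrite vb /= ifT //; lia.
  + have [|b hb vb] := @v_surj j.-1; first by lia.
    by exists b => //; rewrite vb /=; split_ifs.
  + by exists a => //; rewrite va /= ltnn eqxx Ba.
- exact: leqW.
Qed.

Lemma splits_last (B : pred nat) :
  (exists a, [/\ (a < n)%N, nth 0%N v a = 0%N & B a]) ->
  splits (split_last B) m.+1.
Proof.
move=> [a [ha va Ba]]; split=> //.
- apply: packed_mkseq => [c hc|j hj].
    by move=> /=; have := nth_v_le c; case: ifP => _ ?; lia.
  case: (leqP j m) => hjm; last by exists a => //; rewrite va /= Ba /=; lia.
  have [|b hb vb] := @v_surj j; first by lia.
  by exists b => //; rewrite vb /= ifF //; apply/negbTE/negP => /andP[]; lia.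
- apply: merge_mkseq => c hc; have := nth_v_le c; move: (nth 0%N v c) => l hl /=.
  by case: ifP => [/andP[/eqP-> _]|_]; rewrite /merge_letter; split_ifs.
Qed.

Definition block_of (i : nat) : nat := if i == m.+1 then 0%N else i.

(** Cuts of different blocks are independent of each other. *)
Lemma same_blocks w i w' i' : splits w i -> splits w' i' ->
  block_of i <> block_of i' -> same w w'.
Proof.
have last_ u j u' : (0 < j <= m)%N -> splits u j -> splits u' m.+1 -> same u u'.
  move=> hj su su'; apply: (same_last su su'); first by case/andP: hj.
  move=> a ha ea; have [e1 b1 b] := splits_nth su ha; have [e2 b2 _] := splits_nth su' ha.
  move: e1 e2 b1 b; rewrite ea; move: (nth _ u a) (nth _ v a) => A C.
  by clear -hj; rewrite /merge_letter; split_ifs.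
move=> sw sw'; have [_ hi _] := sw; have [_ hi' _] := sw'.
rewrite /block_of; case: eqP => [ei|nei]; case: eqP => [ei'|nei'] // ne.
- by subst i; apply: same_sym; apply: (last_ _ i') => //; lia.
- by subst i'; apply: (last_ _ i) => //; lia.
have [lt|lt|e] := ltngtP i i'; last by case: ne.
  by apply: (same_lt sw sw'); lia.
by apply: same_sym; apply: (same_lt sw' sw); lia.
Qed.

Lemma nth_split_at i B a : (a < n)%N -> nth 0%N (split_at i B) a =
  (let l := nth 0%N v a in
    if (l < i)%N then l else if l == i then (if B a then i.+1 else i) else l.+1).
Proof. by move=> ha; rewrite nth_mkseq. Qed.

(** A cut can be moved, through nested cuts, to one that separates a single element. *)
Lemma same_single w i : splits w i -> (i <= m)%N -> exists a,
  [/\ (a < n)%N, nth 0%N v a = i, splits (split_at i (pred1 a)) i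
    & same w (split_at i (pred1 a))].
Proof.
move=> sw hi; have [|a ha ea] := splits_surj sw (j := i.+1); first by lia.
have [e1 b1 b] := splits_nth sw ha.
have va : nth 0%N v a = i by move: e1; rewrite ea /merge_letter; split_ifs.
have ss : splits (split_at i (pred1 a)) i.
  apply: splits_at => //; first by exists a; rewrite /= eqxx.
  move=> i0; have [|c hc ec] := splits_surj sw (j := i); first by lia.
  exists c; split=> //; first by have [e2 _ _] := splits_nth sw hc; move: e2; rewrite ec /merge_letter; split_ifs.
  by apply/eqP => eca; move: ec; rewrite eca ea; lia.
exists a; split=> //; apply: (same_nested sw ss hi) => c hc.
rewrite nth_split_at //=; have [e2 b2 b'] := splits_nth sw hc.
have [->|ne] := eqVneq c a; first by rewrite ea va ltnn eqxx.
move: e2 b2 b'; move: (nth _ w c) (nth _ v c) => A C.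
by clear -hi; rewrite /merge_letter; split_ifs.
Qed.

(** Separating a single element a or b is connected through the cut that separates both,
    which leaves something behind: a third element, or n+1 in the block 0. *)
Lemma same_singles i a b : (i <= m)%N -> (a < n)%N -> (b < n)%N ->
  nth 0%N v a = i -> nth 0%N v b = i ->
  ((0 < i)%N -> exists c, [/\ (c < n)%N, nth 0%N v c = i & c \notin [:: a; b]]) ->
  same (split_at i (pred1 a)) (split_at i (pred1 b)).
Proof.
move=> hi ha hb va vb third.
have valid (B : pred nat) : {subset B <= [:: a; b]} -> B a || B b -> splits (split_at i B) i.
  move=> sB nB; apply: splits_at => //.
    by case/orP: nB => ?; [exists a | exists b].
  move=> /third[c [hc vc nc]]; exists c; split=> //.
  by apply: contra nc; apply: sB.
have sa : splits (split_at i (pred1 a)) i.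
  by apply: valid => [c|]; rewrite ?inE /= ?eqxx // => /eqP ->; rewrite eqxx.
have sb : splits (split_at i (pred1 b)) i.
  by apply: valid => [c|]; rewrite ?inE /= ?eqxx ?orbT // => /eqP ->; rewrite eqxx orbT.
have sab : splits (split_at i (pred2 a b)) i.
  by apply: valid => [c|]; rewrite ?inE //= eqxx.
have nested (d : nat) : d = a \/ d = b -> splits (split_at i (pred1 d)) i ->
    same (split_at i (pred2 a b)) (split_at i (pred1 d)).
  move=> hd sd; apply: (same_nested sab sd hi) => c hc; rewrite !nth_split_at //=.
  case: ifP => // _; case: ifP => // _; case: eqP => [->|_]; last by case: ifP.
  by case: hd => ->; rewrite eqxx ?orbT.
apply: (same_trans sab); first by apply: same_sym; apply: nested; auto.
by apply: nested; auto.
Qed.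

(** If no block other than t can be split, then t contains all the elements in
    excess; as x has dimension at least 2, it has at least three elements, n+1 included. *)
Lemma other_block_or_large t : (t <= m)%N ->
  (exists w i, splits w i /\ block_of i <> t) \/
  ((if t == 0 then 1 else 2) < count_mem t v)%N.
Proof.
move=> ht; have /andP[/eqP sz le_v] := packed_word pv.
have [/existsP[l /andP[nlt hl]]|small] :=
    boolP [exists l : 'I_m, (l.+1 != t) && (1 < count_mem l.+1 v)%N].
  left; have [|a [ha va _]] := fresh_position (l := l.+1) (ps := [::]) sz; first exact: ltnW hl.
  have [|b [hb vb nb]] := fresh_position (l := l.+1) (ps := [:: a]) sz; first exact: hl.
  exists (split_at l.+1 (pred1 a)), l.+1; split.
    apply: splits_at; first exact: ltn_ord.
      by exists a; rewrite /= eqxx.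
    by move=> _; exists b; split=> //; move: nb; rewrite inE.
  by have := ltn_ord l; rewrite /block_of; move: nlt; split_ifs.
(* from here on, the blocks other than t and 0 are singletons *)
have le1 (l : 'I_m) : l.+1 != t -> (count_mem l.+1 v <= 1)%N.
  move=> nl; rewrite leqNgt; apply: contra small => h.
  by apply/existsP; exists l; rewrite nl.
have en : n = (count_mem 0 v + \sum_(i < m) count_mem i.+1 v)%N.
  by rewrite -sz (size_sum_count le_v) big_ord_recl.
case: eqP => [t0|/eqP t0].
  right; subst t; have : (\sum_(i < m) count_mem i.+1 v <= \sum_(i < m) 1)%N.
    by apply: leq_sum => i _; apply: le1.
  by rewrite sum_nat_const card_ord muln1; lia.
have [c0|c0] := posnP (count_mem 0%N v); last first.
  left; have [|a [ha va _]] := fresh_position (l := 0%N) (ps := [::]) sz; first by [].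
  exists (split_at 0 (pred1 a)), 0%N; split; last by rewrite /block_of /=; lia.
  by apply: splits_at => //; exists a; rewrite /= eqxx.
right; have htm : (t.-1 < m)%N by lia.
have et : t.-1.+1 = t by lia.
have hS : (\sum_(i < m) count_mem i.+1 v <= count_mem t v + m.-1)%N.
  rewrite (bigD1 (Ordinal htm)) //= et leq_add2l.
  apply: (@leq_trans (\sum_(i < m | i != Ordinal htm) 1)%N); last first.
    by rewrite sum_nat_const cardC1 card_ord muln1.
  apply: leq_sum => i ni; apply: le1; apply: contraNneq ni => ei.
  by apply/eqP/val_inj; rewrite /= -ei.
lia.
Qed.

(** A cut of the block of n+1 at its end, reduced to a single element b, is compatible
    with a cut at its beginning that separates another element. *)
Lemma same_last_single w : splits w m.+1 -> (1 < count_mem 0%N v)%N ->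
  exists a, [/\ (a < n)%N, nth 0%N v a = 0%N, splits (split_at 0 (pred1 a)) 0
    & same w (split_at 0 (pred1 a))].
Proof.
move=> sw large; have /andP[/eqP sz _] := packed_word pv.
have single a : (a < n)%N -> nth 0%N v a = 0%N -> splits (split_at 0 (pred1 a)) 0.
  by move=> ha va; apply: splits_at => //; exists a; rewrite /= eqxx.
have away u a : splits u m.+1 -> (a < n)%N -> nth 0%N v a = 0%N -> nth 0%N u a = 0%N ->
    same u (split_at 0 (pred1 a)).
  move=> su ha va ua; apply: same_sym; apply: (same_last (single a ha va) su) => //.
  move=> c hc ec; have [e _ _] := splits_nth su hc.
  have vc : nth 0%N v c = 0%N by rewrite -e ec /merge_letter leqnn eqxx.
  rewrite nth_split_at // vc /=; case: eqP => // eca.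
  by move: ec; rewrite eca ua.
have [b hb eb] : exists2 b, (b < n)%N & nth 0%N w b = m.+1.
  by apply: (splits_surj sw); rewrite leqnn.
have vb : nth 0%N v b = 0%N.
  by have [e _ _] := splits_nth sw hb; rewrite -e eb /merge_letter leqnn eqxx.
have [a [ha va nab]] := fresh_position (l := 0%N) (ps := [:: b]) sz large.
exists a; split=> //; first exact: single.
have sb : splits (split_last (pred1 b)) m.+1.
  by apply: splits_last; exists b; rewrite /= eqxx.
apply: (same_trans sb).
  apply: same_sym; apply: (same_nested_last sb sw) => c hc.
  rewrite nth_mkseq //=; case: ifP => [/andP[_ /eqP->] //|_ ec].
  by have := nth_v_le c; rewrite ec; lia.
apply: away => //; rewrite nth_mkseq //= va /=.
by move: nab; rewrite inE => /negbTE->.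
Qed.

(** Cuts of different blocks are adjacent, so cuts of the same block are
    connected through a cut of another block if there is one; otherwise the block is
    large enough to move the cuts to each other. *)
Lemma splits_connected w i w' i' : splits w i -> splits w' i' -> same w w'.
Proof.
move=> sw sw'; have [e|ne] := eqVneq (block_of i) (block_of i'); last first.
  by apply: (same_blocks sw sw'); apply/eqP.
have [_ hi _] := sw; have [_ hi' _] := sw'.
have [|[u [j [su nj]]]|large] := @other_block_or_large (block_of i).
- by rewrite /block_of; split_ifs.
- apply: (same_trans su); first by apply: (same_blocks sw su) => h; apply: nj.
  by apply: (same_blocks su sw'); rewrite -e.
have single u k : splits u k -> block_of k = block_of i -> exists a,
    [/\ (a < n)%N, nth 0%N v a = block_of i,
        splits (split_at (block_of i) (pred1 a)) (block_of i)
      & same u (split_at (block_of i) (pred1 a))].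
  move=> su ek; have [_ hk _] := su; rewrite -ek; move: large; rewrite -ek /block_of.
  case: (eqVneq k m.+1) => [ekm|nek] hl; last by apply: (same_single su); lia.
  by apply: same_last_single => //; rewrite -ekm.
have [a [ha va sa ssa]] := single w i sw erefl.
have [b [hb vb sb ssb]] := single w' i' sw' (esym e).
apply: (same_trans sa ssa); apply: (same_trans sb _ (same_sym ssb)).
apply: same_singles => //; first by rewrite /block_of; split_ifs.
move=> pos; have /andP[/eqP sz _] := packed_word pv.
by apply: (fresh_position sz); rewrite (gtn_eqF pos) in large.
Qed.

Lemma facets_connected y y' : facet y x -> facet y' x -> val y = val y'.
Proof.
move=> /(facet_word nx)[w [i [ny hi ew]]] /(facet_word nx)[w' [i' [ny' hi' ew']]].
have sw : splits w i by split=> //; apply: names_packed ny.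
have sw' : splits w' i' by split=> //; apply: names_packed ny'.
exact: splits_connected sw sw' _ _ ny ny'.
Qed.

End Connectivity.

(** * Uniqueness of incidence numbers *)

Section Uniqueness.
Variables (n : nat) (e : incidence (QP n)).
Local Notation cellT := (cell (QP n)).
Local Notation inc0 := (@incidence_number n).

Definition ratio (x y : cellT) : int := e x y * inc0 x y.

(** By [diamond], the sum in [inc_square] has only two nonzero terms. *)
Lemma sum_diamond (e' : incidence (QP n)) (x y y' z : cellT) :
  facet y x -> facet y' x -> facet z y -> facet z y' -> y != y' ->
  e' x y * e' y z = - (e' x y' * e' y' z).
Proof.
move=> yx y'x zy zy' ne; apply/eqP; rewrite -addr_eq0; apply/eqP.
have := inc_square e' x z; rewrite (bigD1 y) //= (bigD1 y') /=; last by rewrite eq_sym.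
rewrite big1 ?addr0 // => t /andP[ny ny'].
have [tx|ntx] := boolp.pselect (@facet (QP n) t x); last by rewrite (inc_nfacet e' ntx) mul0r.
have [zt|nzt] := boolp.pselect (@facet (QP n) z t); last by rewrite (inc_nfacet e' nzt) mulr0.
have [et|et] := diamond yx y'x tx zy zy' zt ne.
  by rewrite et eqxx in ny.
by rewrite et eqxx in ny'.
Qed.

Lemma ratio_diamond (x y y' z : cellT) :
  facet y x -> facet y' x -> facet z y -> facet z y' -> y != y' ->
  ratio x y * ratio y z = ratio x y' * ratio y' z.
Proof.
move=> yx y'x zy zy' ne.
have e1 := sum_diamond e yx y'x zy zy' ne.
have e2 := sum_diamond (explicit_incidence n) yx y'x zy zy' ne.
have signs (a b c d a' b' c' d' : int) : a * c = - (a' * c') -> b * d = - (b' * d') ->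
    a * b * (c * d) = a' * b' * (c' * d').
  by move=> h1 h2; rewrite mulrACA h1 h2 mulrNN mulrACA.
exact: signs e1 e2.
Qed.

Lemma ratio_edge (x y y' : cellT) : dim x = 1%N -> facet y x -> facet y' x ->
  ratio x y = ratio x y'.
Proof.
move=> hd f f'; have [|y1 [y2 [ne [f1 f2] sum0 only]]] := edge_facets hd.
  by exists y.
have sume : e x y1 + e x y2 = 0.
  by rewrite -(sum_edge ne only (fun y => @inc_nfacet _ e x y)) (inc_edge e hd).
have e12 : ratio x y1 = ratio x y2.
  rewrite /ratio; move/eqP: sum0; rewrite addr_eq0 => /eqP ->.
  by move/eqP: sume; rewrite addr_eq0 => /eqP ->; rewrite mulrNN.
case: (only y f) => ->; case: (only y' f') => ->;
  [exact: erefl | exact: e12 | exact: esym e12 | exact: erefl].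
Qed.

Lemma facetE (x y : cellT) : facet y x <-> inc0 x y != 0.
Proof.
split=> [/incidence_facet[]->//|ne].
have [//|/incidence_nfacet e0] := boolp.pselect (facet y x).
by rewrite e0 eqxx in ne.
Qed.

Lemma ratio2 (x y : cellT) : facet y x -> ratio x y * ratio x y = 1.
Proof.
by move=> f; rewrite /ratio; case: (inc_facet e f) => ->; case: (incidence_facet f) => ->.
Qed.

Lemma dim_facet (x y : cellT) : facet y x -> dim x = (dim y).+1.
Proof. by case. Qed.

(** The signs s are chosen by induction on the dimension: s x must be s y * ratio x y for
    any facet y of x.  This does not depend on y, by [ratio_edge] in dimension 1 and by
    [ratio_diamond] with [facets_connected] in higher dimensions. *)
Lemma ratio_coboundary d : exists s : cellT -> int,
  [/\ forall x, s x * s x = 1, forall x, dim x = 0%N -> s x = 1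
    & forall x y, (dim x <= d)%N -> facet y x -> ratio x y = s x * s y].
Proof.
elim: d => [|d [s [s2 s0 sd]]].
  exists (fun=> 1); split=> // x y; rewrite leqn0 => /eqP hd /dim_facet.
  by rewrite hd.
(* any facet may serve to define the sign of x; cells without facets get 1 *)
pose s' (x : cellT) : int := if dim x == d.+1 then
    (if [pick y | inc0 x y != 0] is Some y then s y * ratio x y else 1) else s x.
have well x y y' : dim x = d.+1 -> facet y x -> facet y' x ->
    s y * ratio x y = s y' * ratio x y'.
  move=> hx f f'; have hy := dim_facet f; have hy' := dim_facet f'.
  case: (posnP d) => [d0|d0].
    subst d; rewrite (ratio_edge hx f f') !s0 //; lia.
  have [m [v nx]] := cell_names x; have hd := names_dim nx.
  have hmn : (m.+2 <= n)%N by move: hx; rewrite /= hd; lia.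
  apply: (facets_connected nx hmn (val := fun y => s y * ratio x y)) f f'.
  move=> {hy hy'} {}y {}y' z f f' g g'; have [-> //|ne] := eqVneq y y'.
  have hy := dim_facet f; have hy' := dim_facet f'.
  have sy : s y = s z * ratio y z.
    by rewrite (sd y z) //; [rewrite mulrCA s2 mulr1 | lia].
  have sy' : s y' = s z * ratio y' z.
    by rewrite (sd y' z) //; [rewrite mulrCA s2 mulr1 | lia].
  have comm (p q q' r r' : int) : r * q = r' * q' -> p * q * r = p * q' * r'.
    by move=> E; rewrite -!mulrA (mulrC q) (mulrC q') E.
  by rewrite sy sy'; apply: comm; apply: ratio_diamond ne.
have facet_s' x y : dim x = d.+1 -> facet y x -> s' x = s y * ratio x y.
  move=> hx f; rewrite /s' hx eqxx; case: pickP => [y' /facetE f'|none].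
    exact: well.
  by move/facetE: f; rewrite none.
exists s'; split.
- move=> x; rewrite /s'; case: eqP => // hx; case: pickP => // y /facetE f.
  by rewrite mulrACA s2 ratio2.
- by move=> x hx; rewrite /s' hx s0.
move=> x y hx f; have hy := dim_facet f.
have ey : s' y = s y by rewrite /s'; case: eqP => // ?; lia.
have [ex|nex] := eqVneq (dim x) d.+1.
  by rewrite (facet_s' x y) // ey mulrAC s2 mul1r.
by rewrite ey /s' (negbTE nex); apply: sd => //; lia.
Qed.

Lemma incidence_unique : exists s : cellT -> int,
  (forall x, s x * s x = 1) /\ forall x y, e x y = s x * s y * inc0 x y.
Proof.
have [s [s2 _ sd]] := ratio_coboundary n.+1; exists s; split=> // x y.
have [f|nf] := boolp.pselect (facet y x); last first.
  by rewrite (inc_nfacet e nf) incidence_nfacet // mulr0.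
rewrite -sd //; last exact: leq_subr.
by rewrite /ratio -mulrA; case: (incidence_facet f) => ->; rewrite ?mulrNN !mulr1.
Qed.

End Uniqueness.

(** * Chains as invariant cochains *)

Lemma isomorphic_bijective (A B : zmodType) (f : A -> B) :
  (forall x y, f (x - y) = f x - f y) -> bijective f -> isomorphic A B.
Proof.
move=> fB bf.
pose F : {additive A -> B} := HB.pack f (GRing.isZmodMorphism.Build A B f fB).
by exists F.
Qed.

(** The first isomorphism theorem, phrased for maps on cycles. *)
Lemma homology_isomorphic (X : cell_complex) (e : incidence X) (i : int)
    (A : zmodType) (phi : cycle e i -> A) :
  (forall y z, phi (y - z) = phi y - phi z) ->
  (forall a, exists z, phi z = a) ->
  (forall z, phi z = 0 <-> z \in @is_boundary _ e i) ->
  isomorphic (homology e i) A.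
Proof.
move=> phiB surj ker.
have phi_eq y z : (phi y == phi z) = (y == z %[mod homology e i])%qT.
  rewrite -Quotient.idealrBE -subr_eq0 -phiB.
  by apply/eqP/idP => /ker.
have ex a : exists z, phi z == a by have [z <-] := surj a; exists z.
pose f (q : homology e i) := phi (repr q).
pose g a := (\pi_(homology e i) (xchoose (ex a)))%qT.
apply: (@isomorphic_bijective _ _ f).
  move=> p q; rewrite /f -phiB; apply/eqP; rewrite phi_eq.
  by rewrite reprK raddfB /= !reprK.
exists g.
  by move=> q; rewrite /g -[RHS]reprK; apply/eqP; rewrite -phi_eq (eqP (xchooseP (ex _))).
move=> a; rewrite /f /g -[RHS](eqP (xchooseP (ex a))); apply/eqP.
by rewrite phi_eq reprK.
Qed.

Section Chains.
Variables (n : nat) (e : incidence (QP n)) (s : cell (QP n) -> int).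
Local Notation cellT := (cell (QP n)).
Hypotheses (s2 : forall x, s x * s x = 1)
  (es : forall x y, e x y = s x * s y * @incidence_number n x y).

(** The signs s transport the chain to the explicit incidence numbers. *)
Definition word_cochain (m : nat) (c : chain (QP n)) : cochain :=
  lift_chain (n := n) m (fun x => s x * c x).

Lemma word_cochainE m w (x : cellT) c : names m w x ->
  word_cochain m c w = orient n m w * (s x * c x).
Proof. exact: lift_chainE. Qed.

Lemma word_cochain_out m c w : (~~ packed n m w) || (m <= 1)%N -> word_cochain m c w = 0.
Proof.
move=> h; rewrite /word_cochain /lift_chain big_pred0 ?mulr0 // => x.
by case/orP: h => h; rewrite /names ?(negbTE h) ?andbF // ltnNge h.
Qed.

Lemma normal_word_cochain m c : normal n m (word_cochain m c).
Proof.
move=> w j hw hj jw; apply: word_cochain_out; apply/orP; left.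
by apply: contra jw => /packedP[_]; apply.
Qed.

Lemma invariant_word_cochain m c : (1 < m)%N -> invariant n n m (word_cochain m c).
Proof.
move=> hm; split; first exact: normal_word_cochain.
move=> w hw; rewrite /flip; have [pw|npw] := boolP (packed n m w).
  have [x nx] := names_cell hm pw.
  rewrite (word_cochainE c nx) (word_cochainE c (names_reverse nx)).
  by rewrite (orient_reverse hm pw) !mulrA rev_sign2 mul1r.
rewrite !word_cochain_out ?npw ?mulr0 //.
apply/orP; left; apply: contra npw => /packed_reverse.
by rewrite (reverseK hw).
Qed.

Lemma word_cochainB m (c d : chain (QP n)) :
  word_cochain m (c - d) = (fun w => word_cochain m c w - word_cochain m d w).
Proof.
apply: boolp.funext => w; rewrite /word_cochain /lift_chain -mulrBr -sumrB.
by congr (_ * _); apply: eq_bigr => x _; rewrite !ffunE mulrBr.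
Qed.

Lemma word_cochain_boundary m c w : (0 < m)%N -> word n m.+1 w ->
  word_cochain m.+1 (boundary e c) w = delta m (word_cochain m c) w.
Proof.
move=> hm hw; have [pw|npw] := boolP (packed n m.+1 w); last first.
  rewrite word_cochain_out ?npw //; apply/esym.
  exact: (normal_unpacked (normal_delta (@normal_word_cochain m c)) hw npw).
have [y ny] := names_cell (hm : 1 < m.+1)%N pw.
rewrite (word_cochainE _ ny) ffunE.
rewrite (eq_bigr (fun x => s y * (s x * c x * incidence_number x y))); last first.
  by move=> x _; rewrite es; ring.
rewrite -mulr_sumr (boundary_lift _ ny) (mulrA (s y)) s2 mul1r.
by rewrite mulrA orient2 mul1r.
Qed.

Lemma homogeneousP (i : nat) (c : chain (QP n)) :
  reflect (forall x, dim x <> i -> c x = 0) (homogeneous i%:Z c).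
Proof.
apply: (iffP forallP) => h x.
  move=> hd; apply/eqP/negP => /negP c0; apply: hd.
  by have /implyP/(_ c0)/eqP[] := h x.
apply/implyP => c0; apply/eqP; congr Posz; apply/eqP; apply: contraNT c0 => /eqP hd.
by rewrite h.
Qed.

Lemma cell_degree (x : cellT) : exists m w, [/\ names m w x, (1 < m <= n)%N & dim x = (n - m)%N].
Proof.
have [m [w nx]] := cell_names x; exists m, w; split=> //; first exact: names_le nx.
exact: names_dim nx.
Qed.

Lemma word_cochain_inj m c d : (m <= n)%N ->
  homogeneous (n - m)%N%:Z c -> homogeneous (n - m)%N%:Z d ->
  (forall w, word n m w -> word_cochain m c w = word_cochain m d w) -> c = d.
Proof.
move=> hmn /homogeneousP hc /homogeneousP hd ecd; apply/ffunP => x.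
have [m' [w [nx hm' dx]]] := cell_degree x.
have [em|nem] := eqVneq m' m; last by rewrite hc ?hd //; rewrite dx; lia.
subst m'; have := ecd w (packed_word (names_packed nx)); rewrite !(word_cochainE _ nx).
move/(congr1 (fun t => s x * (orient n m w * t))).
by rewrite !(mulrA (orient n m w)) orient2 !mul1r !mulrA s2 !mul1r.
Qed.

(** The coefficient of a cell is read off at its chosen word; invariance takes care of the
    reversed word. *)
Lemma word_cochain_surj m f : (1 < m <= n)%N -> invariant n n m f ->
  exists2 c : chain (QP n), homogeneous (n - m)%N%:Z c &
    forall w, word n m w -> word_cochain m c w = f w.
Proof.
move=> /andP[hm hmn] [nf ef].
pose c : chain (QP n) := [ffun x : cellT => if (cell_word x).1 == m then
  s x * (orient n m (cell_word x).2 * f (cell_word x).2) else 0].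
exists c.
  apply/homogeneousP => x hd; rewrite ffunE; case: eqP => // em.
  by case: hd; have := names_dim (cell_wordP x); rewrite em.
move=> w hw; have [pw|npw] := boolP (packed n m w); last first.
  rewrite word_cochain_out ?npw //; apply/esym.
  exact: (normal_unpacked nf hw npw).
have [x nx] := names_cell hm pw; rewrite (word_cochainE _ nx) ffunE.
have [-> ew] := names_word nx (cell_wordP x).
rewrite eqxx (mulrA (s x)) s2 mul1r; case: ew => ->.
  by rewrite mulrA orient2 mul1r.
rewrite (orient_reverse hm pw) -[in RHS](ef w hw) /flip.
by rewrite [rev_sign n m * _]mulrC -mulrA mulrA orient2 mul1r.
Qed.

Lemma boundary_homogeneous m (c : chain (QP n)) : homogeneous (n - m)%N%:Z c ->
  (m < n)%N -> homogeneous (n - m.+1)%N%:Z (boundary e c).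
Proof.
move=> /homogeneousP hc hmn; apply/homogeneousP => y hd; rewrite ffunE big1 // => x _.
have [f|nf] := boolp.pselect (facet y x); last by rewrite (inc_nfacet e nf) mulr0.
rewrite hc ?mul0r // => dx; apply: hd; have := dim_facet f; rewrite dx.
by have [m' [w [_ hm' ->]]] := cell_degree y; lia.
Qed.

Lemma boundary_top (c : chain (QP n)) : homogeneous 0%:Z c -> boundary e c = 0.
Proof.
move=> /(homogeneousP 0) hc; apply/ffunP => y; rewrite !ffunE big1 // => x _.
have [f|nf] := boolp.pselect (facet y x); last by rewrite (inc_nfacet e nf) mulr0.
by rewrite hc ?mul0r // (dim_facet f).
Qed.

Lemma boundary_eq0 m (c : chain (QP n)) : (1 < m <= n)%N -> homogeneous (n - m)%N%:Z c ->
  (boundary e c = 0 <-> is_cocycle n m (word_cochain m c)).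
Proof.
move=> /andP[hm hmn] hc; split=> [bc w hw | cc].
  rewrite -word_cochain_boundary ?(ltnW hm) // bc /word_cochain /lift_chain.
  by rewrite big1 ?mulr0 // => x _; rewrite ffunE mulr0.
have [em|lt] := eqVneq m n; first by apply: boundary_top; move: hc; rewrite em subnn.
have hmn' : (m < n)%N by lia.
apply: (@word_cochain_inj m.+1) => //; first exact: boundary_homogeneous.
  by apply/homogeneousP => x _; rewrite ffunE.
move=> w hw; rewrite word_cochain_boundary ?(ltnW hm) // cc //.
by rewrite /word_cochain /lift_chain big1 ?mulr0 // => x _; rewrite ffunE mulr0.
Qed.

Lemma homogeneous_out (i : int) (c : chain (QP n)) :
  ~~ (0 <= i <= (n - 2)%N%:Z) -> homogeneous i c -> c = 0.
Proof.
move=> hi /forallP hc; apply/ffunP => x; rewrite ffunE; apply/eqP; apply/negPn/negP => c0.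
have /implyP/(_ c0)/eqP ei := hc x; have [m [w [_ hm dx]]] := cell_degree x.
by case/negP: hi; rewrite -ei dx; lia.
Qed.

Section Degree.
Variable m : nat.
Hypothesis hm : (1 < m <= n)%N.
Local Notation i := ((n - m)%N%:Z).

Lemma cycle_homogeneous (z : cycle e i) : homogeneous i (z : chain (QP n)).
Proof. by have := cycleP z; rewrite unfold_in => /andP[]. Qed.

Lemma cycle_invariant (z : cycle e i) : invariant n n m (word_cochain m z).
Proof. by apply: invariant_word_cochain; case/andP: hm. Qed.

Lemma cycle_cocycle (z : cycle e i) : is_cocycle n m (word_cochain m z).
Proof.
apply/(boundary_eq0 hm (cycle_homogeneous z)).
by have := cycleP z; rewrite unfold_in => /andP[_ /eqP].
Qed.

Lemma cocycle_cycle f : invariant n n m f -> is_cocycle n m f ->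
  exists z : cycle e i, forall w, word n m w -> word_cochain m z w = f w.
Proof.
move=> iF cf; have [c hc ec] := word_cochain_surj hm iF.
have zc : c \in is_cycle e i.
  rewrite unfold_in hc /=; apply/eqP/(boundary_eq0 hm hc) => w hw.
  by rewrite (eq_delta ec) // cf.
by exists (Cycle zc).
Qed.

Lemma boundary_invariant (z : cycle e i) : (2 < m)%N ->
  (z \in @is_boundary _ e i) <-> exists2 b, invariant n n m.-1 b &
    forall w, word n m w -> word_cochain m z w = delta m.-1 b w.
Proof.
move=> hm2; have /andP[hm1 hmn] := hm; have em : m.-1.+1 = m by lia.
have ei : i + 1 = (n - m.-1)%N%:Z by lia.
split=> [|[b ib eb]].
  rewrite unfold_in => /boolp.asboolP[b hb eb].
  exists (word_cochain m.-1 b); first by apply: invariant_word_cochain; lia.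
  move=> w hw; have hw' : word n m.-1.+1 w by rewrite em.
  by rewrite -word_cochain_boundary ?em ?eb //; lia.
rewrite unfold_in; apply/boolp.asboolP.
have [|c hc ec] := word_cochain_surj (m := m.-1) _ ib; first by lia.
exists c; first by rewrite ei.
apply: (word_cochain_inj hmn); last 1 first.
- move=> w hw; have hw' : word n m.-1.+1 w by rewrite em.
  have := word_cochain_boundary c (_ : 0 < m.-1)%N hw'; rewrite em => -> //; last by lia.
  by rewrite (eq_delta ec) // eb.
- have := boundary_homogeneous hc; rewrite em; apply; lia.
- exact: cycle_homogeneous.
Qed.

(** For m = 2 the cells have the top dimension, so only zero is a boundary. *)
Lemma boundary_top_degree (z : cycle e i) : m = 2 ->
  (z \in @is_boundary _ e i) <-> forall w, word n m w -> word_cochain m z w = 0.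
Proof.
move=> em; have /andP[hm1 hmn] := hm; split=> [|z0].
  rewrite unfold_in => /boolp.asboolP[b hb eb] w hw.
  have b0 : b = 0 by apply: (homogeneous_out _ hb); lia.
  rewrite -eb b0 raddf0 /word_cochain /lift_chain.
  by rewrite big1 ?mulr0 // => x _; rewrite ffunE mulr0.
rewrite unfold_in; apply/boolp.asboolP; exists 0; first exact: homogeneous0.
rewrite raddf0; apply/esym; apply: (word_cochain_inj hmn) => [||w hw].
- exact: cycle_homogeneous.
- exact: homogeneous0.
by rewrite z0 // /word_cochain /lift_chain big1 ?mulr0 // => x _; rewrite ffunE mulr0.
Qed.

End Degree.

End Chains.

(** * Homology *)

Section Masks.
Variable n : nat.

Definition mask_of (A : {set 'I_n}) : bitseq := [seq (i \in A) | i <- enum 'I_n].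

Definition set_of (s : bitseq) : {set 'I_n} := [set i : 'I_n | nth false s i].

Lemma size_mask_of A : size (mask_of A) = n.
Proof. by rewrite size_map size_enum_ord. Qed.

Lemma nth_mask_of A (i : 'I_n) : nth false (mask_of A) i = (i \in A).
Proof. by rewrite (nth_map i) ?size_enum_ord // nth_ord_enum. Qed.

Lemma mask_ofK A : set_of (mask_of A) = A.
Proof. by apply/setP => i; rewrite inE nth_mask_of. Qed.

Lemma set_ofK s : size s = n -> mask_of (set_of s) = s.
Proof.
move=> sz; apply: (@eq_from_nth _ false); rewrite size_mask_of // => i hi.
by rewrite (nth_mask_of _ (Ordinal hi)) inE.
Qed.

Lemma count_mask_of A : count id (mask_of A) = #|A|.
Proof. by rewrite count_map -sum1_count -sum1_card big_enum_cond. Qed.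

(** Sort the subsets by the size k of the complement. *)
Lemma card_subsets_ge m : (m <= n)%N ->
  #|[set A : {set 'I_n} | (m <= #|A|)%N]| = xi n (n - m).
Proof.
move=> hm; rewrite /xi -sum1_card.
rewrite (partition_big (fun A : {set 'I_n} => inord (n - #|A|) : 'I_(n - m).+1) xpredT) //=.
apply: eq_bigr => k _; have hk := ltn_ord k; rewrite sum1_card.
rewrite -(bin_sub (_ : k <= n)%N); last by lia.
have <- : #|[set A : {set 'I_n} | #|A| == (n - k)%N]| = 'C(n, n - k).
  by rewrite card_draws card_ord.
apply: eq_card => A; rewrite !inE.
have hA : (#|A| <= n)%N by rewrite -[n in (_ <= n)%N](card_ord n) max_card.
rewrite unfold_in /= inE; apply/andP/eqP => [[hmA /eqP <-]|eA].
  by rewrite inordK ?subKn // ltnS leq_sub2l.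
rewrite eA; split; first by lia.
by rewrite subKn ?inord_val //; lia.
Qed.

End Masks.

(** How invariants of classes that are indexed by a set K, jointly injective and
    arbitrary, give the group as a direct sum. *)
Lemma homology_direct_sum (X : cell_complex) (e : incidence X) (i : int)
    (I : finType) (K : {set I}) (G : zmodType) (psi : I -> cycle e i -> G) :
  (forall A y z, psi A (y - z) = psi A y - psi A z) ->
  (forall t : I -> G, exists z, forall A, A \in K -> psi A z = t A) ->
  (forall z, (forall A, A \in K -> psi A z = 0) <-> z \in @is_boundary _ e i) ->
  isomorphic (homology e i) (direct_sum #|K| G).
Proof.
move=> psiB surj ker.
pose phi z : direct_sum #|K| G := [ffun j => psi (enum_val j) z].
apply: (@homology_isomorphic _ _ _ _ phi).
- by move=> y z; apply/ffunP => j; rewrite !ffunE psiB.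
- move=> a; have [z hz] := surj (fun A => if [pick j | enum_val j == A] is Some j then a j else 0).
  exists z; apply/ffunP => j; rewrite ffunE hz ?enum_valP //.
  by case: pickP => [k /eqP/enum_val_inj -> //|/(_ j)]; rewrite eqxx.
move=> z; rewrite -ker; split=> [/ffunP h A KA|h].
  by have := h (enum_rank_in KA A); rewrite !ffunE enum_rankK_in.
by apply/ffunP => j; rewrite !ffunE h // enum_valP.
Qed.

Lemma Z2_intr_eq0 (x : int) : (x%:~R == 0 :> 'Z_2) = (2 %| x)%Z.
Proof.
have p2 : 2%N \in [pchar 'Z_2] by rewrite inE /= pchar_Zp.
by rewrite -(dvdz_pcharf p2).
Qed.

Section Homology.
Variables (n : nat) (e : incidence (QP n)).
Hypothesis n_ge2 : (2 <= n)%N.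

(** The half periods over the sets with m elements.  For m = 2 there are no boundaries, but
    also no nonzero invariant cochains in degree 1, so the criterion for coboundaries
    still applies. *)
Lemma homology_free m : (1 < m <= n)%N -> ~~ odd (n + m) ->
  isomorphic (homology e (n - m)%N%:Z) (direct_sum 'C(n, m) int).
Proof.
move=> hm ev; have /andP[hm1 hmn] := hm; have [s [s2 es]] := incidence_unique e.
rewrite -[in 'C(n, m)](card_ord n) -card_draws.
pose psi (A : {set 'I_n}) (z : cycle e (n - m)%N%:Z) : int :=
  half_period (mask_of A) m (word_cochain s m z).
have expo : exponent n m = 0 by rewrite /exponent (negbTE ev).
have det t : detects n m t = (count id t == m) by rewrite /detects (negbTE ev).
apply: (@homology_direct_sum _ _ _ _ _ _ psi).
- by move=> A y z; rewrite /psi word_cochainB half_periodB.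
- move=> t; have [|f [iF cf hf]] :=
      @invariant_cocycle_exists n n.+1 n m (fun b => t (set_of n b)) _ hm1; first by lia.
  have [z ez] := cocycle_cycle s2 es hm iF cf.
  exists z => A; rewrite inE => hA; rewrite /psi (eq_half_period (size_mask_of A) hm1 ez).
  have := hf _ (size_mask_of A); rewrite det count_mask_of hA expo => /(_ isT).
  by rewrite dvd0z subr_eq0 mask_ofK => /eqP.
move=> z; have iz := cycle_invariant s hm z; have cz := cycle_cocycle s2 es hm z.
have bz : (forall A, A \in [set A : {set 'I_n} | #|A| == m] -> psi A z = 0) ->
    exists2 b, invariant n n m.-1 b & forall w, word n m w -> word_cochain s m z w = delta m.-1 b w.
  move=> h; have em : m.-1.+1 = m by lia.
  have := @invariant_cocycle_boundary n n n m.-1 (word_cochain s m z).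
  rewrite em; apply=> //; try lia.
  move=> t sz; rewrite det expo dvd0z => ct.
  by rewrite -(set_ofK sz) -/(psi _ z) h // inE -count_mask_of set_ofK.
have [hm2|hm2] := ltnP 2 m.
  rewrite (boundary_invariant s2 es hm z hm2); split=> [//|[b ib eb] A].
  rewrite inE => hA; have em : m.-1.+1 = m by lia.
  rewrite /psi (eq_half_period (size_mask_of A) hm1 eb).
  have := @half_period_boundary n n m.-1 (mask_of A) b (size_mask_of A) _ ib.
  rewrite em det count_mask_of expo dvd0z => H.
  by apply/eqP; apply: H => //; lia.
have em : m = 2 by lia.
rewrite (boundary_top_degree s2 hm z em); split=> [/bz[b [nb eb] zb] w hw|z0 A _].
  rewrite zb //; subst m; rewrite /= /delta big1_seq // => i /andP[_].
  rewrite mem_index_iota => hi; set u := map _ w.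
  have hu : word n 1 u by apply: word_merge.
  have := eb u hu; rewrite /flip (_ : map (reverse_letter 1) u = u); last first.
    by rewrite -[RHS]map_id; apply: (eq_map_word hu) => -[|[|]].
  (* degree 1: the reversal is the identity on words, with sign -1 *)
  have nev : ~~ odd n by move: ev; rewrite addn2 /= negbK.
  rewrite /rev_sign binn exprD expr1 -signr_odd (negbTE nev) expr0 mul1r mulN1r.
  by move=> E; rewrite (_ : b u = 0) ?mulr0 //; lia.
rewrite /psi (eq_half_period (z' := fun=> 0 * 0) (size_mask_of A) hm1) => [|w hw].
  by rewrite half_periodZ mul0r.
by rewrite mul0r z0.
Qed.

Lemma homology_torsion m : (2 < m <= n)%N -> odd (n + m) ->
  isomorphic (homology e (n - m)%N%:Z) (direct_sum (xi n (n - m)) 'Z_2).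
Proof.
move=> /andP[hm2 hmn] od; have hm : (1 < m <= n)%N by rewrite ltnW.
have hm1 := ltnW hm2; have [s [s2 es]] := incidence_unique e.
rewrite -(card_subsets_ge hmn).
pose psi (A : {set 'I_n}) (z : cycle e (n - m)%N%:Z) : 'Z_2 :=
  (half_period (mask_of A) m (word_cochain s m z))%:~R.
have expo : exponent n m = 2 by rewrite /exponent od.
have det t : detects n m t = (m <= count id t)%N by rewrite /detects od.
have em : m.-1.+1 = m by lia.
apply: (@homology_direct_sum _ _ _ _ _ _ psi).
- by move=> A y z; rewrite /psi word_cochainB half_periodB rmorphB.
- move=> t; have [|f [iF cf hf]] :=
    @invariant_cocycle_exists n n.+1 n m (fun b => (t (set_of n b) : nat)%:Z) _ hm1; first by lia.
  have [z ez] := cocycle_cycle s2 es hm iF cf.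
  exists z => A; rewrite inE => hA; rewrite /psi (eq_half_period (size_mask_of A) hm1 ez).
  have := hf _ (size_mask_of A); rewrite det count_mask_of hA expo => /(_ isT).
  rewrite -Z2_intr_eq0 rmorphB /= subr_eq0 mask_ofK => /eqP ->.
  exact: natr_Zp.
move=> z; have iz := cycle_invariant s hm z; have cz := cycle_cocycle s2 es hm z.
rewrite (boundary_invariant s2 es hm z hm2); split=> [h|[b ib eb] A].
  have := @invariant_cocycle_boundary n n n m.-1 (word_cochain s m z).
  rewrite em; apply=> //; try lia.
  move=> t sz; rewrite det expo -Z2_intr_eq0 => ct.
  by rewrite -(set_ofK sz) -/(psi _ z) h // inE -count_mask_of set_ofK.
rewrite inE => hA; rewrite /psi (eq_half_period (size_mask_of A) hm1 eb).
apply/eqP; rewrite Z2_intr_eq0.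
have := @half_period_boundary n n m.-1 (mask_of A) b (size_mask_of A) _ ib.
by rewrite em det count_mask_of expo; apply=> //; lia.
Qed.

Lemma homology_top_odd : odd n ->
  isomorphic (homology e (n - 2)%N%:Z) (direct_sum (xi n (n - 2)) int).
Proof.
move=> od; have hm : (1 < 2 <= n)%N by rewrite n_ge2.
have [s [s2 es]] := incidence_unique e.
rewrite -(card_subsets_ge n_ge2).
pose psi (A : {set 'I_n}) (z : cycle e (n - 2)%N%:Z) : int :=
  potential (mask_of A) (word_cochain s 2 z).
apply: (@homology_direct_sum _ _ _ _ _ _ psi).
- by move=> A y z; rewrite /psi word_cochainB potentialB.
- move=> t; have [f [iF cf hf]] := top_cocycle_exists n (fun b => t (set_of n b)) od.
  have [z ez] := cocycle_cycle s2 es hm iF cf.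
  exists z => A; rewrite inE => hA; rewrite /psi (eq_potential (size_mask_of A) ez).
  by rewrite hf ?size_mask_of ?count_mask_of // mask_ofK.
move=> z; have iz := cycle_invariant s hm z; have cz := cycle_cocycle s2 es hm z.
rewrite (boundary_top_degree s2 hm z erefl); split=> [h|z0 A _].
  apply: (top_cocycle_eq0 od iz cz) => t sz ct.
  by rewrite -(set_ofK sz) -/(psi _ z) h // inE -count_mask_of set_ofK.
rewrite /psi (eq_potential (z := fun w => 0 - 0) (size_mask_of A)) => [|w hw].
  by rewrite (potentialB _ (fun=> 0) (fun=> 0)) subrr.
by rewrite z0.
Qed.

Lemma homology_out (i : int) : ~~ (0 <= i <= (n - 2)%N%:Z) ->
  forall h : homology e i, h = 0.
Proof.
move=> hi h; rewrite -[h]reprK (_ : repr h = 0) ?raddf0 //.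
apply: val_inj => /=; apply: (homogeneous_out hi).
by have := cycleP (repr h); rewrite unfold_in => /andP[].
Qed.

End Homology.

Close Scope ring_scope.

Theorem theorem1p6 (n : nat) (hn : (2 <= n)%N) :
  inhabited (incidence (QP n)) /\
  forall e : incidence (QP n),
    (~~ odd n ->
      [/\ forall i : nat, odd i -> (i <= n - 2)%N ->
            isomorphic (homology e i%:Z) (direct_sum (xi n i) 'Z_2),
          forall i : nat, ~~ odd i -> (i <= n - 2)%N ->
            isomorphic (homology e i%:Z) (direct_sum 'C(n, i) int)
        & forall i : int, ~~ (0 <= i <= (n - 2)%N%:Z)%R ->
            forall h : homology e i, h = 0%R]) /\
    (odd n ->
      [/\ isomorphic (homology e (n - 2)%N%:Z) (direct_sum (xi n (n - 2)) int),
          forall i : nat, odd i -> (i < n - 2)%N ->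
            isomorphic (homology e i%:Z) (direct_sum (xi n i) 'Z_2),
          forall i : nat, ~~ odd i -> (i <= n - 2)%N ->
            isomorphic (homology e i%:Z) (direct_sum 'C(n, i) int)
        & forall i : int, ~~ (0 <= i <= (n - 2)%N%:Z)%R ->
            forall h : homology e i, h = 0%R]).
Proof.
split; first exact: (inhabits (explicit_incidence n)).
move=> e.
have free i : ~~ odd i -> (i <= n - 2)%N ->
    isomorphic (homology e i%:Z) (direct_sum 'C(n, i) int).
  move=> ev hi; have hin : (i <= n)%N by lia.
  have := @homology_free n e hn (n - i); rewrite subKn // bin_sub //.
  by apply; [lia | rewrite oddD oddB // addKb].
have torsion i : odd i -> (i < n - 2)%N ->
    isomorphic (homology e i%:Z) (direct_sum (xi n i) 'Z_2).
  move=> od hi; have hin : (i <= n)%N by lia.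
  have := @homology_torsion n e hn (n - i); rewrite subKn //.
  by apply; [lia | rewrite oddD oddB // addKb].
split=> parity; split=> //.
- move=> i od hi; apply: torsion => //.
  rewrite ltn_neqAle hi andbT; apply: contraTneq od => ->.
  by rewrite oddB // addbF.
- exact: homology_out.
- exact: homology_top_odd.
- exact: homology_out.
Qed.
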